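(* Let $1\leq p\leq\infty$ and let $W:\mathbf{R}^d\to\mathbf{F}^{n\times n}$ be a matrix weight. Then the following are equivalent: (i) $W\in A_p$; (ii) $M:L^p_W(\mathbf{R}^d;\mathcal{K})\to L^p_W(\mathbf{R}^d;\mathcal{K})_{\mathrm{weak}}$. Moreover, $[W]_p$ and $\|M\|_{L^p_W(\mathbf{R}^d;\mathcal{K})\to L^p_W(\mathbf{R}^d;\mathcal{K})_{\mathrm{weak}}}$ are comparable, with comparability constants depending only on $d$ and $n$.
   Context: $d,n\ge 1$ are fixed integers, $\mathbf{F}$ is $\mathbf{R}$ or $\mathbf{C}$, $u\cdot v=\sum_{k=1}^n u_k\overline{v_k}$ and $|u|=|u\cdot u|^{1/2}$ on $\mathbf{F}^n$. $L^0(\mathbf{R}^d;\mathbf{F}^n)$ is the space of measurable functions $\mathbf{R}^d\to\mathbf{F}^n$ (modulo a.e. equality; Lebesgue measure). $p'$ is the Hölder conjugate of $p$. A cube is a cube in $\mathbf{R}^d$ with sides parallel to the coordinate axes. A matrix weight is a measurable $W:\mathbf{R}^d\to\mathbf{F}^{n\times n}$ that is Hermitian positive definite a.e. $L^p_W(\mathbf{R}^d;\mathbf{F}^n)$ is the space of $f\in L^0(\mathbf{R}^d;\mathbf{F}^n)$ with $\|f\|_{L^p_W(\mathbf{R}^d;\mathbf{F}^n)}:=\||Wf|\|_{L^p(\mathbf{R}^d)}<\infty$. $W\in A_p$ means $W^{-1}\in L^{p'}_{\mathrm{loc}}(\mathbf{R}^d;\mathbf{F}^{n\times n})$ and there is $C>0$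 such that for every cube $Q$ and every $u\in\mathbf{F}^n$ there is a non-zero $v\in\mathbf{F}^n$ with $$\Big(\frac1{|Q|}\int_Q|W(x)u|^p\,dx\Big)^{1/p}\Big(\frac1{|Q|}\int_Q|W(x)^{-1}v|^{p'}\,dx\Big)^{1/p'}\le C|u\cdot v|$$ (essential suprema for infinite exponents); the smallest $C$ is $[W]_p$. $\mathcal{K}$ is the collection of non-empty closed convex $K\subseteq\mathbf{F}^n$ that are symmetric: $\lambda u\in K$ for $u\in K$, $\lambda\in\mathbf{F}$, $|\lambda|=1$. $L^0(\mathbf{R}^d;\mathcal{K})$ is the set of $F:\mathbf{R}^d\to\mathcal{K}$ such that $\{x:F(x)\cap E\ne\emptyset\}$ is measurable for every measurable (equivalently, every open) $E\subseteq\mathbf{F}^n$. $S^0(\mathbf{R}^d;F)$ is the set of $f\in L^0(\mathbf{R}^d;\mathbf{F}^n)$ with $f(x)\in F(x)$ a.e. $L^p_W(\mathbf{R}^d;\mathcal{K})$ is the set of $F\in L^0(\mathbf{R}^d;\mathcal{K})$ with $\|F\|_{L^p_W(\mathbf{R}^d;\mathcal{K})}:=\sup_{f\in S^0(\mathbf{R}^d;F)}\|f\|_{L^p_W(\mathbf{R}^d;\mathbf{F}^n)}<\infty$ (all selections being in $L^p_W(\mathbf{R}^d;\mathbf{F}^n)$). $L^1_{\mathrm{loc}}(\mathbf{R}^d;\mathcal{K})$ is the set of $F\in L^0(\mathbf{R}^d;\mathcal{K})$ such that for each cube $Q$ the set $S^0(\mathbf{R}^d;F\mathbf{1}_Q)$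 is bounded in $L^1(\mathbf{R}^d;\mathbf{F}^n)$, where $F\mathbf{1}_Q$ equals $F$ on $Q$ and $\{0\}$ off $Q$. For such $F$, $\langle F\rangle_Q:=\{\frac1{|Q|}\int_Qf\,dx:f\in S^0(\mathbf{R}^d;F\mathbf{1}_Q)\}$ and $MF(x):=\overline{\bigcup_{Q\ni x}\langle F\rangle_Q}$ (all cubes $Q$ containing $x$). Statement (ii) means that $L^p_W(\mathbf{R}^d;\mathcal{K})\subseteq L^1_{\mathrm{loc}}(\mathbf{R}^d;\mathcal{K})$ and there is $C>0$ with $$\sup_{u\in\mathbf{F}^n}\|\mathbf{1}_{\{x\in\mathbf{R}^d:u\in MF(x)\}}u\|_{L^p_W(\mathbf{R}^d;\mathbf{F}^n)}\le C\|F\|_{L^p_W(\mathbf{R}^d;\mathcal{K})}$$ for all $F\in L^p_W(\mathbf{R}^d;\mathcal{K})$; the smallest $C$ is the operator norm $\|M\|_{L^p_W(\mathbf{R}^d;\mathcal{K})\to L^p_W(\mathbf{R}^d;\mathcal{K})_{\mathrm{weak}}}$. *)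

(* Defs.v *)
From HB Require Import structures.
From mathcomp Require Import all_boot all_order all_algebra.
From mathcomp Require Import complex.
From mathcomp Require Import all_classical all_reals all_analysis ess_sup_inf.

Set Implicit Arguments.
Unset Strict Implicit.
Unset Printing Implicit Defensive.

Import Order.TTheory GRing.Theory Num.Theory.
Import numFieldNormedType.Exports.

Local Open Scope classical_set_scope.
Local Open Scope ring_scope.

Lemma sigma_finite_prod d1 d2 (T1 : measurableType d1) (T2 : measurableType d2)
    (R : realType) (m1 : {sigma_finite_measure set T1 -> \bar R})
    (m2 : {sigma_finite_measure set T2 -> \bar R}) :
  sigma_finite setT (m1 \x m2)%E.
Proof.
have /sigma_finiteP[F [TF ndF Foo]] := sigma_finiteT m1.
have /sigma_finiteP[G [TG ndG Goo]] := sigma_finiteT m2.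
exists (fun n => F n `*` G n).
  rewrite -setXTT TF TG predeqE => -[x y]; split.
    move=> [/= [n _ Fnx] [k _ Gky]]; exists (maxn n k) => //; split.
    - by move: x Fnx; exact/subsetPset/ndF/leq_maxl.
    - by move: y Gky; exact/subsetPset/ndG/leq_maxr.
  by move=> [n _ []/= ? ?]; split; exists n.
move=> k; have [? ?] := Foo k; have [? ?] := Goo k.
split; first exact: measurableX.
by rewrite product_measure1E// lte_mul_pinfty// ge0_fin_numE.
Qed.

Section ConsMeasure.
Context (R : realType) (d : nat).

Local Notation RT := (measurableTypeR R).

Definition cons_pair (z : RT * d.-tuple RT) : d.+1.-tuple RT :=
  cons_tuple z.1 z.2.

Lemma measurable_cons_pair : measurable_fun setT cons_pair.
Proof. exact: measurable_cons. Qed.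

Definition cons_measure (m : {sigma_finite_measure set (d.-tuple RT) -> \bar R})
    : set (d.+1.-tuple RT) -> \bar R :=
  pushforward (lebesgue_measure \x m)%E cons_pair.

Section instances.
Variable m : {sigma_finite_measure set (d.-tuple RT) -> \bar R}.

Let mcp := measurable_cons_pair.

Let cons_measure0 : cons_measure m set0 = 0%E.
Proof. by rewrite /cons_measure /pushforward preimage_set0 measure0. Qed.

Let cons_measure_ge0 A : (0 <= cons_measure m A)%E.
Proof. exact: measure_ge0. Qed.

Let cons_measure_sigma_additive : semi_sigma_additive (cons_measure m).
Proof.
move=> F mF tF mUF; rewrite /cons_measure /pushforward preimage_bigcup.
apply: measure_semi_sigma_additive.
- by move=> n; rewrite -[X in measurable X]setTI; exact: mcp.
- apply/trivIsetP => /= i j _ _ ij; rewrite -preimage_setI.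
  by move/trivIsetP : tF => /(_ _ _ _ _ ij) ->//; rewrite preimage_set0.
- by rewrite -preimage_bigcup -[X in measurable X]setTI; exact: mcp.
Qed.

HB.instance Definition _ := isMeasure.Build _ _ _ (cons_measure m)
  cons_measure0 cons_measure_ge0 cons_measure_sigma_additive.

Let cons_measure_sigma_finite : sigma_finite setT (cons_measure m).
Proof.
have [F FT mF] := sigma_finite_prod lebesgue_measure m.
pose g (t : d.+1.-tuple RT) : RT * d.-tuple RT :=
  (tnth t ord0, [tuple of behead t]).
have mg : measurable_fun setT g.
  apply: measurable_fun_pair; first exact: measurable_tnth.
  exact: measurable_behead.
have gK : cancel cons_pair g.
  by move=> [x t]; rewrite /g /cons_pair /= tnth0; congr pair; exact/val_inj.
exists (fun k => g @^-1` F k).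
  by rewrite -preimage_bigcup -FT preimage_setT.
move=> k; split; first by rewrite -[X in measurable X]setTI; apply: mg (mF k).1.
rewrite /cons_measure /pushforward -comp_preimage.
rewrite (_ : g \o cons_pair = id); first exact: (mF k).2.
by apply/funext => z /=; exact: gK.
Qed.

HB.instance Definition _ := Measure_isSigmaFinite.Build _ _ _ (cons_measure m)
  cons_measure_sigma_finite.

End instances.
End ConsMeasure.

(* The Borel Lebesgue measure on R^d, as the d-fold product of the Lebesgue
   measure on R. *)
Fixpoint borel_lebesgue (R : realType) (d : nat) :
    {sigma_finite_measure set (d.-tuple (measurableTypeR R)) -> \bar R} :=
  match d with
  | 0%N => \d_[tuple]
  | d'.+1 => cons_measure (borel_lebesgue R d')
  end.

(* R^d with the sigma-algebra of Lebesgue-measurable sets (the Caratheodory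
   measurable sets of the outer measure induced by [borel_lebesgue]); the points
   are d-tuples of reals. *)
Definition euclid (R : realType) (d : nat) : Type :=
  caratheodory_type (mu_ext (borel_lebesgue R d)).
HB.instance Definition _ (R : realType) (d : nat) :=
  Measurable.on (euclid R d).

Definition lebesgue (R : realType) (d : nat) :
    {measure set (euclid R d) -> \bar R} :=
  @completed_measure_extension _ _ R (borel_lebesgue R d).

(* Open cubes.  Whether cubes are open, closed or half-open changes neither the
   averages over Q nor, since a cube can be enlarged slightly and a closure is
   taken there, the maximal operator below. *)
Definition cube (R : realType) (d : nat) (a : d.-tuple R) (l : R) :
    set (euclid R d) :=
  [set x : d.-tuple R |
    forall i : 'I_d, tnth a i < tnth x i /\ tnth x i < tnth a i + l].

Definition is_cube (R : realType) (d : nat) (Q : set (euclid R d)) : Prop :=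
  exists (a : d.-tuple R) (l : R), 0 < l /\ Q = cube a l.

Variant ground := RealField | ComplexField.

Definition ground_field (R : realType) (k : ground) : numFieldType :=
  match k with RealField => R | ComplexField => R[i] end.

Section Scalar.
Context (R : realType) (k : ground).
Local Notation F := (ground_field R k).

Definition re : F -> R :=
  match k return ground_field R k -> R with
  | RealField => fun z => z
  | ComplexField => fun z => complex.Re z
  end.

Definition im : F -> R :=
  match k return ground_field R k -> R with
  | RealField => fun=> 0
  | ComplexField => fun z => complex.Im z
  end.

(* [of_re_im x y] is x + iy; the imaginary part is dropped over R. *)
Definition of_re_im : R -> R -> F :=
  match k return R -> R -> ground_field R k with
  | RealField => fun x _ => x
  | ComplexField => fun x y => Complex x y
  end.

Definition conjugate (z : F) : F := of_re_im (re z) (- im z).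

(* The library norm of C takes its values in C. *)
Definition modulus (z : F) : R := re `|z|.

Definition dot n (u v : 'cV[F]_n) : F := \sum_i u i 0 * conjugate (v i 0).

Definition vnorm n (u : 'cV[F]_n) : R := Num.sqrt (modulus (dot u u)).

Definition mxnorm n (A : 'M[F]_n) : R :=
  Num.sqrt (\sum_i \sum_j modulus (A i j) ^+ 2).

Definition hermitian n (A : 'M[F]_n) : Prop := (map_mx conjugate A)^T = A.

(* In the order of C, 0 < z means that z is real and positive. *)
Definition posdef n (A : 'M[F]_n) : Prop :=
  hermitian A /\ forall u : 'cV[F]_n, u != 0 -> 0 < dot (A *m u) u.

Definition convex_body n (K : set 'cV[F]_n) : Prop :=
  [/\ K !=set0, closed K, convex_set (K : set (convex_lmodType 'cV[F]_n))
    & forall (c : F) (u : 'cV[F]_n), modulus c = 1 -> K u -> K (c *: u)].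

End Scalar.

Section Spaces.
Context (R : realType) (d n : nat) (k : ground).

Local Notation F := (ground_field R k).
Local Notation Rd := (euclid R d).
Local Notation V := 'cV[F]_n.
Local Notation M := 'M[F]_n.
Local Notation mu := (lebesgue R d).

Definition borel_fun (T : ptopologicalType) (f : Rd -> T) : Prop :=
  measurable_fun setT (f : Rd -> g_sigma_algebraType (@open T)).

Definition matrix_weight (W : Rd -> M) : Prop :=
  borel_fun W /\ {ae mu, forall x, posdef (W x)}.

Definition LpW_norm (p : \bar R) (W : Rd -> M) (f : Rd -> V) : \bar R :=
  Lnorm mu p (fun x => (vnorm (W x *m f x))%:E).

(* ((1/|Q|) \int_Q g^p)^(1/p), resp. the essential supremum of g on Q, for g
   nonnegative. *)
Definition avg_norm (p : \bar R) (Q : set Rd) (g : Rd -> R) : \bar R :=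
  match p with
  | r%:E => (((fine (mu Q))^-1)%:E * \int[mu]_(x in Q) (g x `^ r)%:E) `^ r^-1
  | +oo => ess_sup mu (fun x => (g x * \1_Q x)%:E)
  | -oo => 0
  end%E.

Definition inv_Lploc (p : \bar R) (W : Rd -> M) : Prop :=
  forall Q, is_cube Q ->
    (Lnorm mu p (fun x => (mxnorm (invmx (W x)) * \1_Q x)%:E) < +oo)%E.

Definition Ap_bound (p : \bar R) (W : Rd -> M) (C : R) : Prop :=
  forall Q, is_cube Q -> forall u : V, exists2 v : V, v != 0 &
    (avg_norm p Q (fun x => vnorm (W x *m u)) *
     avg_norm (hoelder_conjugate p) Q (fun x => vnorm (invmx (W x) *m v))
       <= (C * modulus (dot u v))%:E)%E.

Definition Ap (p : \bar R) (W : Rd -> M) : Prop :=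
  inv_Lploc (hoelder_conjugate p) W /\ exists2 C : R, 0 < C & Ap_bound p W C.

(* Meaningful only if [Ap p W]. *)
Definition Ap_const (p : \bar R) (W : Rd -> M) : R :=
  inf [set C : R | 0 < C /\ Ap_bound p W C].

(* For closed-valued maps on a complete sigma-finite measure space, it is the
   same to ask this for all open sets and for all Borel sets. *)
Definition measurable_body (G : Rd -> set V) : Prop :=
  (forall x, convex_body (G x)) /\
  forall E : set V, open E -> measurable [set x | G x `&` E !=set0].

Definition selections (G : Rd -> set V) : set (Rd -> V) :=
  [set f | borel_fun f /\ {ae mu, forall x, G x (f x)}].

Definition LpW_body_norm (p : \bar R) (W : Rd -> M) (G : Rd -> set V) : \bar R :=
  ereal_sup [set LpW_norm p W f | f in selections G].

Definition LpW_body (p : \bar R) (W : Rd -> M) (G : Rd -> set V) : Prop :=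
  measurable_body G /\ (LpW_body_norm p W G < +oo)%E.

Definition restrict_body (G : Rd -> set V) (Q : set Rd) (x : Rd) : set V :=
  if x \in Q then G x else [set 0].

Definition L1loc_body (G : Rd -> set V) : Prop :=
  measurable_body G /\
  forall Q, is_cube Q -> exists C : R,
    forall f, selections (restrict_body G Q) f ->
      (Lnorm mu 1 (fun x => (vnorm (f x))%:E) <= C%:E)%E.

Definition vintegral (Q : set Rd) (f : Rd -> V) : V :=
  \col_i of_re_im k (\int[mu]_(x in Q) re (f x i 0))
                    (\int[mu]_(x in Q) im (f x i 0)).

Definition body_average (G : Rd -> set V) (Q : set Rd) : set V :=
  [set of_re_im k (fine (mu Q))^-1 0 *: vintegral Q f
    | f in selections (restrict_body G Q)].

Definition maximal (G : Rd -> set V) (x : Rd) : set V :=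
  closure (\bigcup_(Q in [set Q | is_cube Q /\ Q x]) body_average G Q).

Definition weak_norm_at (p : \bar R) (W : Rd -> M) (G : Rd -> set V) (u : V) :
    \bar R :=
  LpW_norm p W (fun x => if u \in maximal G x then u else 0).

Definition weak_bound (p : \bar R) (W : Rd -> M) (C : R) : Prop :=
  forall G, LpW_body p W G ->
    (ereal_sup [set weak_norm_at p W G u | u in [set: V]]
       <= C%:E * LpW_body_norm p W G)%E.

Definition maximal_weak_type (p : \bar R) (W : Rd -> M) : Prop :=
  (forall G, LpW_body p W G -> L1loc_body G) /\
  exists2 C : R, 0 < C & weak_bound p W C.

(* Meaningful only if [maximal_weak_type p W]. *)
Definition maximal_weak_norm (p : \bar R) (W : Rd -> M) : R :=
  inf [set C : R | 0 < C /\ weak_bound p W C].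

End Spaces.

(* Main.v *)
Require Import Defs.
From mathcomp Require Import all_boot all_order all_algebra.
From mathcomp Require Import complex.
From mathcomp Require Import all_classical all_reals all_analysis ess_sup_inf.
From mathcomp Require Import measurable_realfun.
From mathcomp Require Import ring lra.

Set Implicit Arguments.
Unset Strict Implicit.
Unset Printing Implicit Defensive.

Import Order.TTheory GRing.Theory Num.Theory.
Import numFieldNormedType.Exports.

Local Open Scope classical_set_scope.
Local Open Scope ring_scope.

(** Write N(f) for the norm of |W f| in L^p, and p' for the conjugate exponent.
The weight class says exactly that, on every cube Q, the averages satisfy
N(<f>_Q 1_Q) <= C N(f) for f supported on Q, up to a factor 2: this is the
uniform boundedness of the averaging operators, and both implications go
through it.

From the weight class to the weak bound.  The inequality for averages is the
defining inequality tested at u = <f>_Q combined with Hoelder's inequality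
([mean_weight_le]).  Applied on the tripled cube to the same f it gives
N(<f>_Q 1_3Q) <= 3^d C N(f) ([mean_triple_le]).  Fix u <> 0.  The level set
{u in MF} is a countable intersection of unions of cubes carrying selections
with means w arbitrarily close to u ([maximalP], [near_mean_cover]).  Where
|W| is at most m |W u| / 2, a mean w within 1/m of u satisfies
|W u| <= 2 |W w|, so that the closure in the definition of M costs only a
factor 2 ([comparable_atP]).  Vitali's selection among finitely many cubes
([vitali_cubes]) and the gluing of selections over disjoint cubes into one
selection of F ([glue_selections]) then bound the norm of W u over such a piece
of the level set by 2 . 3^d C times the norm of F ([weak_step]); monotone
convergence removes the truncations.

From the weak bound to the weight class.  For f supported on Q the set-valued
map x |-> {w : |W(x) w| <= |W(x) f(x)|} has the norm of f and admits f as a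
selection, so its maximal function contains <f>_Q on Q, and the weak bound gives
N(<f>_Q 1_Q) <= C N(f) ([mean_le_of_weak]).  The set B of means of functions of
norm at most 1 is bounded and convex.  Given u <> 0, rescale it so that the norm
of W u 1_Q is 2C; then u has positive distance to B and is separated from it by
a vector v ([separation]).  Testing with f = phi W^-1 (W^-1 v), the converse of
Hoelder's inequality ([hoelder_converse]) bounds the norm of W^-1 v 1_Q in L^p'
by |Q| times the supremum of re (w . v) over w in B, hence by |Q| |u . v|
([dual_Lnorm_le], [dual_vector]).  The boundedness of B gives in the same way
the local integrability of the p'-th power of W^-1 ([inv_weight_lty]).

Each direction transports every admissible constant to an admissible constant
up to a factor depending on d only, hence the comparison of the infima.  All
estimates use the real inner product rdot = re (u . v), which treats real and
complex scalars simultaneously. *)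

Local Notation "'NN' m p '(' x '=>' e ')'" := (Lnorm m p (fun x => (e)%:E))
  (at level 10, m at level 8, p at level 8, x name, e at level 200,
   format "'NN'  m  p  '(' x  '=>'  e ')'").

(** * Scalars *)

Section Scalars.
Context (R : realType) (k : ground).
Local Notation F := (ground_field R k).
Local Notation re := (@re R k).
Local Notation im := (@im R k).
Implicit Types (x y z : F) (s t : R).

Definition real_scalar (t : R) : F := of_re_im k t 0.
Local Notation rs := real_scalar.

Lemma re_im_inj x y : re x = re y -> im x = im y -> x = y.
Proof.
by move: x y; rewrite /re /im /ground_field; case: k => //= -[a b] [c d] /= -> ->.
Qed.

Lemma reB : {morph re : x y / x - y}.
Proof. by rewrite /re /ground_field; case: k => //= -[a b] [c d]. Qed.

Lemma imB : {morph im : x y / x - y}.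
Proof.
by rewrite /im /ground_field; case: k => //= [? ?|[a b] [c d]] //=; rewrite subr0.
Qed.

Lemma re0 : re 0 = 0. Proof. by rewrite -(subrr 0) reB subrr. Qed.
Lemma im0 : im 0 = 0. Proof. by rewrite -(subrr 0) imB subrr. Qed.
Lemma reN : {morph re : x / - x}.
Proof. by move=> x; rewrite -[- x]sub0r reB re0 sub0r. Qed.
Lemma imN : {morph im : x / - x}.
Proof. by move=> x; rewrite -[- x]sub0r imB im0 sub0r. Qed.
Lemma reD : {morph re : x y / x + y}.
Proof. by move=> x y /=; rewrite -[in LHS](opprK y) reB reN opprK. Qed.
Lemma imD : {morph im : x y / x + y}.
Proof. by move=> x y /=; rewrite -[in LHS](opprK y) imB imN opprK. Qed.

Lemma re_sum I (r : seq I) (P : pred I) (f : I -> F) :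
  re (\sum_(i <- r | P i) f i) = \sum_(i <- r | P i) re (f i).
Proof. exact: (big_morph _ reD re0). Qed.
Lemma im_sum I (r : seq I) (P : pred I) (f : I -> F) :
  im (\sum_(i <- r | P i) f i) = \sum_(i <- r | P i) im (f i).
Proof. exact: (big_morph _ imD im0). Qed.

Lemma reM x y : re (x * y) = re x * re y - im x * im y.
Proof.
move: x y; rewrite /re /im /ground_field; case: k => /= [x y|[a b] [c d]] //=.
by rewrite mulr0 subr0.
Qed.

Lemma imM x y : im (x * y) = re x * im y + im x * re y.
Proof.
move: x y; rewrite /re /im /ground_field; case: k => /= [x y|[a b] [c d]] //=.
by rewrite mulr0 mul0r addr0.
Qed.

Lemma re1 : re 1 = 1.
Proof. by rewrite /re /ground_field; case: k. Qed.
Lemma im1 : im 1 = 0.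
Proof. by rewrite /im /ground_field; case: k. Qed.

Lemma re_of_re_im s t : re (of_re_im k s t) = s.
Proof. by rewrite /re /of_re_im; case: k. Qed.

Lemma of_re_imK z : of_re_im k (re z) (im z) = z.
Proof. by move: z; rewrite /re /im /of_re_im /ground_field; case: k => //= -[]. Qed.

(** Over the reals the second argument of [of_re_im] is dropped, but there every
imaginary part vanishes. *)
Lemma im_of_re_im s t z : im (of_re_im k s (t * im z)) = t * im z.
Proof.
by move: z; rewrite /im /of_re_im /ground_field; case: k => //= z; rewrite mulr0.
Qed.

Lemma im_of_re_im_le s t : `|im (of_re_im k s t)| <= `|t|.
Proof. by rewrite /im /of_re_im; case: k => //=; rewrite normr0. Qed.

Lemma re_rs t : re (rs t) = t. Proof. exact: re_of_re_im. Qed.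
Lemma im_rs t : im (rs t) = 0.
Proof. by rewrite /rs -[X in of_re_im _ _ X](mul0r (im 0)) im_of_re_im mul0r. Qed.

Lemma re_rsM t z : re (rs t * z) = t * re z.
Proof. by rewrite reM re_rs im_rs mul0r subr0. Qed.
Lemma im_rsM t z : im (rs t * z) = t * im z.
Proof. by rewrite imM re_rs im_rs mul0r addr0. Qed.

Lemma rs0 : rs 0 = 0.
Proof. by apply: re_im_inj; rewrite ?re_rs ?im_rs ?re0 ?im0. Qed.
Lemma rs1 : rs 1 = 1.
Proof. by apply: re_im_inj; rewrite ?re_rs ?im_rs ?re1 ?im1. Qed.
Lemma rsM : {morph rs : s t / s * t}.
Proof.
move=> s t; apply: re_im_inj; rewrite ?re_rsM ?im_rsM ?re_rs ?im_rs ?mulr0//.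
Qed.

Lemma re_conj z : re (conjugate z) = re z.
Proof. exact: re_of_re_im. Qed.
Lemma im_conj z : im (conjugate z) = - im z.
Proof. by rewrite /conjugate -mulN1r im_of_re_im. Qed.

Lemma modulusE z : modulus z = Num.sqrt (re z ^+ 2 + im z ^+ 2).
Proof.
move: z; rewrite /modulus /re /im /ground_field; case: k => //= z.
  by rewrite expr0n addr0 sqrtr_sqr.
by case: z.
Qed.

Lemma modulus_ge0 z : 0 <= modulus z.
Proof. by rewrite modulusE sqrtr_ge0. Qed.

Lemma modulus_sqr z : modulus z ^+ 2 = re z ^+ 2 + im z ^+ 2.
Proof. by rewrite modulusE sqr_sqrtr// addr_ge0// sqr_ge0. Qed.

Lemma modulus0 : modulus (0 : F) = 0.
Proof. by rewrite modulusE re0 im0 expr0n addr0 sqrtr0. Qed.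

Lemma modulus_eq0 z : modulus z = 0 -> z = 0.
Proof.
move=> z0; have := modulus_sqr z; rewrite z0 expr0n/= => /esym/eqP.
rewrite paddr_eq0 ?sqr_ge0// !sqrf_eq0 => /andP[/eqP a /eqP b].
by apply: re_im_inj; rewrite ?re0 ?im0.
Qed.

Lemma modulusM x y : modulus (x * y) = modulus x * modulus y.
Proof.
rewrite !modulusE -sqrtrM ?addr_ge0 ?sqr_ge0//; congr Num.sqrt.
rewrite reM imM; ring.
Qed.

Lemma modulus_rs t : modulus (rs t) = `|t|.
Proof. by rewrite modulusE re_rs im_rs expr0n addr0 sqrtr_sqr. Qed.

Lemma normr_le_sqrt (a b : R) : a ^+ 2 <= b -> `|a| <= Num.sqrt b.
Proof. by move=> ab; rewrite -sqrtr_sqr ler_wsqrtr. Qed.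

Lemma re_le_modulus z : `|re z| <= modulus z.
Proof. by rewrite modulusE normr_le_sqrt// lerDl sqr_ge0. Qed.
Lemma im_le_modulus z : `|im z| <= modulus z.
Proof. by rewrite modulusE normr_le_sqrt// lerDr sqr_ge0. Qed.

Lemma modulus_le_re_im z : modulus z <= `|re z| + `|im z|.
Proof.
rewrite modulusE -(@ger0_norm _ (`|re z| + _)) ?addr_ge0// -sqrtr_sqr.
rewrite ler_wsqrtr// sqrrD !real_normK ?num_real//.
by rewrite lerD2r lerDl mulrn_wge0// mulr_ge0.
Qed.

(** In the order of the complex numbers an inequality forces equal imaginary
parts, so comparing norms amounts to comparing real parts. *)
Lemma norm_ltE z (e : F) : 0 < e -> (`|z| < e) = (modulus z < re e).
Proof.
move: z e; rewrite /modulus /re /ground_field; case: k => //= -[a b] [c d].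
rewrite !ltcE/= => /andP[/eqP -> _].
by rewrite eqxx.
Qed.

Lemma re_gt0 (e : F) : 0 < e -> 0 < re e.
Proof.
move: e; rewrite /re /ground_field; case: k => //= -[c d].
by rewrite !ltcE/= => /andP[_].
Qed.

Lemma rs_gt0 t : 0 < t -> 0 < rs t.
Proof.
by rewrite /rs /of_re_im /ground_field; case: k => //= t0; rewrite ltcE/= eqxx.
Qed.

Lemma rs_re_gt0 (e : F) : 0 < e -> rs (re e) = e.
Proof.
move: e; rewrite /rs /of_re_im /re /ground_field; case: k => //= -[c d].
by rewrite !ltcE/= => /andP[/eqP -> _].
Qed.
Lemma rs_re_ge0 (e : F) : 0 <= e -> rs (re e) = e.
Proof.
by rewrite le0r => /predU1P[->|/rs_re_gt0//]; rewrite re0 rs0.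
Qed.

Lemma re_ge0 (e : F) : 0 <= e -> 0 <= re e.
Proof. by rewrite le0r => /predU1P[->|/re_gt0/ltW//]; rewrite re0. Qed.

End Scalars.
Arguments real_scalar {R} k t.

Section Vectors.
Context (R : realType) (k : ground).
Local Notation F := (ground_field R k).
Local Notation re := (@re R k).
Local Notation im := (@im R k).
Local Notation rs := (real_scalar k).

Definition rdot n (u v : 'cV[F]_n) : R := re (dot u v).

Section fixed_dim.
Context (n : nat).
Implicit Types (u v w : 'cV[F]_n) (t : R) (c : F) (A : 'M[F]_n).

Lemma rdotE u v :
  rdot u v = \sum_i (re (u i 0) * re (v i 0) + im (u i 0) * im (v i 0)).
Proof.
rewrite /rdot /dot re_sum; apply: eq_bigr => i _.
by rewrite reM re_conj im_conj mulrN opprK.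
Qed.

Lemma rdotC u v : rdot u v = rdot v u.
Proof. by rewrite !rdotE; apply: eq_bigr => i _; rewrite mulrC [X in _ + X]mulrC. Qed.

Lemma rdotDl u v w : rdot (u + v) w = rdot u w + rdot v w.
Proof.
rewrite !rdotE -big_split; apply: eq_bigr => i _ /=.
by rewrite mxE reD imD; ring.
Qed.

Lemma rdotZl t u v : rdot (rs t *: u) v = t * rdot u v.
Proof.
rewrite !rdotE big_distrr; apply: eq_bigr => i _ /=.
by rewrite mxE re_rsM im_rsM; ring.
Qed.

Lemma rdotDr u v w : rdot w (u + v) = rdot w u + rdot w v.
Proof. by rewrite ![rdot w _]rdotC rdotDl. Qed.
Lemma rdotZr t u v : rdot v (rs t *: u) = t * rdot v u.
Proof. by rewrite ![rdot v _]rdotC rdotZl. Qed.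

Lemma rsN1 u : rs (-1) *: u = - u.
Proof.
rewrite -[RHS]scaleN1r; congr (_ *: _).
by apply: re_im_inj; rewrite ?re_rs ?im_rs ?reN ?imN ?re1 ?im1 ?oppr0.
Qed.

Lemma rdotNl u v : rdot (- u) v = - rdot u v.
Proof. by rewrite -rsN1 rdotZl mulN1r. Qed.
Lemma rdotNr u v : rdot u (- v) = - rdot u v.
Proof. by rewrite rdotC rdotNl rdotC. Qed.

Lemma rdot0l v : rdot 0 v = 0.
Proof. by rewrite -(scale0r v) -(rs0 R k) rdotZl mul0r. Qed.

Lemma rdot_ge0 u : 0 <= rdot u u.
Proof. by rewrite rdotE sumr_ge0// => i _; rewrite -!expr2 addr_ge0 ?sqr_ge0. Qed.

Lemma im_dot_diag u : im (dot u u) = 0.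
Proof.
rewrite /dot im_sum big1// => i _.
by rewrite imM re_conj im_conj mulrN mulrC addrC subrr.
Qed.

Lemma vnormE u : vnorm u = Num.sqrt (rdot u u).
Proof.
rewrite /vnorm modulusE im_dot_diag expr0n addr0 sqrtr_sqr.
by rewrite ger0_norm// rdot_ge0.
Qed.

Lemma vnorm_ge0 u : 0 <= vnorm u. Proof. by rewrite vnormE sqrtr_ge0. Qed.

Lemma vnorm_sqr u : vnorm u ^+ 2 = rdot u u.
Proof. by rewrite vnormE sqr_sqrtr// rdot_ge0. Qed.

Lemma vnorm_sqrE u : vnorm u ^+ 2 = \sum_i modulus (u i 0) ^+ 2.
Proof.
by rewrite vnorm_sqr rdotE; apply: eq_bigr => i _; rewrite modulus_sqr !expr2.
Qed.

Lemma modulus_le_vnorm u i : modulus (u i 0) <= vnorm u.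
Proof.
rewrite -(ger0_norm (modulus_ge0 _)) vnormE normr_le_sqrt//.
rewrite -vnorm_sqr vnorm_sqrE (bigD1 i)//= lerDl.
by apply: sumr_ge0 => j _; rewrite sqr_ge0.
Qed.

Lemma sqrt_sum_le I (r : seq I) (a : I -> R) : (forall i, 0 <= a i) ->
  Num.sqrt (\sum_(i <- r) a i ^+ 2) <= \sum_(i <- r) a i.
Proof.
move=> a0; have s0 (q : seq I) : 0 <= \sum_(i <- q) a i by apply: sumr_ge0.
rewrite -(ger0_norm (s0 r)) -sqrtr_sqr ler_wsqrtr//.
elim: r => [|i r ih]; first by rewrite !big_nil expr0n.
rewrite !big_cons sqrrD -addrA lerD2l (le_trans ih)// lerDr.
by rewrite mulrn_wge0// mulr_ge0.
Qed.

Lemma vnorm_le_sum u : vnorm u <= \sum_i modulus (u i 0).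
Proof.
rewrite vnormE -vnorm_sqr vnorm_sqrE; apply: sqrt_sum_le => i; exact: modulus_ge0.
Qed.

Lemma vnorm_eq0 u : vnorm u = 0 -> u = 0.
Proof.
move=> u0; apply/matrixP => i j; rewrite ord1 mxE; apply: modulus_eq0.
by apply/eqP; rewrite eq_le modulus_ge0 andbT -u0 modulus_le_vnorm.
Qed.

Lemma vnorm0 : vnorm (0 : 'cV[F]_n) = 0.
Proof. by rewrite vnormE rdot0l sqrtr0. Qed.

Lemma vnorm_gt0 u : u != 0 -> 0 < vnorm u.
Proof.
move=> u0; rewrite lt_neqAle vnorm_ge0 andbT eq_sym.
by apply: contra u0 => /eqP/vnorm_eq0 ->.
Qed.

Lemma vnormZ c u : vnorm (c *: u) = modulus c * vnorm u.
Proof.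
apply/eqP; rewrite -(@eqrXn2 _ 2) ?mulr_ge0 ?vnorm_ge0 ?modulus_ge0//.
rewrite exprMn !vnorm_sqrE big_distrr/=; apply/eqP/eq_bigr => i _.
by rewrite mxE modulusM exprMn.
Qed.

Lemma vnormN u : vnorm (- u) = vnorm u.
Proof. by rewrite -rsN1 vnormZ modulus_rs normrN1 mul1r. Qed.

Lemma vnormB u v : vnorm (u - v) = vnorm (v - u).
Proof. by rewrite -vnormN opprB. Qed.

Lemma vnorm_sqrD u v :
  vnorm (u + v) ^+ 2 = vnorm u ^+ 2 + 2 * rdot u v + vnorm v ^+ 2.
Proof. by rewrite !vnorm_sqr rdotDl !rdotDr (rdotC v u); ring. Qed.

Lemma cauchy_schwarz u v : rdot u v <= vnorm u * vnorm v.
Proof.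
have [->|v0] := eqVneq v 0; first by rewrite rdotC rdot0l vnorm0 mulr0.
rewrite (le_trans (ler_norm _))// !vnormE -sqrtrM ?rdot_ge0// normr_le_sqrt//.
have b0 : 0 < rdot v v by rewrite -vnorm_sqr exprn_gt0// vnorm_gt0.
have := rdot_ge0 (rs (rdot v v) *: u + rs (- rdot u v) *: v).
rewrite rdotDl !rdotDr !rdotZl !rdotZr (rdotC v u).
set a := rdot u u; set b := rdot v v; set c := rdot u v => h.
have : 0 <= b * (a * b - c ^+ 2).
  by apply: le_trans h _; rewrite le_eqVlt; apply/orP; left; apply/eqP; ring.
by rewrite pmulr_rge0// subr_ge0.
Qed.

Lemma vnormD u v : vnorm (u + v) <= vnorm u + vnorm v.
Proof.
rewrite -(@ler_pXn2r _ 2) ?nnegrE ?addr_ge0 ?vnorm_ge0//.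
rewrite vnorm_sqrD sqrrD lerD2r lerD2l mulr2n mulrDl mul1r.
by rewrite lerD// cauchy_schwarz.
Qed.

Lemma dotZr c u v : dot u (c *: v) = conjugate c * dot u v.
Proof.
rewrite /dot big_distrr/=; apply: eq_bigr => i _.
rewrite mxE mulrCA; congr (_ * _).
by apply: re_im_inj; rewrite ?(reM, imM, re_conj, im_conj); ring.
Qed.

Lemma dotZl c u v : dot (c *: u) v = c * dot u v.
Proof.
by rewrite /dot big_distrr/=; apply: eq_bigr => i _; rewrite mxE mulrA.
Qed.

Lemma rdot_le_modulus u v : rdot u v <= modulus (dot u v).
Proof. exact: le_trans (ler_norm _) (re_le_modulus _). Qed.

(** Rotating the second argument turns the modulus of the inner product into a
real inner product, so that all estimates can be made with the latter. *)
Lemma phase u v :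
  exists2 c : F, modulus c = 1 & rdot u (c *: v) = modulus (dot u v).
Proof.
set z := dot u v; have [z0|z0] := eqVneq z 0.
  exists 1; first by rewrite -(rs1 R k) modulus_rs normr1.
  by rewrite scale1r z0 modulus0 /rdot -/z z0 re0.
have m0 : 0 < modulus z.
  by rewrite lt_neqAle modulus_ge0 andbT eq_sym; apply: contra z0 => /eqP/modulus_eq0->.
exists (rs (modulus z)^-1 * z).
  by rewrite modulusM modulus_rs ger0_norm ?invr_ge0 ?ltW// mulVf ?gt_eqF.
rewrite /rdot dotZr reM re_conj im_conj re_rsM im_rsM -/z.
transitivity ((modulus z)^-1 * modulus z ^+ 2); first by rewrite modulus_sqr; ring.
by rewrite expr2 mulrA mulVf ?gt_eqF// mul1r.
Qed.

Lemma modulus_dot_le u v : modulus (dot u v) <= vnorm u * vnorm v.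
Proof.
have [c c1 <-] := phase u v.
by rewrite (le_trans (cauchy_schwarz _ _))// vnormZ c1 mul1r.
Qed.

Lemma mxnorm_ge0 A : 0 <= mxnorm A. Proof. exact: sqrtr_ge0. Qed.

Lemma vnorm_mulmx_le A u : vnorm (A *m u) <= mxnorm A * vnorm u.
Proof.
rewrite -(@ler_pXn2r _ 2) ?nnegrE ?mulr_ge0 ?vnorm_ge0 ?mxnorm_ge0//.
rewrite exprMn [mxnorm A ^+ 2]sqr_sqrtr; last first.
  by rewrite sumr_ge0// => i _; rewrite sumr_ge0// => j _; rewrite sqr_ge0.
rewrite vnorm_sqrE big_distrl/=; apply: ler_sum => i _.
pose a : 'cV[F]_n := \col_j A i j; pose b : 'cV[F]_n := \col_j conjugate (u j 0).
have -> : (A *m u) i 0 = dot a b.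
  rewrite mxE; apply: eq_bigr => j _; rewrite !mxE; congr (_ * _).
  by apply: re_im_inj; rewrite ?(re_conj, im_conj) ?opprK.
have -> : \sum_j modulus (A i j) ^+ 2 = vnorm a ^+ 2.
  by rewrite vnorm_sqrE; apply: eq_bigr => j _; rewrite mxE.
have <- : vnorm b ^+ 2 = vnorm u ^+ 2.
  rewrite !vnorm_sqrE; apply: eq_bigr => j _; rewrite mxE.
  by rewrite !modulus_sqr re_conj im_conj sqrrN.
by rewrite -exprMn lerXn2r ?nnegrE ?mulr_ge0 ?vnorm_ge0 ?modulus_ge0// modulus_dot_le.
Qed.

Lemma mxnorm_le_sum A : mxnorm A <= \sum_j vnorm (A *m delta_mx j 0).
Proof.
rewrite /mxnorm exchange_big/=.
under eq_bigr => j _.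
  have -> : \sum_i modulus (A i j) ^+ 2 = vnorm (A *m delta_mx j 0 : 'cV_n) ^+ 2.
    by rewrite vnorm_sqrE; apply: eq_bigr => i _; rewrite -colE mxE.
  over.
by apply: sqrt_sum_le => j; exact: vnorm_ge0.
Qed.

Lemma rdot_hermitian A u v : Defs.hermitian A -> rdot (A *m u) v = rdot u (A *m v).
Proof.
move=> hA; congr re; rewrite /dot.
under eq_bigr do rewrite mxE big_distrl/=.
rewrite exchange_big/=; apply: eq_bigr => j _.
transitivity (u j 0 * \sum_i (A i j * conjugate (v i 0))).
  by rewrite big_distrr/=; apply: eq_bigr => i _; rewrite mulrCA mulrA.
congr (_ * _).
have conjM (x y : F) : conjugate (x * y) = conjugate x * conjugate y.
  by apply: re_im_inj; rewrite ?(reM, imM, re_conj, im_conj); ring.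
have conjD (x y : F) : conjugate (x + y) = conjugate x + conjugate y.
  by apply: re_im_inj; rewrite ?(reD, imD, re_conj, im_conj); ring.
have conj0 : conjugate (0 : F) = 0.
  by apply: re_im_inj; rewrite ?(re_conj, im_conj) ?re0 ?im0 ?oppr0.
rewrite mxE (big_morph _ conjD conj0); apply: eq_bigr => i _.
by rewrite conjM -[in LHS]hA !mxE.
Qed.

Lemma posdef_unitmx A : posdef A -> A \in unitmx.
Proof.
move=> [_ pA]; rewrite unitmxE unitfE -det_tr; apply/negP => /det0P[v v0 vA].
have Av : A *m v^T = 0 by rewrite -[A]trmxK -trmx_mul vA trmx0.
have := pA v^T; rewrite -(inj_eq trmx_inj) trmxK trmx0 => /(_ v0).
rewrite Av /dot big1 ?ltxx// => i _.
by rewrite mxE mul0r.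
Qed.

End fixed_dim.

Lemma nbhs_mx m n (A : 'M[F]_(m, n)) (E : set 'M[F]_(m, n)) :
  nbhs A E <-> exists2 e : R, 0 < e &
    forall B : 'M[F]_(m, n), (forall i j, modulus (B i j - A i j) < e) -> E B.
Proof.
split.
  move=> /nbhs_ballP[e /= e0 eE]; exists (re e); first exact: re_gt0.
  move=> B AB; apply: eE; split => // i j; rewrite -ball_normE/= -opprB normrN norm_ltE//.
move=> [e e0 eE]; apply/nbhs_ballP; exists (rs e); first exact: rs_gt0.
move=> B [_ AB]; apply: eE => i j; have := AB i j; rewrite -ball_normE/=.
by rewrite -opprB normrN norm_ltE ?rs_gt0// re_rs.
Qed.

Lemma nbhs_vnorm n (u : 'cV[F]_n) (E : set 'cV[F]_n) :
  nbhs u E <-> exists2 e : R, 0 < e & forall w : 'cV[F]_n, vnorm (w - u) < e -> E w.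
Proof.
rewrite nbhs_mx; split => -[e e0 eE].
  exists e => // w wu; apply: eE => i j; rewrite ord1.
  have -> : w i 0 - u i 0 = (w - u) i 0 by rewrite !mxE.
  exact: le_lt_trans (modulus_le_vnorm _ _) wu.
exists (e / n.+1%:R) => [|w wu]; first by rewrite divr_gt0.
apply: eE; apply: (le_lt_trans (vnorm_le_sum _)).
apply: (@le_lt_trans _ _ (\sum_(i < n) e / n.+1%:R)).
  by apply: ler_sum => i _; rewrite !mxE ltW.
rewrite sumr_const card_ord -[X in X < _]mulr_natr -mulrA gtr_pMr// mulrC.
by rewrite ltr_pdivrMr// mul1r ltr_nat.
Qed.

Lemma open_vnormP n (E : set 'cV[F]_n) : open E <->
  forall u, E u -> exists2 e : R, 0 < e & forall w : 'cV[F]_n, vnorm (w - u) < e -> E w.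
Proof.
rewrite openE; split => h u /h; first by move=> /nbhs_vnorm.
by move=> ?; apply/nbhs_vnorm.
Qed.

Lemma closure_vnormP n (E : set 'cV[F]_n) u : closure E u <->
  forall m, exists2 w, E w & vnorm (w - u) < m.+1%:R^-1.
Proof.
split => h.
  move=> m; have /h[w [Ew /=]] : nbhs u [set w | vnorm (w - u) < m.+1%:R^-1].
    by apply/nbhs_vnorm; exists m.+1%:R^-1; rewrite ?invr_gt0.
  by exists w.
move=> B /nbhs_vnorm[e e0 eB].
have [m me] := ltr_add_invr e0; rewrite add0r in me.
have [w Ew wm] := h m; exists w; split => //; apply: eB; exact: lt_trans me.
Qed.

End Vectors.

(** * Measurability *)

Section Rational.
Context (R : realType) (k : ground) (n : nat).
Local Notation F := (ground_field R k).

Definition ratvec (a : {ffun 'I_n -> rat * rat}) : 'cV[F]_n :=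
  \col_i of_re_im k (ratr (a i).1) (ratr (a i).2).

Lemma rat_near (x e : R) : 0 < e -> exists q : rat, `|ratr q - x| < e.
Proof.
move=> e0; have : x - e < x + e by rewrite ltrBlDr -addrA ltrDl addr_gt0.
move=> /rat_in_itvoo[q]; rewrite in_itv/= => /andP[a b]; exists q.
by rewrite ltr_norml ltrBrDr addrC a/= ltrBlDr addrC.
Qed.

Lemma ratvec_dense (u : 'cV[F]_n) (e : R) : 0 < e ->
  exists a, vnorm (ratvec a - u) < e.
Proof.
move=> e0.
have [d d0 dE] : exists2 e' : R, 0 < e' & forall w : 'cV[F]_n,
    (forall i j, modulus (w i j - u i j) < e') -> vnorm (w - u) < e.
  apply/(nbhs_mx u [set w | vnorm (w - u) < e])/nbhs_vnorm.
  by exists e.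
have d2 : 0 < d / 2 by rewrite divr_gt0.
have /choice[a aP] (i : 'I_n) : exists q : rat * rat,
    `|ratr q.1 - re (u i 0)| < d / 2 /\ `|ratr q.2 - im (u i 0)| < d / 2.
  have [q qP] := rat_near (re (u i 0)) d2.
  have [r rP] := rat_near (im (u i 0)) d2.
  by exists (q, r).
exists [ffun i => a i]; apply: dE => i j; rewrite ord1 mxE ffunE.
have [a1 a2] := aP i.
apply: (le_lt_trans (modulus_le_re_im _)); rewrite reB imB re_of_re_im.
rewrite [ltRHS](splitr d) ltr_leD//.
rewrite -{1}(of_re_imK (u i 0)) -imB; apply: le_trans (ltW a2).
apply: le_trans (im_of_re_im_le k 0 _); rewrite le_eqVlt; apply/orP; left; apply/eqP.
congr (`|_|); move: (u i 0); rewrite /im /of_re_im /ground_field.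
by case: k => //= ?; rewrite subr0.
Qed.

End Rational.

Section ScalarMeasurability.
Context d (T : measurableType d) (R : realType) (k : ground).
Local Notation F := (ground_field R k).

(** Coordinatewise form of Borel measurability, stable under algebraic
operations by inspection. *)
Definition measurable_scalar (f : T -> F) : Prop :=
  measurable_fun setT (fun x => re (f x)) /\
  measurable_fun setT (fun x => im (f x)).

Lemma measurable_scalar_cst c : measurable_scalar (fun=> c).
Proof. by split; exact: measurable_cst. Qed.

Lemma measurable_scalarD f g : measurable_scalar f -> measurable_scalar g ->
  measurable_scalar (fun x => f x + g x).
Proof.
move=> [rf jf] [rg jg]; split.
  under eq_fun do rewrite reD; exact: measurable_funD.
under eq_fun do rewrite imD; exact: measurable_funD.
Qed.

Lemma measurable_scalarM f g : measurable_scalar f -> measurable_scalar g ->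
  measurable_scalar (fun x => f x * g x).
Proof.
move=> [rf jf] [rg jg]; split.
  under eq_fun do rewrite reM.
  by apply: measurable_funB; apply: measurable_funM.
under eq_fun do rewrite imM.
by apply: measurable_funD; apply: measurable_funM.
Qed.

Lemma measurable_scalar_rs (f : T -> R) : measurable_fun setT f ->
  measurable_scalar (fun x => real_scalar k (f x)).
Proof.
move=> mf; split; first by under eq_fun do rewrite re_rs.
by under eq_fun do rewrite im_rs; exact: measurable_cst.
Qed.

Lemma measurable_scalar_conj f : measurable_scalar f ->
  measurable_scalar (fun x => conjugate (f x)).
Proof.
move=> [rf jf]; split; first by under eq_fun do rewrite re_conj.
by under eq_fun do rewrite im_conj; exact: measurable_funN.
Qed.

Lemma measurable_scalar_sum I (r : seq I) (f : I -> T -> F) :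
  (forall i, measurable_scalar (f i)) -> measurable_scalar (fun x => \sum_(i <- r) f i x).
Proof.
move=> mf; elim: r => [|i r ih].
  by under eq_fun do rewrite big_nil; exact: measurable_scalar_cst.
by under eq_fun do rewrite big_cons; exact: measurable_scalarD.
Qed.

Lemma measurable_scalar_prod I (r : seq I) (f : I -> T -> F) :
  (forall i, measurable_scalar (f i)) -> measurable_scalar (fun x => \prod_(i <- r) f i x).
Proof.
move=> mf; elim: r => [|i r ih].
  by under eq_fun do rewrite big_nil; exact: measurable_scalar_cst.
by under eq_fun do rewrite big_cons; exact: measurable_scalarM.
Qed.

Lemma measurable_modulus f : measurable_scalar f ->
  measurable_fun setT (fun x => modulus (f x)).
Proof.
move=> [rf jf].
under eq_fun do rewrite modulusE -powR12_sqrt ?addr_ge0 ?sqr_ge0//.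
apply: (measurableT_comp (measurable_powR _)).
by apply: measurable_funD; apply: measurable_funX.
Qed.

Lemma measurable_funV_ge0 (f : T -> R) : (forall x, 0 <= f x) ->
  measurable_fun setT f -> measurable_fun setT (fun x => (f x)^-1).
Proof.
move=> f0 mf; under eq_fun do rewrite -powR_inv1//.
exact: (measurableT_comp (measurable_powR _)).
Qed.

(** Exhibits the inverse as a polynomial in real and imaginary parts divided by a
nonnegative real function, from which its measurability follows. *)
Lemma invrE_conj (z : F) : z^-1 = real_scalar k (modulus z ^+ 2)^-1 * conjugate z.
Proof.
have [->|z0] := eqVneq z 0.
  by rewrite invr0 modulus0 expr0n invr0 rs0 mul0r.
have m0 : modulus z ^+ 2 != 0.
  by rewrite sqrf_eq0; apply: contra z0 => /eqP/modulus_eq0 ->.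
apply: (mulfI z0); rewrite divff//; apply: re_im_inj.
  rewrite re1 reM re_rsM im_rsM re_conj im_conj -[LHS](mulVf m0).
  by rewrite {2}modulus_sqr; ring.
by rewrite im1 imM re_rsM im_rsM re_conj im_conj; ring.
Qed.

Lemma measurable_scalarV f : measurable_scalar f -> measurable_scalar (fun x => (f x)^-1).
Proof.
move=> mf; under eq_fun do rewrite invrE_conj.
apply: measurable_scalarM; last exact: measurable_scalar_conj.
apply: measurable_scalar_rs; apply: measurable_funV_ge0 => [x|]; first by rewrite sqr_ge0.
by apply: measurable_funX; exact: measurable_modulus.
Qed.

Lemma measurable_scalar_if (D : set T) f g : 
  measurable D -> measurable_scalar f -> measurable_scalar g ->
  measurable_scalar (fun x => if x \in D then f x else g x).
Proof.
move=> mD [rf jf] [rg jg].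
have mb : measurable_fun setT (fun x => x \in D).
  apply: (measurable_fun_bool true) => //; rewrite setTI.
  rewrite (_ : _ @^-1` _ = D)//; apply/seteqP; split => x /=; first by move=> /set_mem.
  by move=> /mem_set.
split.
  under eq_fun do rewrite (fun_if (@re R k)).
  exact: measurable_fun_ifT.
under eq_fun do rewrite (fun_if (@im R k)).
exact: measurable_fun_ifT.
Qed.

Definition measurable_mx m n (A : T -> 'M[F]_(m, n)) : Prop :=
  forall i j, measurable_scalar (fun x => A x i j).

Lemma measurable_mx_cst m n (A : 'M[F]_(m, n)) : measurable_mx (fun=> A).
Proof. by move=> i j; exact: measurable_scalar_cst. Qed.

Lemma measurable_mx_mul m n p (A : T -> 'M[F]_(m, n)) (B : T -> 'M[F]_(n, p)) :
  measurable_mx A -> measurable_mx B -> measurable_mx (fun x => A x *m B x).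
Proof.
move=> mA mB i j; under eq_fun do rewrite mxE.
by apply: measurable_scalar_sum => l; exact: measurable_scalarM.
Qed.

Lemma measurable_mx_scale m n (f : T -> F) (A : T -> 'M[F]_(m, n)) :
  measurable_scalar f -> measurable_mx A -> measurable_mx (fun x => f x *: A x).
Proof. by move=> mf mA i j; under eq_fun do rewrite mxE; exact: measurable_scalarM. Qed.

Lemma measurable_mxD m n (A B : T -> 'M[F]_(m, n)) :
  measurable_mx A -> measurable_mx B -> measurable_mx (fun x => A x + B x).
Proof. by move=> mf mA i j; under eq_fun do rewrite mxE; exact: measurable_scalarD. Qed.

Lemma measurable_mx_if (D : set T) m n (f g : T -> 'M[F]_(m, n)) :
  measurable D -> measurable_mx f -> measurable_mx g ->
  measurable_mx (fun x => if x \in D then f x else g x).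
Proof.
move=> mD mf mg i j.
under eq_fun do rewrite (fun_if (fun M : 'M[F]_(m, n) => M i j)).
exact: measurable_scalar_if.
Qed.

Lemma measurable_scalar_det n (A : T -> 'M[F]_n) : measurable_mx A ->
  measurable_scalar (fun x => \det (A x)).
Proof.
move=> mA; rewrite /determinant; apply: measurable_scalar_sum => s.
apply: measurable_scalarM; first exact: measurable_scalar_cst.
by apply: measurable_scalar_prod => i; exact: mA.
Qed.

(** Cramer's rule, on the measurable set where the determinant is nonzero. *)
Lemma measurable_mx_inv n (A : T -> 'M[F]_n) : measurable_mx A ->
  measurable_mx (fun x => invmx (A x)).
Proof.
move=> mA; set D := [set x | \det (A x) == 0].
have mD : measurable D.
  have := measurable_modulus (measurable_scalar_det mA) => md.
  have := md measurableT _ (measurable_set1 0); rewrite setTI.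
  rewrite (_ : _ @^-1` _ = D)//; apply/seteqP; split => x /=.
    by move=> /modulus_eq0/eqP.
  by move=> /eqP ->; rewrite modulus0.
rewrite (_ : (fun x => _) = fun x =>
    if x \in D then A x else (\det (A x))^-1 *: \adj (A x)); last first.
  apply/funext => x; rewrite /invmx unitmxE unitfE.
  have [d0|d0] := eqVneq (\det (A x)) 0.
    by rewrite /= mem_set// /D/= d0.
  by rewrite /= memNset// /D/=; apply/negP.
apply: measurable_mx_if => //; apply: measurable_mx_scale.
  exact/measurable_scalarV/measurable_scalar_det.
move=> i j; under eq_fun do rewrite !mxE.
rewrite /cofactor; apply: measurable_scalarM; first exact: measurable_scalar_cst.
by apply: measurable_scalar_det => a b; under eq_fun do rewrite !mxE; exact: mA.
Qed.

Lemma measurable_rdot n (f g : T -> 'cV[F]_n) : measurable_mx f -> measurable_mx g ->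
  measurable_fun setT (fun x => rdot (f x) (g x)).
Proof.
move=> mf mg; have [] // : measurable_scalar (fun x => dot (f x) (g x)).
apply: measurable_scalar_sum => i; apply: measurable_scalarM; first exact: mf.
by apply: measurable_scalar_conj; exact: mg.
Qed.

Lemma measurable_vnorm n (f : T -> 'cV[F]_n) : measurable_mx f ->
  measurable_fun setT (fun x => vnorm (f x)).
Proof.
move=> mf; under eq_fun do rewrite vnormE -powR12_sqrt ?rdot_ge0//.
by apply: (measurableT_comp (measurable_powR _)); exact: measurable_rdot.
Qed.

Lemma measurable_mxnorm n (A : T -> 'M[F]_n) : measurable_mx A ->
  measurable_fun setT (fun x => mxnorm (A x)).
Proof.
move=> mA; under eq_fun do rewrite /mxnorm.
have ge0 x : 0 <= \sum_i \sum_j modulus (A x i j) ^+ 2.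
  by apply: sumr_ge0 => i _; apply: sumr_ge0 => j _; rewrite sqr_ge0.
under eq_fun do rewrite -powR12_sqrt//.
apply: (measurableT_comp (measurable_powR _)).
apply: measurable_sum => i; apply: measurable_sum => j; apply: measurable_funX.
exact: measurable_modulus.
Qed.

End ScalarMeasurability.

Section BorelFunctions.
Context (R : realType) (d : nat) (k : ground).
Local Notation F := (ground_field R k).
Local Notation Rd := (euclid R d).

(** The coordinates are continuous, so half-lines pull back to open sets. *)
Lemma borel_measurable_mx m n (f : Rd -> 'M[F]_(m, n)) : borel_fun f -> measurable_mx f.
Proof.
move=> mf i j.
have key (h : F -> R) : (forall x y, h (x - y) = h x - h y) ->
    (forall z, `|h z| <= modulus z) -> measurable_fun setT (fun x => h (f x i j)).
  move=> hB hm; apply: (@measurability _ _ Rd (measurableTypeR R) setT _ _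
    (RGenOInfty.measurableE R)).
  move=> _ [_ [a ->] <-]; rewrite setTI.
  rewrite (_ : _ @^-1` _ = f @^-1` [set A | a < h (A i j)]); last first.
    by apply/seteqP; split => x /=; rewrite in_itv/= andbT.
  rewrite -[X in measurable X]setTI; apply: mf => //; apply: sub_sigma_algebra.
  rewrite /= openE => A /= aA; apply/nbhs_mx.
  exists (h (A i j) - a) => [|B AB]; first by rewrite subr_gt0.
  have := le_lt_trans (hm _) (AB i j); rewrite hB ltr_norml opprB => /andP[+ _].
  by rewrite ltrD2r.
split; apply: key; [exact: reB|exact: re_le_modulus|exact: imB|exact: im_le_modulus].
Qed.

(** An open set is the union of the countably many balls with rational centre and
radius 1/(m+1) that it contains. *)
Lemma measurable_mx_borel n (f : Rd -> 'cV[F]_n) : measurable_mx f -> borel_fun f.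
Proof.
move=> mf; apply: (@measurability _ _ Rd (g_sigma_algebraType (@open 'cV[F]_n))
  setT _ (@open 'cV[F]_n) (erefl _)) => _ [E oE <-]; rewrite setTI.
pose B (q : {ffun 'I_n -> rat * rat} * nat) : set 'cV[F]_n :=
  [set w | vnorm (w - ratvec R k q.1) < q.2.+1%:R^-1].
pose idx (i : nat) := if unpickle i is Some q then
  (if `[< B q `<=` E >] then B q else set0) else set0.
have -> : f @^-1` E = \bigcup_i f @^-1` idx i.
  rewrite -preimage_bigcup; congr (_ @^-1` _).
  apply/seteqP; split => [u Eu|u [i _]]; last first.
    rewrite /idx; case: unpickle => // q; case: ifPn => // /asboolP; exact.
  have /open_vnormP/(_ u Eu)[e e0 eE] := oE.
  have e2 : 0 < e / 2 by rewrite divr_gt0.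
  have [m] := ltr_add_invr e2; rewrite add0r => me.
  have m0 : 0 < m.+1%:R^-1 :> R by rewrite invr_gt0.
  have [a au] := ratvec_dense u m0.
  exists (pickle (a, m)) => //; rewrite /idx pickleK.
  case: asboolP => [_|[]]; first by rewrite /B/= vnormB.
  move=> w wa; apply: eE; rewrite -(subrKA (ratvec R k a)).
  rewrite (le_lt_trans (vnormD _ _))// (splitr e) ltrD//.
    exact: lt_trans wa _.
  exact: lt_trans au _.
apply: bigcupT_measurable => i; rewrite /idx; case: unpickle => [q|]; last first.
  by rewrite preimage_set0.
case: ifPn => _; last by rewrite preimage_set0.
have : measurable_mx (fun x => f x + (- ratvec R k q.1)).
  by apply: measurable_mxD => //; exact: measurable_mx_cst.
move=> /measurable_vnorm mv.
rewrite -[X in measurable X]setTI.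
have := measurable_fun_ltr mv (@measurable_cst _ _ _ _ setT (q.2.+1%:R^-1 : R)).
by move=> /(_ measurableT [set true] Logic.I).
Qed.

End BorelFunctions.

(** * Cubes *)

Section Cubes.
Context (R : realType) (d : nat).
Local Notation Rd := (euclid R d).
Local Notation mu := (lebesgue R d).
Implicit Types (a : d.-tuple R) (l : R).

Lemma borel_cube d' (a : d'.-tuple R) l :
  measurable (cube a l : set (d'.-tuple (measurableTypeR R))).
Proof.
have -> : (cube a l : set (d'.-tuple (measurableTypeR R))) =
    \big[setI/setT]_(i < d') (fun x : d'.-tuple (measurableTypeR R) => tnth x i) @^-1`
      `]tnth a i, tnth a i + l[%classic.
  apply/seteqP; split => x.
    move=> xa; rewrite -bigcap_seq/= => i _ /=; rewrite in_itv/=.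
    by have [-> ->] := xa i.
  rewrite -bigcap_seq => xa i; have := xa i (mem_index_enum i).
  by rewrite /= in_itv/= => /andP.
apply: bigsetI_measurable => i _; rewrite -[X in measurable X]setTI.
exact: measurable_tnth.
Qed.

Lemma borel_lebesgue_cube d' (a : d'.-tuple R) l : 0 <= l ->
  borel_lebesgue R d' (cube a l) = (l ^+ d')%:E.
Proof.
move=> l0; elim: d' => [|d' ih] in a *.
  by rewrite /= diracE mem_set//= => -[].
case/tupleP: a => a0 a.
rewrite [LHS](_ : _ = (lebesgue_measure \x borel_lebesgue R d')%E
    (`]a0, a0 + l[%classic `*` cube a l)); last first.
  transitivity ((lebesgue_measure \x borel_lebesgue R d')%E
      (@cons_pair R d' @^-1` cube [tuple of a0 :: a] l)); first by [].
  congr (product_measure1 _ _ _).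
  apply/seteqP; split => -[x t] /=; rewrite in_itv/=.
    move=> h; split; first by have := h ord0; rewrite !tnth0 => -[-> ->].
    move=> i; have := h (lift ord0 i); rewrite !tnthS//.
  move=> [/andP[x1 x2] h] i; case: (unliftP ord0 i) => [j ->|->]; last by rewrite !tnth0.
  by rewrite !tnthS; exact: h.
rewrite product_measure1E//; last exact: borel_cube.
transitivity (lebesgue_measure (`]a0, (a0 + l)%R[%classic : set R) * (l ^+ d')%:E)%E.
  by rewrite ih.
rewrite lebesgue_measure_itv/= lte_fin ltrDl.
have [l1|] := ltP 0 l; first by rewrite EFinN EFinD addeAC subee// add0e -EFinM exprS.
move=> l1; have -> : l = 0 by apply/eqP; rewrite eq_le l1 l0.
by rewrite mul0e expr0n.
Qed.

Lemma measurable_cube a l : measurable (cube a l : set Rd).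
Proof. by apply: sub_caratheodory; apply: sub_sigma_algebra; exact: borel_cube. Qed.

Lemma lebesgue_cube a l : 0 <= l -> mu (cube a l) = (l ^+ d)%:E.
Proof.
move=> l0; rewrite -(borel_lebesgue_cube a l0).
apply: measurable_mu_extE; exact: borel_cube.
Qed.

Lemma lebesgue_cube_gt0 a l : 0 < l -> (0 < mu (cube a l))%E.
Proof. by move=> l0; rewrite lebesgue_cube ?ltW// lte_fin exprn_gt0. Qed.

Lemma lebesgueT_gt0 : (0 < mu setT)%E.
Proof.
apply: lt_le_trans (lebesgue_cube_gt0 [tuple 0 | i < d] ltr01) _.
by apply: le_measure; rewrite ?inE//; exact: measurable_cube.
Qed.

(** Any union of cubes is the union of countably many of them: each point of a
cube lies in a box with rational vertices contained in that cube. *)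
Lemma cube_lindelof (I : Type) (P : set I) (a : I -> d.-tuple R) (l : I -> R)
    (i0 : I) : P i0 ->
  exists2 s : nat -> I, (forall n, P (s n)) &
    forall i x, P i -> cube (a i) (l i) x ->
      exists n, cube (a (s n)) (l (s n)) x.
Proof.
move=> Pi0.
pose box (b : {ffun 'I_d -> rat * rat}) : set (d.-tuple R) :=
  [set x | forall i, ratr (b i).1 < tnth x i /\ tnth x i < ratr (b i).2].
pose good b i := P i /\ box b `<=` cube (a i) (l i).
have /choice[c cP] (b : {ffun 'I_d -> rat * rat}) : exists i,
    P i /\ ((exists j, good b j) -> box b `<=` cube (a i) (l i)).
  have [[j [Pj bj]]|nb] := pselect (exists j, good b j); first by exists j.
  by exists i0; split => // /nb.
exists (fun n => if unpickle n is Some b then c b else i0) => [n|i x Pi xi].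
  by case: unpickle => // b; have [] := cP b.
have /choice[b bP] (j : 'I_d) : exists q : rat * rat,
    [/\ tnth (a i) j <= ratr q.1, ratr q.1 < tnth x j, tnth x j < ratr q.2 &
        ratr q.2 <= tnth (a i) j + l i].
  have [/rat_in_itvoo[q qP] /rat_in_itvoo[r rP]] := xi j.
  exists (q, r); move: qP rP; rewrite !in_itv/= => /andP[/ltW-> ->].
  by move=> /andP[-> /ltW->].
exists (pickle [ffun j => b j]); rewrite pickleK.
have [_] := cP [ffun j => b j]; apply.
  exists i; split => // y yb j; have [b1 _ _ b2] := bP j.
  have := yb j; rewrite ffunE => -[y1 y2].
  by rewrite (le_lt_trans b1)// (lt_le_trans y2).
by move=> j; rewrite ffunE; have [] := bP j.
Qed.

Definition triple a l : set Rd := cube [tuple tnth a i - l | i < d] (3 * l).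

Lemma sub_triple a l : 0 < l -> cube a l `<=` triple a l.
Proof.
by move=> l0 x xa i; have [x1 x2] := xa i; rewrite tnth_mktuple; split; lra.
Qed.

Lemma meets_sub_triple a l b m : m <= l -> cube a l `&` cube b m !=set0 ->
  cube b m `<=` triple a l.
Proof.
move=> ml [y [ya yb]] x xb i; rewrite tnth_mktuple.
have [xb1 xb2] := xb i; have [ya1 ya2] := ya i; have [yb1 yb2] := yb i.
by split; lra.
Qed.

Lemma exists_max_seq (I : eqType) (l : I -> R) (s : seq I) : s != [::] ->
  exists2 i, i \in s & forall j, j \in s -> l j <= l i.
Proof.
elim: s => // i s ih _; have [->|/ih[j js jmax]] := eqVneq s [::].
  by exists i; rewrite ?inE// => j; rewrite inE => /eqP ->.
have [ij|ji] := leP (l i) (l j).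
  by exists j; rewrite ?inE ?js ?orbT// => m; rewrite inE => /predU1P[->|/jmax].
exists i; rewrite ?inE ?eqxx// => m; rewrite inE => /predU1P[->//|/jmax].
by move=> mj; rewrite (le_trans mj)// ltW.
Qed.

(** Vitali's selection: greedily keep a largest cube and discard those that
meet it, which are contained in its concentric triple. *)
Lemma vitali_cubes (I : eqType) (a : I -> d.-tuple R) (l : I -> R) (s : seq I) :
  (forall i, 0 < l i) ->
  exists D : seq I, [/\ uniq D, {subset D <= s},
    {in D &, forall i j, i != j -> cube (a i) (l i) `&` cube (a j) (l j) = set0} &
    forall i x, i \in s -> cube (a i) (l i) x ->
      exists2 j, j \in D & triple (a j) (l j) x].
Proof.
move=> l0; have [n] := ubnP (size s); elim: n => // n ih in s *; rewrite ltnS => sn.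
have [->|s0] := eqVneq s [::]; first by exists [::]; split.
have [i si imax] := exists_max_seq l s0.
pose keep j := (j != i) && `[< cube (a i) (l i) `&` cube (a j) (l j) = set0 >].
have [|D [uD Ds dD cD]] := ih [seq j <- s | keep j].
  rewrite (leq_trans _ sn)// size_filter -(count_predC keep s) -[ltnLHS]addn0.
  by rewrite ltn_add2l -has_count; apply/hasP; exists i; rewrite //= /keep eqxx.
have kD j : j \in D -> keep j by move=> /Ds; rewrite mem_filter => /andP[].
exists (i :: D); split.
- by rewrite /= uD andbT; apply/negP => /kD; rewrite /keep eqxx.
- by move=> j; rewrite inE => /predU1P[->//|/Ds]; rewrite mem_filter => /andP[].
- move=> j m; rewrite !inE => /predU1P[->|jD] /predU1P[->|mD] jm.
  + by rewrite eqxx in jm.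
  + by have /andP[_ /asboolP] := kD _ mD.
  + by rewrite setIC; have /andP[_ /asboolP] := kD _ jD.
  + exact: dD.
- move=> j x js xj; have [kj|] := boolP (keep j).
    have [|m mD xm] := cD j x _ xj; first by rewrite mem_filter kj.
    by exists m; rewrite // inE mD orbT.
  rewrite negb_and negbK => /orP[/eqP ji|/asboolPn/eqP/set0P meet].
    by exists i; rewrite ?inE ?eqxx//; apply: sub_triple; rewrite // -ji.
  exists i; first by rewrite inE eqxx.
  by apply: meets_sub_triple meet _ xj; exact: imax.
Qed.

End Cubes.

(** * Lebesgue norms *)

Section LebesgueNorms.
Context d (T : measurableType d) (R : realType).
Variable mu : {measure set T -> \bar R}.
Hypothesis muT : (0 < mu setT)%E.
Implicit Types (f g h : T -> R) (p : \bar R) (r K : R).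


Let mE f : measurable_fun setT f -> measurable_fun setT (fun x => (f x)%:E).
Proof. by move=> mf; exact/measurable_EFinP. Qed.

Let mpowR f r : measurable_fun setT f -> measurable_fun setT (fun x => (f x `^ r)%:E).
Proof.
by move=> mf; apply/measurable_EFinP; exact: (measurableT_comp (measurable_powR _)).
Qed.

Lemma Lnorm_finE r g : (forall x, 0 <= g x) ->
  (NN mu r%:E (x => g x) = (\int[mu]_x (g x `^ r)%:E) `^ r^-1)%E.
Proof.
move=> g0; rewrite unlock; congr (_ `^ _)%E; apply: eq_integral => x _.
by rewrite abse_EFin ger0_norm// poweR_EFin.
Qed.

Lemma Lnorm_inftyE g : (forall x, 0 <= g x) ->
  NN mu +oo%E (x => g x) = ess_sup mu (fun x => (g x)%:E).
Proof.
move=> g0; rewrite unlock muT; congr (ess_sup mu _); apply/funext => x /=.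
by rewrite ger0_norm.
Qed.

Lemma Lnorm_fin_leP r g K : 1 <= r -> (forall x, 0 <= g x) -> 0 <= K ->
  (NN mu r%:E (x => g x) <= K%:E)%E <-> (\int[mu]_x (g x `^ r)%:E <= (K `^ r)%:E)%E.
Proof.
move=> r1 g0 K0; have r0 : 0 < r by exact: lt_le_trans r1.
have I0 : (0 <= \int[mu]_x (g x `^ r)%:E)%E.
  by apply: integral_ge0 => x _; rewrite lee_fin powR_ge0.
have mem (x : \bar R) : (0 <= x)%E -> x \in `[0%E, +oo%E].
  by move=> x0; rewrite in_itv/= x0 leey.
rewrite Lnorm_finE//; split => h.
  have := gt0_ler_poweR (ltW r0) (mem _ (poweR_ge0 _ _)) (mem K%:E _) h.
  by rewrite -poweRrM mulVf ?gt_eqF// poweRe1// poweR_EFin lee_fin; exact.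
have rV : 0 <= r^-1 by rewrite invr_ge0 ltW.
have KK : (0 <= (K `^ r)%:E)%E by rewrite lee_fin powR_ge0.
have := gt0_ler_poweR rV (mem _ I0) (mem _ KK) h.
by rewrite poweR_EFin -powRrM mulfV ?gt_eqF// powRr1.
Qed.

Lemma Lnorm_infty_leP g K : (forall x, 0 <= g x) ->
  (NN mu +oo%E (x => g x) <= K%:E)%E <-> {ae mu, forall x, g x <= K}.
Proof.
by move=> g0; rewrite Lnorm_inftyE//; split => [/ess_supP|] h; [|apply/ess_supP];
  apply: filterS h => x; rewrite lee_fin.
Qed.

Lemma le_Lnorm_ae p f g : (1 <= p)%E ->
  measurable_fun setT f -> measurable_fun setT g ->
  (forall x, 0 <= f x) -> (forall x, 0 <= g x) ->
  {ae mu, forall x, f x <= g x} -> (NN mu p (x => f x) <= NN mu p (x => g x))%E.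
Proof.
case: p => [r| |]// r1 mf mg f0 g0 fg; last first.
  rewrite !Lnorm_inftyE//; apply: le_ess_sup.
  by apply: filterS fg => x; rewrite lee_fin.
have r0 : 0 < r by rewrite lee_fin in r1; exact: lt_le_trans r1.
rewrite !Lnorm_finE//; apply: gt0_ler_poweR.
- by rewrite invr_ge0 ltW.
- by rewrite in_itv/= leey integral_ge0// => x _; rewrite lee_fin powR_ge0.
- by rewrite in_itv/= leey integral_ge0// => x _; rewrite lee_fin powR_ge0.
apply: ae_ge0_le_integral => //.
- by move=> x _; rewrite lee_fin powR_ge0.
- exact: mpowR.
- by move=> x _; rewrite lee_fin powR_ge0.
- exact: mpowR.
apply: filterS fg => x fgx _; rewrite lee_fin ge0_ler_powR ?nnegrE//.
exact: ltW.
Qed.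

Lemma LnormZ p g K : (1 <= p)%E -> measurable_fun setT g -> (forall x, 0 <= g x) ->
  0 <= K -> NN mu p (x => K * g x) = (K%:E * NN mu p (x => g x))%E.
Proof.
case: p => [r| |]// r1 mg g0 K0; last first.
  rewrite !Lnorm_inftyE//; last by move=> x; rewrite mulr_ge0.
  by rewrite -ess_supZl.
have r0 : 0 < r by rewrite lee_fin in r1; exact: lt_le_trans r1.
rewrite !Lnorm_finE//; last by move=> x; rewrite mulr_ge0.
under eq_integral do rewrite powRM// EFinM.
rewrite ge0_integralZl_EFin//; last 3 first.
- by move=> x _; rewrite lee_fin powR_ge0.
- exact: mpowR.
- by rewrite powR_ge0.
rewrite poweRM ?lee_fin ?powR_ge0//; last first.
  by apply: integral_ge0 => x _; rewrite lee_fin powR_ge0.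
by rewrite poweR_EFin -powRrM mulfV ?gt_eqF// powRr1.
Qed.

Lemma LnormD_le p f g : (1 <= p)%E ->
  measurable_fun setT f -> measurable_fun setT g ->
  (forall x, 0 <= f x) -> (forall x, 0 <= g x) ->
  (NN mu p (x => f x + g x) <= NN mu p (x => f x) + NN mu p (x => g x))%E.
Proof.
case: p => [r| |]// r1 mf mg f0 g0; first exact: minkowski_EFin.
rewrite !Lnorm_inftyE//; first exact:
  (ess_supD mu (fun x => (f x)%:E) (fun x => (g x)%:E)).
by move=> x; rewrite addr_ge0.
Qed.

Lemma Lnorm_cst0 p : (1 <= p)%E -> NN mu p (x => 0) = 0%E.
Proof.
by move=> p1; apply: Lnorm0; rewrite gt_eqF// (lt_le_trans _ p1)// lte01.
Qed.

Lemma Lnorm_sum_le p I (s : seq I) (f : I -> T -> R) : (1 <= p)%E ->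
  (forall i, measurable_fun setT (f i)) -> (forall i x, 0 <= f i x) ->
  (NN mu p (x => \sum_(i <- s) f i x) <= \sum_(i <- s) NN mu p (x => f i x))%E.
Proof.
move=> p1 mf f0; elim: s => [|i s ih].
  by rewrite big_nil; under eq_Lnorm do rewrite big_nil; rewrite Lnorm_cst0.
rewrite big_cons; under eq_Lnorm do rewrite big_cons.
apply: le_trans (leeD2l _ ih); apply: LnormD_le => //; first exact: measurable_sum.
by move=> x; exact: sumr_ge0.
Qed.

Lemma Lnorm_gt0 p g (D : set T) : (1 <= p)%E -> measurable_fun setT g ->
  measurable D -> (0 < mu D)%E -> {ae mu, forall x, D x -> g x <> 0} ->
  (0 < NN mu p (x => g x))%E.
Proof.
move=> p1 mg mD muD gD; rewrite lt0e Lnorm_ge0 andbT; apply/eqP => N0.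
have p0 : (0 < p)%E by rewrite (lt_le_trans _ p1)// lte01.
have g0 := Lnorm_eq0_eq0 (mE mg) p0 N0.
suff : mu D = 0%E by move=> D0; rewrite D0 ltxx in muD.
apply: measure_negligible => //.
have : {ae mu, forall x, ~ D x}.
  by apply: filterS2 gD g0 => x + /(_ Logic.I)[] => /[swap] -> + Dx; apply.
by apply: negligibleS => x /= Dx; exact.
Qed.

Lemma hoelder1 f g : measurable_fun setT f -> measurable_fun setT g ->
  (forall x, 0 <= f x) -> (forall x, 0 <= g x) ->
  (\int[mu]_x (f x * g x)%:E <= NN mu 1%E (x => f x) * NN mu +oo%E (x => g x))%E.
Proof.
move=> mf mg f0 g0.
have mfg : measurable_fun setT (fun x => (f x * g x)%:E).
  by apply/measurable_EFinP; exact: measurable_funM.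
have [Ng|Ng] := eqVneq (NN mu +oo%E (x => g x)) +oo%E.
  rewrite Ng; have [Nf|Nf] := eqVneq (NN mu 1%E (x => f x)) 0%E; last first.
    by rewrite gt0_muley ?leey// lt0e Nf Lnorm_ge0.
  rewrite Nf mul0e.
  have fe := Lnorm_eq0_eq0 (mE mf) lte01 Nf.
  suff -> : (\int[mu]_x (f x * g x)%:E = 0)%E by [].
  rewrite -[RHS](integral0 mu setT).
  apply: ae_eq_integral => //.
  by apply: filterS fe => x /(_ Logic.I)[-> _]; rewrite mul0r.
have Nfin : NN mu +oo%E (x => g x) \is a fin_num by rewrite ge0_fin_numE ?Lnorm_ge0// ltey.
have gae : {ae mu, forall x, g x <= fine (NN mu +oo%E (x => g x))}.
  by apply/Lnorm_infty_leP => //; rewrite fineK.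
rewrite Lnorm1 -[X in (_ * X)%E]fineK//.
rewrite -ge0_integralZr//; last 2 first.
- by apply/measurable_EFinP/measurableT_comp.
- by rewrite lee_fin fine_ge0// Lnorm_ge0.
apply: ae_ge0_le_integral => //.
- by move=> x _; rewrite lee_fin mulr_ge0.
- by move=> x _; rewrite mule_ge0// lee_fin fine_ge0// Lnorm_ge0.
- apply: emeasurable_funM => //; by apply/measurable_EFinP/measurableT_comp.
apply: filterS gae => x gx _; rewrite /= ger0_norm// -EFinM lee_fin.
exact: ler_wpM2l.
Qed.

Lemma hoelder_conjugate_fin r : 1 < r ->
  hoelder_conjugate r%:E = (r / (r - 1))%:E.
Proof.
move=> r1; rewrite /hoelder_conjugate/= gt_eqF ?(lt_trans lte01)// ?lte_fin//.
by rewrite -EFinD inver subr_eq0 gt_eqF.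
Qed.

(** Joins the case of finite exponents to the two endpoint cases. *)
Lemma hoelder_ge0 p f g : (1 <= p)%E ->
  measurable_fun setT f -> measurable_fun setT g ->
  (forall x, 0 <= f x) -> (forall x, 0 <= g x) ->
  (\int[mu]_x (f x * g x)%:E <=
   NN mu p (x => f x) * NN mu (hoelder_conjugate p) (x => g x))%E.
Proof.
case: p => [r| |]// r1 mf mg f0 g0; last first.
  rewrite hoelder_conjugatey muleC; under eq_integral do rewrite mulrC.
  exact: hoelder1.
move: r1; rewrite lee_fin le_eqVlt => /predU1P[<-|r1].
  by rewrite hoelder_conjugate1; exact: hoelder1.
rewrite hoelder_conjugate_fin//.
have := @hoelder _ _ _ mu f g r (r / (r - 1)) mf mg.
have r0 : 0 < r by exact: lt_trans r1.
rewrite r0 divr_gt0 ?subr_gt0// => /(_ isT isT); rewrite Lnorm1.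
under eq_integral do rewrite /= ger0_norm ?mulr_ge0//.
apply; rewrite invf_div; field.
by rewrite gt_eqF.
Qed.

(** Monotone convergence along increasing sets; for p = oo a countable union of
null sets. *)
Lemma Lnorm_mono_sets p g (A : (set T)^nat) K : (1 <= p)%E ->
  measurable_fun setT g -> (forall x, 0 <= g x) -> 0 <= K ->
  (forall n, measurable (A n)) -> nondecreasing_seq A ->
  {ae mu, forall x, g x != 0 -> exists n, A n x} ->
  (forall n, NN mu p (x => g x * \1_(A n) x) <= K%:E)%E ->
  (NN mu p (x => g x) <= K%:E)%E.
Proof.
move=> p1 mg g0 K0 mA ndA gA NK.
have gA0 n x : 0 <= g x * \1_(A n) x by rewrite mulr_ge0.
case: p p1 NK => [r| |]// r1 NK; last first.
  apply/Lnorm_infty_leP => //.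
  have h n : {ae mu, forall x, g x * \1_(A n) x <= K} by apply/Lnorm_infty_leP.
  move/ae_foralln : h; apply: filterS2 gA => x gx hx.
  have [->//|/gx[n An]] := eqVneq (g x) 0.
  by have := hx n; rewrite indicE mem_set// mulr1.
rewrite lee_fin in r1; have r0 : 0 < r by exact: lt_le_trans r1.
apply/Lnorm_fin_leP => //.
have mU : measurable (\bigcup_n A n) by exact: bigcupT_measurable.
rewrite (_ : integral _ _ _ = \int[mu]_(x in \bigcup_n A n) (g x `^ r)%:E)%E; last first.
  rewrite [RHS]integral_mkcond; apply: ae_eq_integral => //.
  - exact: mpowR.
  - apply/(measurable_restrictT _ mU).
    by apply: measurable_funTS; exact: mpowR.
  apply: filterS gA => x gx _; rewrite patchE; case: ifPn => // xA.
  have [->|/gx[n An]] := eqVneq (g x) 0; first by rewrite powR0// gt_eqF.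
  by rewrite mem_set in xA => //; exists n.
have cv := @ge0_nondecreasing_set_cvg_integral _ _ _ A
  (fun x => (g x `^ r)%:E) mu ndA mA.
apply: (cvge_to_le (cv _ _)) => [n|n x _|].
- by apply: measurable_funTS; exact: mpowR.
- by rewrite lee_fin powR_ge0.
apply: nearW => n; have /(Lnorm_fin_leP r1 (gA0 n) K0) := NK n.
apply: le_trans; rewrite integral_mkcond; apply: ge0_le_integral => //.
- by move=> x _; rewrite erestrict_ge0// => y _; rewrite lee_fin powR_ge0.
- apply/(measurable_restrictT _ (mA n)).
  by apply: measurable_funTS; exact: mpowR.
- apply: mpowR; apply: measurable_funM => //; exact: measurable_indic.
- move=> x _; rewrite patchE; case: ifPn => xA; last by rewrite lee_fin powR_ge0.
  by rewrite indicE xA mulr1.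
Qed.

(** Replaces a strict level by the levels A + 1/(n+1). *)
Lemma Lnorm_pinfty_converse h (A : R) : measurable_fun setT h ->
    (forall x, 0 <= h x) -> 0 <= A ->
    (forall e, 0 < e -> mu [set x | A + e < h x] = 0%E) ->
  (NN mu +oo%E (x => h x) <= A%:E)%E.
Proof.
move=> mh h0 A0 hA; apply/Lnorm_infty_leP => //.
have hn (n : nat) : {ae mu, forall x, h x <= A + n.+1%:R^-1}.
  exists [set x | A + n.+1%:R^-1 < h x]; split.
  - have := measurable_fun_ltr (@measurable_cst _ _ _ _ setT (A + n.+1%:R^-1)) mh.
    by move=> /(_ measurableT [set true] Logic.I); rewrite setTI.
  - by apply: hA; rewrite invr_gt0.
  - by move=> x /= /negP; rewrite -ltNge.
move/ae_foralln : hn; apply: filterS => x hx; apply/ler_addgt0Pr => e e0.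
have [n] := ltr_add_invr e0; rewrite add0r => /ltW ne.
by rewrite (le_trans (hx n))// lerD2l.
Qed.

(** The converse of Hoelder's inequality, by testing against the extremal
function h^(p'-1), truncated where h is large so that all norms are finite. *)
Lemma hoelder_converse p (Q : set T) h (A : R) : (1 <= p)%E ->
    measurable Q -> (mu Q < +oo)%E ->
    measurable_fun setT h -> (forall x, 0 <= h x) -> (forall x, ~ Q x -> h x = 0) ->
    0 <= A ->
    (forall f, measurable_fun setT f -> (forall x, 0 <= f x) ->
      (forall x, ~ Q x -> f x = 0) -> (NN mu p (x => f x) <= 1)%E ->
      (\int[mu]_x (f x * h x)%:E <= A%:E)%E) ->
    (NN mu (hoelder_conjugate p) (x => h x) <= A%:E)%E.
Proof.
move=> p1 mQ Qfin mh h0 hQ A0 hA; case: p p1 hA => [r| |]// r1 hA; last first.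
  rewrite hoelder_conjugatey Lnorm1.
  have mQ1 : measurable_fun setT (\1_Q : T -> R) by exact: measurable_indic.
  have := hA (\1_Q) mQ1.
  rewrite (_ : (\int[mu]_x _)%E = \int[mu]_x (`|(h x)%:E|)%E)%E; last first.
    apply: eq_integral => x _; rewrite abse_EFin ger0_norm// indicE.
    have [xQ|xQ] := pselect (Q x); first by rewrite mem_set// mul1r.
    by rewrite memNset// hQ// mul0r.
  apply => [x|x xQ|]; first by rewrite indicE.
    by rewrite indicE memNset.
  apply/Lnorm_infty_leP => [x|]; first by rewrite indicE.
  by apply: nearW => x; rewrite indicE; case: (_ \in _).
move: r1; rewrite lee_fin le_eqVlt => /predU1P[r1|r1].
  rewrite -r1 hoelder_conjugate1; apply: Lnorm_pinfty_converse => // e e0.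
  set S := [set x | _].
  have mS : measurable S.
    have := measurable_fun_ltr (@measurable_cst _ _ _ _ setT (A + e)) mh.
    by move=> /(_ measurableT [set true] Logic.I); rewrite setTI.
  have SQ : S `<=` Q.
    move=> x Sx; apply: contrapT => /hQ hx0; move: Sx; rewrite /S/= hx0.
    by rewrite ltNge addr_ge0// ltW.
  have Sfin : mu S \is a fin_num.
    by rewrite ge0_fin_numE// (le_lt_trans _ Qfin)// le_measure ?inE.
  apply/eqP/negPn/negP => S0.
  have m0 : 0 < fine (mu S) by rewrite fine_gt0// lt0e S0 measure_ge0/= -ge0_fin_numE.
  set m := fine (mu S) in m0.
  have mf : measurable_fun setT (fun x => m^-1 * \1_S x).
    by apply: measurable_funM => //; exact: measurable_indic.
  have f0 x : 0 <= m^-1 * \1_S x by rewrite mulr_ge0// invr_ge0 ltW.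
  have If (c : R) : 0 <= c -> (\int[mu]_x (m^-1 * \1_S x * c)%:E = c%:E)%E.
    move=> c0; under eq_integral do rewrite mulrAC EFinM.
    rewrite ge0_integralZl_EFin//; last 2 first.
    - by apply: mE; exact: measurable_indic.
    - by rewrite mulr_ge0// invr_ge0 ltW.
    rewrite integral_indic// setIT -(fineK Sfin) -/m -EFinM mulrAC.
    by rewrite mulVf ?gt_eqF// mul1r.
  have := hA _ mf f0; rewrite -r1 => /(_ _ _)/(le_trans _) => H.
  suff : ((A + e)%:E <= A%:E)%E by rewrite lee_fin gerDl leNgt e0.
  apply: H.
  - rewrite -(If (A + e)) ?addr_ge0 ?(ltW e0)//; apply: ge0_le_integral => //.
    + by move=> x _; rewrite lee_fin mulr_ge0// addr_ge0// ltW.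
    + by apply: mE; apply: measurable_funM.
    + by apply: mE; apply: measurable_funM.
    + move=> x _; rewrite lee_fin indicE.
      have [Sx|xS] := pselect (S x); last by rewrite (memNset xS) !mulr0 !mul0r.
      by rewrite mem_set// ler_wpM2l ?(ltW Sx)// mulr1 invr_ge0 ltW.
  - by move=> x xQ; rewrite indicE memNset ?mulr0// => /SQ.
  - rewrite Lnorm1; under eq_integral do rewrite abse_EFin ger0_norm//.
    by have := If 1 ler01; under eq_integral do rewrite mulr1; move=> ->.
have r0 : 0 < r by exact: lt_trans r1.
have r10 : 0 < r - 1 by rewrite subr_gt0.
rewrite hoelder_conjugate_fin//; set q := r / (r - 1).
have q1 : 1 < q by rewrite /q ltr_pdivlMr// mul1r ltrBlDr ltrDl.
have q0 : 0 < q by exact: lt_trans q1.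
have q10 : 0 < q - 1 by rewrite subr_gt0.
have qr : (q - 1) * r = q by rewrite /q; field; rewrite gt_eqF.
have rq : 1 - r^-1 = q^-1 by rewrite /q invf_div; field; rewrite gt_eqF.
pose B n := [set x | h x <= n%:R].
have mB n : measurable (B n).
  have := measurable_fun_ler mh (@measurable_cst _ _ _ _ setT (n%:R : R)).
  by move=> /(_ measurableT [set true] Logic.I); rewrite setTI.
apply: (@Lnorm_mono_sets _ _ B) => //; first by rewrite lee_fin ltW.
- move=> n m nm; apply/subsetPset => x /= /le_trans; apply.
  by rewrite ler_nat.
- apply: nearW => x _; exists (Num.bound (h x)); rewrite /B/= ltW//.
  exact: archi_boundP.
move=> n; set g := fun x => h x * \1_(B n) x.
have g0 x : 0 <= g x by rewrite /g mulr_ge0.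
have mg : measurable_fun setT g.
  by apply: measurable_funM => //; exact: measurable_indic.
have gQ x : g x <= n%:R * \1_Q x.
  rewrite /g !indicE; have [xQ|xQ] := pselect (Q x); last first.
    by rewrite (memNset xQ) hQ// mul0r mulr0.
  rewrite (mem_set xQ).
  by have [/set_mem|_] := boolP (x \in B n); rewrite ?mulr1 ?mulr0.
set c := (\int[mu]_x (g x `^ q)%:E)%E.
have c0 : (0 <= c)%E by apply: integral_ge0 => x _; rewrite lee_fin powR_ge0.
have cfin : c \is a fin_num.
  rewrite ge0_fin_numE//.
  apply: (@le_lt_trans _ _ (\int[mu]_x ((n%:R `^ q) * \1_Q x)%:E)%E).
    apply: ge0_le_integral => //.
    - by move=> x _; rewrite lee_fin powR_ge0.
    - exact: mpowR.
    - by apply: mE; apply: measurable_funM => //; exact: measurable_indic.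
    - move=> x _; rewrite lee_fin; apply: (@le_trans _ _ ((n%:R * \1_Q x) `^ q)).
        by apply: (ge0_ler_powR (ltW q0)); rewrite ?nnegrE ?g0 ?gQ//; exact: mulr_ge0.
      rewrite powRM// indicE; case: (_ \in _); first by rewrite powR1.
      by rewrite powR0// gt_eqF.
  under eq_integral do rewrite EFinM.
  rewrite ge0_integralZl_EFin ?powR_ge0//; last by apply: mE; exact: measurable_indic.
  rewrite integral_indic// setIT lte_mul_pinfty// ?lee_fin ?powR_ge0//.
rewrite Lnorm_finE// -/c -(fineK cfin) poweR_EFin lee_fin.
have [->|cn0] := eqVneq (fine c) 0.
  by rewrite powR0// invr_neq0// gt_eqF.
have cp : 0 < fine c by rewrite lt_neqAle eq_sym cn0 fine_ge0.
(* The extremal function of Hoelder's inequality for g, normalized in L^r. *)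
pose f x := fine c `^ (- r^-1) * g x `^ (q - 1).
have mf : measurable_fun setT f.
  by apply: measurable_funM => //; exact: (measurableT_comp (measurable_powR _)).
have f0 x : 0 <= f x by rewrite mulr_ge0 ?powR_ge0.
have fQ x : ~ Q x -> f x = 0.
  by move=> /hQ hx; rewrite /f /g hx mul0r powR0 ?mulr0// gt_eqF.
have Ic (b : R) : 0 <= b -> (\int[mu]_x (b * g x `^ q)%:E = (b * fine c)%:E)%E.
  move=> b0; under eq_integral do rewrite EFinM.
  rewrite ge0_integralZl_EFin//; last 2 first.
  - by move=> x _; rewrite lee_fin powR_ge0.
  - exact: mpowR.
  by rewrite -/c -{1}(fineK cfin).
have fh x : f x * h x = fine c `^ (- r^-1) * g x `^ q.
  rewrite /f -mulrA; congr (_ * _); have [gx|gx] := eqVneq (g x) 0.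
    by rewrite gx !powR0 ?gt_eqF// mul0r.
  have -> : h x = g x.
    by move: gx; rewrite /g indicE; case: (_ \in _); rewrite ?mulr1// mulr0 eqxx.
  by rewrite mulrC mulr_powRB1.
have := hA f mf f0 fQ; under eq_integral do rewrite fh.
have -> : fine c `^ q^-1 = fine c `^ (- r^-1) * fine c.
  by rewrite -{3}(powRr1 (ltW cp)) -powRD ?cn0 ?implybT// addrC rq.
rewrite Ic ?powR_ge0// lee_fin; apply; apply/Lnorm_fin_leP => //; first exact: ltW.
under eq_integral do rewrite /f powRM ?powR_ge0// -!powRrM qr.
rewrite Ic ?powR_ge0// mulNr mulVf ?gt_eqF// powR_inv1 ?(ltW cp)//.
by rewrite mulVf// powR1.
Qed.

End LebesgueNorms.

(** * Means of vector-valued functions *)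

(** 1/p, with the convention 1/oo = 0. *)
Definition inv_exponent (R : realType) (p : \bar R) : R :=
  if p is r%:E then r^-1 else 0.

Lemma inv_exponent_hoelder (R : realType) (p : \bar R) : (1 <= p)%E ->
  inv_exponent p + inv_exponent (hoelder_conjugate p) = 1.
Proof.
case: p => [r| |]//; last by rewrite hoelder_conjugatey/= invr1 add0r.
rewrite lee_fin le_eqVlt => /predU1P[<-|r1].
  by rewrite hoelder_conjugate1/= invr1 addr0.
rewrite hoelder_conjugate_fin//= invf_div; field.
by rewrite gt_eqF// (lt_trans _ r1).
Qed.

Section VectorIntegrals.
Context dT (T : measurableType dT) (R : realType) (k : ground) (n : nat).
Variable mu : {measure set T -> \bar R}.
Hypothesis muT : (0 < mu setT)%E.
Local Notation F := (ground_field R k).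
Local Notation V := 'cV[F]_n.
Local Notation rs := (real_scalar k).

Lemma integral_indicE (Q : set T) (g : T -> R) :
  (\int[mu]_(x in Q) (g x)%:E = \int[mu]_x (g x * \1_Q x)%:E)%E.
Proof.
rewrite integral_mkcond; apply: eq_integral => x _; rewrite patchE indicE.
by case: ifPn => _; rewrite ?mulr1 ?mulr0.
Qed.

Lemma avg_Lnorm (r m : R) (Q : set T) (g : T -> R) : 1 <= r -> 0 <= m ->
    (forall x, 0 <= g x) ->
  ((m%:E * \int[mu]_(x in Q) (g x `^ r)%:E) `^ r^-1 =
   (m `^ r^-1)%:E * NN mu r%:E (x => (g x * \1_Q x)%R))%E.
Proof.
move=> r1 m0 g0; have r0 : 0 < r by exact: lt_le_trans r1.
have g1 x : 0 <= g x * \1_Q x by rewrite mulr_ge0.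
have I0 : (0 <= \int[mu]_(x in Q) (g x `^ r)%:E)%E.
  by apply: integral_ge0 => x _; rewrite lee_fin powR_ge0.
rewrite (poweRM _ _ I0) ?lee_fin// poweR_EFin; congr (_ * _)%E.
rewrite (Lnorm_finE _ _ g1); congr (_ `^ _)%E.
rewrite integral_indicE; apply: eq_integral => x _; congr EFin.
by rewrite indicE; case: (_ \in _); rewrite ?mulr1// !mulr0 powR0// gt_eqF.
Qed.

(** W is self-adjoint, so u . v = (W u) . (W^-1 v). *)
Lemma rdot_le_weight (A : 'M[F]_n) (u v : V) : posdef A ->
  rdot u v <= vnorm (A *m u) * vnorm (invmx A *m v).
Proof.
move=> pA; apply: le_trans (cauchy_schwarz _ _).
rewrite (rdot_hermitian _ _ pA.1) mulmxA mulmxV ?mul1mx//.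
exact: posdef_unitmx.
Qed.

Lemma vnorm_le_inv (A : 'M[F]_n) (u : V) : posdef A ->
  vnorm u <= mxnorm (invmx A) * vnorm (A *m u).
Proof.
move=> pA; apply: le_trans (vnorm_mulmx_le _ _).
by rewrite mulmxA mulVmx ?mul1mx//; exact: posdef_unitmx.
Qed.

Definition vintegrable (f : T -> V) : Prop :=
  measurable_mx f /\ (NN mu 1%E (x => vnorm (f x)) < +oo)%E.

Lemma vintegrable_coord (f : T -> V) (Q : set T) (h : F -> R) i :
  measurable Q -> vintegrable f -> (forall x, `|h x| <= modulus x) ->
  measurable_fun setT (fun x => h (f x i 0)) ->
  mu.-integrable Q (EFin \o (fun x => h (f x i 0))).
Proof.
move=> mQ [mf fi] hm mh.
apply: (@integrableS _ _ _ _ setT) => //; apply/integrableP; split.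
  exact/measurable_EFinP.
apply: le_lt_trans fi; rewrite Lnorm1; apply: ge0_le_integral => //.
- by do 2 apply/measurableT_comp => //.
- by do 2 apply/measurableT_comp => //; exact: measurable_vnorm.
- move=> x _ /=; rewrite lee_fin (ger0_norm (vnorm_ge0 _)).
  by rewrite (le_trans (hm _))// modulus_le_vnorm.
Qed.

Lemma vintegrable_re (f : T -> V) (Q : set T) i : measurable Q -> vintegrable f ->
  mu.-integrable Q (EFin \o (fun x => re (f x i 0))).
Proof.
move=> mQ fi; apply: vintegrable_coord => //; first exact: re_le_modulus.
by have [] := fi.1 i 0.
Qed.

Lemma vintegrable_im (f : T -> V) (Q : set T) i : measurable Q -> vintegrable f ->
  mu.-integrable Q (EFin \o (fun x => im (f x i 0))).
Proof.
move=> mQ fi; apply: vintegrable_coord => //; first exact: im_le_modulus.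
by have [] := fi.1 i 0.
Qed.

(** [vintegral] over an arbitrary measure space. *)
Definition gvintegral (Q : set T) (f : T -> V) : V :=
  \col_i of_re_im k (\int[mu]_(x in Q) re (f x i 0))
                    (\int[mu]_(x in Q) im (f x i 0)).

Lemma re_vintegral (f : T -> V) (Q : set T) i :
  re (gvintegral Q f i 0) = \int[mu]_(x in Q) re (f x i 0).
Proof. by rewrite mxE re_of_re_im. Qed.

Lemma im_Rintegral (k' : ground) (g : T -> ground_field R k') (Q : set T) s :
  im (of_re_im k' s (\int[mu]_(x in Q) im (g x))) = \int[mu]_(x in Q) im (g x).
Proof.
move: g; rewrite /im /of_re_im /ground_field; case: k' => //= g.
by rewrite /Rintegral integral0.
Qed.

Lemma im_vintegral (f : T -> V) (Q : set T) i :
  im (gvintegral Q f i 0) = \int[mu]_(x in Q) im (f x i 0).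
Proof. by rewrite mxE im_Rintegral. Qed.

Lemma Rintegral_lin (f g : T -> R) (Q : set T) (s t : R) : measurable Q ->
  mu.-integrable Q (EFin \o f) -> mu.-integrable Q (EFin \o g) ->
  mu.-integrable Q (EFin \o (fun x => s * f x + t * g x)) /\
  \int[mu]_(x in Q) (s * f x + t * g x) =
  s * \int[mu]_(x in Q) f x + t * \int[mu]_(x in Q) g x.
Proof.
move=> mQ fi gi.
have fs : mu.-integrable Q (EFin \o (fun x => s * f x)) by exact: (integrableZl mQ s fi).
have gt : mu.-integrable Q (EFin \o (fun x => t * g x)) by exact: (integrableZl mQ t gi).
split; first exact: (integrableD mQ fs gt).
by rewrite RintegralD// !RintegralZl.
Qed.

Lemma vintegral_lin (f g : T -> V) (Q : set T) (s t : R) : measurable Q ->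
  vintegrable f -> vintegrable g ->
  gvintegral Q (fun x => rs s *: f x + rs t *: g x) =
  rs s *: gvintegral Q f + rs t *: gvintegral Q g.
Proof.
move=> mQ fi gi; apply/matrixP => i j; rewrite ord1.
have E (a b : V) : (rs s *: a + rs t *: b) i 0 = rs s * a i 0 + rs t * b i 0.
  by rewrite !mxE.
rewrite E; apply: re_im_inj.
  rewrite reD !re_rsM !re_vintegral; under eq_Rintegral do rewrite E reD !re_rsM.
  by have [_ ->] := Rintegral_lin s t mQ (vintegrable_re i mQ fi) (vintegrable_re i mQ gi).
rewrite imD !im_rsM !im_vintegral; under eq_Rintegral do rewrite E imD !im_rsM.
by have [_ ->] := Rintegral_lin s t mQ (vintegrable_im i mQ fi) (vintegrable_im i mQ gi).
Qed.

Lemma rdot_vintegral (f : T -> V) (Q : set T) (v : V) : measurable Q ->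
  vintegrable f ->
  mu.-integrable Q (EFin \o (fun x => rdot (f x) v)) /\
  rdot (gvintegral Q f) v = \int[mu]_(x in Q) rdot (f x) v.
Proof.
move=> mQ fi.
pose S (s : seq 'I_n) x := \sum_(i <- s)
  (re (v i 0) * re (f x i 0) + im (v i 0) * im (f x i 0)).
have H s : mu.-integrable Q (EFin \o S s) /\
    \int[mu]_(x in Q) S s x = \sum_(i <- s)
      (re (v i 0) * re (gvintegral Q f i 0) + im (v i 0) * im (gvintegral Q f i 0)).
  elim: s => [|i s [ih1 ih2]].
    have -> : S [::] = fun=> 0 by apply/funext => x; rewrite /S big_nil.
    by rewrite big_nil /Rintegral integral0; split => //; exact: integrable0.
  have [H1 H2] := Rintegral_lin (re (v i 0)) (im (v i 0)) mQ
    (vintegrable_re i mQ fi) (vintegrable_im i mQ fi).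
  have [H3 H4] := Rintegral_lin 1 1 mQ H1 ih1.
  have SE : S (i :: s) = fun x =>
      1 * (re (v i 0) * re (f x i 0) + im (v i 0) * im (f x i 0)) + 1 * S s x.
    by apply/funext => x; rewrite /S big_cons !mul1r.
  by rewrite SE big_cons; split => //; rewrite H4 H2 ih2 !mul1r re_vintegral im_vintegral.
have [H1 H2] := H (index_enum 'I_n).
have SE : S (index_enum 'I_n) = fun x => rdot (f x) v.
  by apply/funext => x; rewrite rdotC rdotE.
by rewrite -SE; split => //; rewrite H2 rdotC rdotE.
Qed.

Lemma le_Rintegral_Lnorm (f h : T -> R) (Q : set T) : measurable Q ->
  mu.-integrable Q (EFin \o f) -> measurable_fun setT h -> (forall x, 0 <= h x) ->
  {ae mu, forall x, Q x -> f x <= h x} ->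
  ((\int[mu]_(x in Q) f x)%:E <= \int[mu]_x (h x)%:E)%E.
Proof.
move=> mQ fi mh h0 fh.
have mf : measurable_fun Q (EFin \o f) by exact: measurable_int fi.
rewrite /Rintegral fineK; last exact: integrable_fin_num.
apply: (@le_trans _ _ (\int[mu]_(x in Q) (EFin \o f)^\+ x)%E).
  apply: le_integral => //; first exact: integrable_funepos.
  move=> x _; by rewrite funeposE le_max lexx.
apply: (@le_trans _ _ (\int[mu]_(x in Q) (h x)%:E)%E); last first.
  apply: ge0_subset_integral => //; first exact/measurable_EFinP.
  by move=> x _; rewrite lee_fin.
apply: ae_ge0_le_integral => //.
- exact: measurable_funepos.
- by move=> x _; rewrite lee_fin.
- by apply/measurable_EFinP; exact: measurable_funTS.
apply: filterS fh => x fhx Qx; rewrite funeposE /= -EFin_max lee_fin.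
by rewrite ge_max fhx//=.
Qed.

Section Weight.
Variables (p : \bar R) (W : T -> 'M[F]_n).
Hypothesis p1 : (1 <= p)%E.
Hypothesis mW : measurable_mx W.
Hypothesis pW : {ae mu, forall x, posdef (W x)}.
Local Notation p' := (hoelder_conjugate p).
Let p1' : (1 <= p')%E := hoelder_conj_ge1 p1.

Lemma measurable_weight (f : T -> V) : measurable_mx f ->
  measurable_fun setT (fun x => vnorm (W x *m f x)).
Proof. by move=> mf; apply: measurable_vnorm; exact: measurable_mx_mul. Qed.

Lemma measurable_weight_cst (u : V) :
  measurable_fun setT (fun x => vnorm (W x *m u)).
Proof. by apply: measurable_weight; exact: measurable_mx_cst. Qed.

Lemma measurable_inv_weight_cst (u : V) :
  measurable_fun setT (fun x => vnorm (invmx (W x) *m u)).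
Proof.
apply: measurable_vnorm; apply: measurable_mx_mul; first exact: measurable_mx_inv.
exact: measurable_mx_cst.
Qed.

Lemma Lnorm_inv_weight_lty (Q : set T) (v : V) : measurable Q ->
  (NN mu p' (x => (mxnorm (invmx (W x)) * \1_Q x)%R) < +oo)%E ->
  (NN mu p' (x => (vnorm (invmx (W x) *m v) * \1_Q x)%R) < +oo)%E.
Proof.
move=> mQ Qfin; have mI := measurable_mxnorm (measurable_mx_inv mW).
have m1 : measurable_fun setT (\1_Q : T -> R) by exact: measurable_indic.
apply: (@le_lt_trans _ _ (NN mu p' (x => (vnorm v * (mxnorm (invmx (W x)) * \1_Q x))%R))).
  apply: le_Lnorm_ae => //.
  - by apply: measurable_funM => //; exact: measurable_inv_weight_cst.
  - by apply: measurable_funM => //; exact: measurable_funM.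
  - by move=> x; rewrite mulr_ge0 ?vnorm_ge0.
  - by move=> x; rewrite !mulr_ge0 ?vnorm_ge0 ?mxnorm_ge0.
  - apply: nearW => x; rewrite mulrA ler_wpM2r// mulrC; exact: vnorm_mulmx_le.
rewrite LnormZ ?vnorm_ge0//; first by rewrite lte_mul_pinfty ?lee_fin ?vnorm_ge0.
  exact: measurable_funM.
by move=> x; rewrite mulr_ge0 ?mxnorm_ge0.
Qed.

Lemma Lnorm_inv_weight_gt0 (Q : set T) (v : V) : measurable Q ->
  (0 < mu Q)%E -> v != 0 ->
  (0 < NN mu p' (x => (vnorm (invmx (W x) *m v) * \1_Q x)%R))%E.
Proof.
move=> mQ Q0 v0; apply: (@Lnorm_gt0 _ _ _ _ _ _ Q) => //.
  by apply: measurable_funM; [exact: measurable_inv_weight_cst|exact: measurable_indic].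
apply: filterS pW => x px xQ; rewrite indicE mem_set// mulr1 => /vnorm_eq0 Wv.
move/eqP: v0; apply; rewrite -[v]mul1mx -(mulmxV (posdef_unitmx px)).
by rewrite -mulmxA Wv mulmx0.
Qed.

Lemma Lnorm_weight_gt0 (Q : set T) (v : V) : measurable Q ->
  (0 < mu Q)%E -> v != 0 ->
  (0 < NN mu p (x => (vnorm (W x *m v) * \1_Q x)%R))%E.
Proof.
move=> mQ Q0 v0; apply: (@Lnorm_gt0 _ _ _ _ _ _ Q) => //.
  by apply: measurable_funM; [exact: measurable_weight_cst|exact: measurable_indic].
apply: filterS pW => x px xQ; rewrite indicE mem_set// mulr1 => /vnorm_eq0 Wv.
move/eqP: v0; apply; rewrite -[v]mul1mx -(mulVmx (posdef_unitmx px)).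
by rewrite -mulmxA Wv mulmx0.
Qed.

(** The pairing of the mean of f with a vector v splits pointwise as the
pairing of W f with W^-1 v. *)
Lemma rdot_vintegral_le (f : T -> V) (Q Q' : set T) (v : V) :
  measurable Q -> measurable Q' -> Q `<=` Q' -> vintegrable f ->
  ((rdot (gvintegral Q f) v)%:E <=
   NN mu p (x => vnorm (W x *m f x)) *
   NN mu p' (x => (vnorm (invmx (W x) *m v) * \1_Q' x)%R))%E.
Proof.
move=> mQ mQ' QQ' fi; have [ri ->] := rdot_vintegral v mQ fi.
have mv : measurable_fun setT (fun x => vnorm (invmx (W x) *m v) * \1_Q' x).
  by apply: measurable_funM; [exact: measurable_inv_weight_cst|exact: measurable_indic].
have mf := measurable_weight fi.1.
have v0 x : 0 <= vnorm (invmx (W x) *m v) * \1_Q' x by rewrite mulr_ge0 ?vnorm_ge0.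
apply: le_trans (hoelder_ge0 muT p1 mf mv _ v0); last first.
  by move=> x; exact: vnorm_ge0.
apply: le_Rintegral_Lnorm => //.
- exact: measurable_funM.
- by move=> x; rewrite mulr_ge0 ?vnorm_ge0.
apply: filterS pW => x px Qx; rewrite indicE mem_set ?mulr1; last exact: QQ'.
exact: rdot_le_weight.
Qed.

(** The duality inequality of the weight class at the mean w of f, where
|w . v| is bounded by the pairing of W f with W^-1 v, after cancelling the
positive and finite norm of W^-1 v. *)
Lemma mean_weight_le (f : T -> V) (Q Q' : set T) (v : V) (K m : R) :
  let w := rs m^-1 *: gvintegral Q f in
  measurable Q -> measurable Q' -> Q `<=` Q' -> (0 < mu Q')%E -> vintegrable f ->
  0 < K -> 0 < m -> v != 0 ->
  (NN mu p' (x => (mxnorm (invmx (W x)) * \1_Q' x)%R) < +oo)%E ->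
  (NN mu p (x => (vnorm (W x *m w) * \1_Q' x)%R) *
   NN mu p' (x => (vnorm (invmx (W x) *m v) * \1_Q' x)%R) <=
     (K * m * modulus (dot w v))%:E)%E ->
  (NN mu p (x => (vnorm (W x *m w) * \1_Q' x)%R) <=
    K%:E * NN mu p (x => vnorm (W x *m f x)))%E.
Proof.
move=> w mQ mQ' QQ' Q'0 fi K0 m0 v0 Ifin.
set Nf := NN mu p (x => vnorm (W x *m f x)).
set N2 := NN mu p' (x => (vnorm (invmx (W x) *m v) * \1_Q' x)%R).
set N1 := NN mu p (x => (vnorm (W x *m w) * \1_Q' x)%R) => H.
have N20 : (0 < N2)%E by exact: Lnorm_inv_weight_gt0.
have N2fin : N2 \is a fin_num.
  by rewrite ge0_fin_numE ?(ltW N20)//; exact: Lnorm_inv_weight_lty.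
have [c c1 cE] := phase w v.
have : ((m * modulus (dot w v))%:E <= Nf * N2)%E.
  rewrite -cE /w rdotZl mulrA mulfV ?gt_eqF// mul1r.
  apply: le_trans (rdot_vintegral_le (c *: v) mQ mQ' QQ' fi) _.
  rewrite le_eqVlt; apply/orP; left; apply/eqP; congr (_ * _)%E.
  by apply: eq_Lnorm => x; rewrite /= -scalemxAr vnormZ c1 mul1r.
move=> H'; have : (N1 * N2 <= (K%:E * Nf) * N2)%E.
  apply: le_trans H _; rewrite -mulrA EFinM -muleA.
  by apply: lee_wpmul2l => //; rewrite lee_fin ltW.
by rewrite lee_pmul2r// lt0e_neq0.
Qed.

(** Hoelder's inequality for |f| <= |W^-1| |W f|. *)
Lemma weight_L1_le (f : T -> V) (Q : set T) : measurable Q -> measurable_mx f ->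
  {ae mu, forall x, ~ Q x -> f x = 0} ->
  (NN mu 1%E (x => vnorm (f x)) <= NN mu p (x => vnorm (W x *m f x)) *
    NN mu p' (x => (mxnorm (invmx (W x)) * \1_Q x)%R))%E.
Proof.
move=> mQ mf fQ; have mI := measurable_mxnorm (measurable_mx_inv mW).
have m1 : measurable_fun setT (\1_Q : T -> R) by exact: measurable_indic.
have I0 x : 0 <= mxnorm (invmx (W x)) * \1_Q x by rewrite mulr_ge0 ?mxnorm_ge0.
have mI1 : measurable_fun setT (fun x => mxnorm (invmx (W x)) * \1_Q x).
  exact: measurable_funM.
have mWf := measurable_weight mf.
apply: le_trans (hoelder_ge0 muT p1 mWf mI1 _ I0); last first.
  by move=> x; exact: vnorm_ge0.
rewrite Lnorm1; apply: ae_ge0_le_integral => //.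
- apply/measurableT_comp => //; apply/measurable_EFinP; exact: measurable_vnorm.
- by move=> x _; rewrite lee_fin mulr_ge0 ?vnorm_ge0.
- by apply/measurable_EFinP; exact: measurable_funM.
apply: filterS2 pW fQ => x px fx _; rewrite /= lee_fin ger0_norm ?vnorm_ge0//.
have [Qx|/fx ->] := pselect (Q x); last by rewrite vnorm0 mulr_ge0 ?vnorm_ge0.
by rewrite indicE mem_set// mulr1 mulrC; exact: vnorm_le_inv.
Qed.

End Weight.
End VectorIntegrals.

(** * Packing *)

Section PackedSums.
Context dT (T : measurableType dT) (R : realType).
Variable mu : {measure set T -> \bar R}.
Hypothesis muT : (0 < mu setT)%E.

(** A point lies in at most one of the sets. *)
Lemma sum_indic_disjoint (I : eqType) (D : seq I) (Q : I -> set T) x : uniq D ->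
  {in D &, forall i j, i != j -> Q i `&` Q j = set0} ->
  \sum_(j <- D) \1_(Q j) x <= 1 :> R.
Proof.
elim: D => [|i D ih] /=; first by rewrite big_nil.
move=> /andP[iD uD] dis; rewrite big_cons.
have [xi|xi] := pselect (Q i x); last first.
  rewrite indicE memNset// add0r; apply: ih => // j m jD mD.
  by apply: dis; rewrite inE ?jD ?mD orbT.
rewrite indicE mem_set// big_seq big1 ?addr0// => j jD.
rewrite indicE memNset// => xj.
have : (Q i `&` Q j) x by [].
rewrite dis ?inE ?eqxx ?jD ?orbT//.
by apply: contraNneq iD => ->.
Qed.

Lemma disjoint_integral_le (I : eqType) (D : seq I) (Q : I -> set T) (g : T -> R) :
  uniq D -> {in D &, forall i j, i != j -> Q i `&` Q j = set0} ->
  (forall i, measurable (Q i)) -> measurable_fun setT g -> (forall x, 0 <= g x) ->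
  (\sum_(j <- D) \int[mu]_x (g x * \1_(Q j) x)%:E <= \int[mu]_x (g x)%:E)%E.
Proof.
move=> uD dis mQ mg g0.
have mgQ i : measurable_fun setT (fun x => (g x * \1_(Q i) x)%:E).
  by apply/measurable_EFinP; apply: measurable_funM => //; exact: measurable_indic.
rewrite -ge0_integral_sum//; last by move=> i x _; rewrite lee_fin mulr_ge0.
apply: ge0_le_integral => //.
- by move=> x _; apply: sume_ge0 => i _; rewrite lee_fin mulr_ge0.
- by apply: emeasurable_sum.
- by apply/measurable_EFinP.
move=> x _; rewrite sumEFin lee_fin -mulr_sumr -[leRHS]mulr1 ler_wpM2l//.
exact: sum_indic_disjoint.
Qed.

(** For finite p the integrals of p-th powers add up over the disjoint sets; for
p = oo the finitely many bounds hold simultaneously almost everywhere. *)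
Lemma Lnorm_packing p (I : eqType) (D : seq I) (Q : I -> set T) (g phi : T -> R)
    (h : I -> T -> R) (A K : R) : (1 <= p)%E ->
  uniq D -> {in D &, forall i j, i != j -> Q i `&` Q j = set0} ->
  (forall i, measurable (Q i)) ->
  measurable_fun setT g -> (forall x, 0 <= g x) ->
  measurable_fun setT phi -> (forall x, 0 <= phi x) ->
  (forall j, measurable_fun setT (h j)) -> (forall j x, 0 <= h j x) ->
  0 <= A -> 0 <= K ->
  (forall x, g x != 0 -> exists2 j, j \in D & g x <= h j x) ->
  {in D, forall j, (NN mu p (x => h j x) <=
    A%:E * NN mu p (x => (phi x * \1_(Q j) x)%R))%E} ->
  (NN mu p (x => phi x) <= K%:E)%E ->
  (NN mu p (x => g x) <= (A * K)%:E)%E.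
Proof.
move=> p1 uD dis mQ mg g0 mphi phi0 mh h0 A0 K0 gh hphi phiK.
have mphiQ j : measurable_fun setT (fun x => phi x * \1_(Q j) x).
  by apply: measurable_funM => //; exact: measurable_indic.
have phiQ0 j x : 0 <= phi x * \1_(Q j) x by rewrite mulr_ge0.
have phiQK j : (NN mu p (x => (phi x * \1_(Q j) x)%R) <= K%:E)%E.
  apply: le_trans phiK; apply: le_Lnorm_ae => //; apply: nearW => x.
  by rewrite -[leRHS]mulr1 ler_wpM2l// indicE; case: (_ \in _).
have hK j : j \in D -> (NN mu p (x => h j x) <= (A * K)%:E)%E.
  move=> jD; apply: (le_trans (hphi j jD)); rewrite EFinM.
  by apply: lee_wpmul2l.
case: p p1 hphi phiK phiQK hK => [r| |]// p1 hphi phiK phiQK hK; last first.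
  apply/Lnorm_infty_leP => //.
  have H (s : seq I) : {subset s <= D} ->
      {ae mu, forall x, forall j, j \in s -> h j x <= A * K}.
    elim: s => [|i s ih] sD; first exact: nearW.
    have /ih ihs : {subset s <= D} by move=> j js; apply: sD; rewrite inE js orbT.
    have /Lnorm_infty_leP hi : (NN mu +oo%E (x => h i x) <= (A * K)%:E)%E.
      by apply: hK; apply: sD; rewrite inE eqxx.
    apply: filterS2 (hi muT (h0 i)) ihs => x hix hs j.
    by rewrite inE => /predU1P[->//|/hs].
  apply: filterS (H D (fun _ => id)) => x hx.
  have [->|/gh[j jD gj]] := eqVneq (g x) 0; first exact: mulr_ge0.
  exact: le_trans gj (hx j jD).
rewrite lee_fin in p1; have r0 : 0 < r by exact: lt_le_trans p1.
have mpow (f : T -> R) : measurable_fun setT f ->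
    measurable_fun setT (fun x => (f x `^ r)%:E).
  by move=> mf; apply/measurable_EFinP; exact: (measurableT_comp (measurable_powR _)).
have AK0 : 0 <= A * K by exact: mulr_ge0.
apply/(Lnorm_fin_leP mu p1 g0 AK0).
have Phi : (\int[mu]_x (phi x `^ r)%:E <= (K `^ r)%:E)%E.
  exact/(Lnorm_fin_leP mu p1 phi0 K0).
have step j : j \in D -> (\int[mu]_x (h j x `^ r)%:E <=
    (A `^ r)%:E * \int[mu]_x (phi x `^ r * \1_(Q j) x)%:E)%E.
  move=> jD; set t := NN mu r%:E (x => (phi x * \1_(Q j) x)%R).
  have tfin : t \is a fin_num.
    by rewrite ge0_fin_numE ?Lnorm_ge0// (le_lt_trans (phiQK j))// ltry.
  have t0 : 0 <= fine t by rewrite fine_ge0// Lnorm_ge0.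
  have At0 : 0 <= A * fine t by exact: mulr_ge0.
  have := hphi j jD; rewrite -/t -(fineK tfin) -EFinM.
  move=> /(Lnorm_fin_leP mu p1 (h0 j) At0) /le_trans; apply.
  rewrite powRM// EFinM; apply: lee_wpmul2l; first by rewrite lee_fin powR_ge0.
  rewrite -poweR_EFin fineK// /t poweR_Lnorm ?gt_eqF//.
  rewrite le_eqVlt; apply/orP; left; apply/eqP; apply: eq_integral => x _.
  rewrite abse_EFin ger0_norm// poweR_EFin indicE; case: (_ \in _).
    by rewrite !mulr1.
  by rewrite !mulr0 powR0// gt_eqF.
apply: (@le_trans _ _ (\sum_(j <- D) \int[mu]_x (h j x `^ r)%:E)%E).
  rewrite -ge0_integral_sum//; last 2 first.
  - by move=> j; exact: mpow.
  - by move=> j x _; rewrite lee_fin powR_ge0.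
  apply: ge0_le_integral => //.
  - by move=> x _; rewrite lee_fin powR_ge0.
  - exact: mpow.
  - by apply: emeasurable_sum => j; exact: mpow.
  move=> x _; have [gx|/gh[j jD gj]] := eqVneq (g x) 0.
    rewrite gx powR0 ?gt_eqF//; apply: sume_ge0 => j _.
    by rewrite lee_fin powR_ge0.
  rewrite sumEFin lee_fin (bigD1_seq j)//=.
  apply: (@le_trans _ _ (h j x `^ r)).
    by apply: (ge0_ler_powR (ltW r0)); rewrite ?nnegrE.
  by rewrite lerDl sumr_ge0// => i _; rewrite powR_ge0.
apply: (@le_trans _ _
  (\sum_(j <- D) (A `^ r)%:E * \int[mu]_x (phi x `^ r * \1_(Q j) x)%:E)%E).
  by rewrite big_seq [leRHS]big_seq; apply: lee_sum.
rewrite -ge0_sume_distrr; last first.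
  by move=> j _; apply: integral_ge0 => x _; rewrite lee_fin mulr_ge0// powR_ge0.
rewrite powRM// EFinM; apply: lee_wpmul2l; first by rewrite lee_fin powR_ge0.
apply: le_trans Phi; apply: disjoint_integral_le => //.
  exact: (measurableT_comp (measurable_powR _)).
by move=> x; rewrite powR_ge0.
Qed.

End PackedSums.

Section Bodies.
Context (R : realType) (k : ground) (n : nat).
Local Notation F := (ground_field R k).
Local Notation V := 'cV[F]_n.

(** The midpoint of u and -u. *)
Lemma convex_body0 (K : set V) : convex_body K -> K 0.
Proof.
move=> [[u Ku] _ cK sK].
have KN : K (- u).
  rewrite -rsN1; apply: sK => //.
  by rewrite modulus_rs normrN normr1.
have h0 : 0 <= 2^-1 :> F by rewrite invr_ge0.
have h1 : 2^-1 <= 1 :> F by rewrite invf_le1// ler1n.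
have := cK u (- u) (Itv01 h0 h1) (mem_set Ku) (mem_set KN).
move=> /set_mem; congr K; rewrite /conv/=.
have -> : unstable.onem (2^-1 : F) = 2^-1.
  by rewrite /unstable.onem {1}(splitr 1) mul1r addrK.
by rewrite scalerN subrr.
Qed.

End Bodies.

(** * From the weight class to the weak bound *)

#[local] Opaque lebesgue.

Section MaximalFunction.
Context (R : realType) (d n : nat) (k : ground).
Local Notation F := (ground_field R k).
Local Notation Rd := (euclid R d).
Local Notation V := 'cV[F]_n.
Local Notation mu := (lebesgue R d).
Local Notation rs := (real_scalar k).

Lemma fine_lebesgue_cube (a : d.-tuple R) (l : R) : 0 <= l ->
  fine (mu (cube a l)) = l ^+ d.
Proof. by move=> l0; rewrite lebesgue_cube. Qed.

Lemma avg_normE (p : \bar R) (Q : set Rd) (g : Rd -> R) : (1 <= p)%E ->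
  (forall x, 0 <= g x) ->
  avg_norm p Q g = (((fine (mu Q))^-1 `^ inv_exponent p)%:E *
    NN mu p (x => (g x * \1_Q x)%R))%E.
Proof.
move=> p1 g0; have g1 x : 0 <= g x * \1_Q x by rewrite mulr_ge0.
case: p p1 => [r| |] p1; last by [].
  by rewrite /avg_norm avg_Lnorm// invr_ge0 fine_ge0.
by rewrite /avg_norm /inv_exponent powRr0 mul1e Lnorm_inftyE//; exact: lebesgueT_gt0.
Qed.

Lemma avg_norm_cube_prod (p : \bar R) (a : d.-tuple R) (l : R) (g h : Rd -> R) :
  (1 <= p)%E -> 0 < l -> (forall x, 0 <= g x) -> (forall x, 0 <= h x) ->
  (avg_norm p (cube a l) g * avg_norm (hoelder_conjugate p) (cube a l) h =
   ((l ^+ d)^-1)%:E * (NN mu p (x => (g x * \1_(cube a l) x)%R) *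
     NN mu (hoelder_conjugate p) (x => (h x * \1_(cube a l) x)%R)))%E.
Proof.
move=> p1 l0 g0 h0; rewrite !avg_normE//; last exact: hoelder_conj_ge1.
have ld : 0 < (l ^+ d)^-1 by rewrite invr_gt0 exprn_gt0.
rewrite fine_lebesgue_cube ?ltW// muleACA -EFinM -powRD; last first.
  by rewrite (gt_eqF ld) implybT.
by rewrite inv_exponent_hoelder// powRr1// ltW.
Qed.

(** The two normalizing powers of |Q| multiply to |Q|^-1, as 1/p + 1/p' = 1. *)
Lemma Ap_boundP (p : \bar R) (W : Rd -> 'M[F]_n) (C : R) : (1 <= p)%E ->
  Ap_bound p W C <->
  forall (a : d.-tuple R) (l : R), 0 < l -> forall u : V, exists2 v : V, v != 0 &
    (NN mu p (x => (vnorm (W x *m u) * \1_(cube a l) x)%R) *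
     NN mu (hoelder_conjugate p) (x => (vnorm (invmx (W x) *m v) * \1_(cube a l) x)%R)
       <= (C * l ^+ d * modulus (dot u v))%:E)%E.
Proof.
move=> p1; have E (a : d.-tuple R) (l : R) (u v : V) : 0 < l ->
  (avg_norm p (cube a l) (fun x => vnorm (W x *m u)) *
   avg_norm (hoelder_conjugate p) (cube a l) (fun x => vnorm (invmx (W x) *m v))
     <= (C * modulus (dot u v))%:E)%E =
  (NN mu p (x => (vnorm (W x *m u) * \1_(cube a l) x)%R) *
   NN mu (hoelder_conjugate p) (x => (vnorm (invmx (W x) *m v) * \1_(cube a l) x)%R)
     <= (C * l ^+ d * modulus (dot u v))%:E)%E.
  move=> l0; rewrite avg_norm_cube_prod//; last 2 first.
  - by move=> x; exact: vnorm_ge0.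
  - by move=> x; exact: vnorm_ge0.
  by rewrite lee_pdivrMl ?exprn_gt0// -EFinM mulrA [l ^+ d * C]mulrC.
split=> [H a l l0 u|H _ [a [l [l0 ->]]] u].
  have [|v v0 vC] := H (cube a l) _ u; first by exists a, l.
  by exists v => //; rewrite -E.
by have [v v0 vC] := H a l l0 u; exists v => //; rewrite E.
Qed.

(** Off the cube a selection of the restricted body is 0, which lies in every
body. *)
Lemma selections_restrict (G : Rd -> set V) (Q : set Rd) (f : Rd -> V) :
  measurable_body G -> selections (restrict_body G Q) f ->
  selections G f /\ {ae mu, forall x, ~ Q x -> f x = 0}.
Proof.
move=> [cG _] [bf fG]; split; first split => //.
  apply: filterS fG => x; rewrite /restrict_body; case: ifP => // _ ->.
  exact: convex_body0.
apply: filterS fG => x; rewrite /restrict_body => + xQ.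
by rewrite memNset.
Qed.

Lemma LpW_norm_le (p : \bar R) (W : Rd -> 'M[F]_n) (G : Rd -> set V) f :
  selections G f -> (NN mu p (x => vnorm (W x *m f x)) <= LpW_body_norm p W G)%E.
Proof. by move=> fG; apply: ereal_sup_ubound; exists f. Qed.

Lemma selections0 (G : Rd -> set V) : measurable_body G ->
  selections G (fun=> 0).
Proof.
move=> [cG _]; split; first by apply: measurable_mx_borel; exact: measurable_mx_cst.
by apply: nearW => x; exact: convex_body0.
Qed.

Lemma LpW_body_norm_fin (p : \bar R) (W : Rd -> 'M[F]_n) (G : Rd -> set V) :
  LpW_body p W G -> exists2 K : R, 0 <= K & LpW_body_norm p W G = K%:E.
Proof.
move=> [mG Gfin]; have N0 : (0 <= LpW_body_norm p W G)%E.
  apply: le_trans (LpW_norm_le p W (selections0 mG)); exact: Lnorm_ge0.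
exists (fine (LpW_body_norm p W G)); first exact: fine_ge0.
by rewrite fineK// ge0_fin_numE.
Qed.

Section Weighted.
Variables (p : \bar R) (W : Rd -> 'M[F]_n).
Hypothesis p1 : (1 <= p)%E.
Hypothesis wW : matrix_weight W.
Let mW : measurable_mx W := borel_measurable_mx wW.1.
Let pW : {ae mu, forall x, posdef (W x)} := wW.2.
Let muT := lebesgueT_gt0 R d.

Lemma L1loc_of_LpW (G : Rd -> set V) : inv_Lploc (hoelder_conjugate p) W ->
  LpW_body p W G -> L1loc_body G.
Proof.
move=> iW GL; have [K K0 KE] := LpW_body_norm_fin GL; have mG := GL.1.
split => // Q cQ; have mQ : measurable Q.
  by have [a [l [_ ->]]] := cQ; exact: measurable_cube.
have Ifin := iW Q cQ.
set I := NN mu (hoelder_conjugate p) (x => (mxnorm (invmx (W x)) * \1_Q x)%R) in Ifin.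
have I0 : (0 <= I)%E by exact: Lnorm_ge0.
exists (K * fine I).
move=> f fS; have [fG f0] := selections_restrict mG fS.
have mf := borel_measurable_mx fS.1.
apply: le_trans (weight_L1_le muT p1 mW pW mQ mf f0) _.
rewrite EFinM fineK; last by rewrite ge0_fin_numE.
by apply: lee_wpmul2r => //; rewrite -KE; exact: LpW_norm_le.
Qed.

Definition mean (a : d.-tuple R) (l : R) (f : Rd -> V) : V :=
  rs (l ^+ d)^-1 *: gvintegral mu (cube a l) f.

Lemma body_averageE (G : Rd -> set V) (a : d.-tuple R) (l : R) : 0 < l ->
  body_average G (cube a l) =
  [set mean a l f | f in selections (restrict_body G (cube a l))].
Proof. by move=> l0; rewrite /body_average fine_lebesgue_cube// ltW. Qed.

(** The components of q are the corner and the side of a cube and a selection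
over it; countably many such q suffice to cover a level set. *)
Definition near_mean (G : Rd -> set V) (u : V) (m : nat)
    (q : d.-tuple R * R * (Rd -> V)) : Prop :=
  [/\ 0 < q.1.2, selections (restrict_body G (cube q.1.1 q.1.2)) q.2 &
      vnorm (mean q.1.1 q.1.2 q.2 - u) < m.+1%:R^-1].

Lemma maximalP (G : Rd -> set V) (u : V) x : maximal G x u <->
  forall m, exists2 q, near_mean G u m q & cube q.1.1 q.1.2 x.
Proof.
rewrite /maximal closure_vnormP; split => h m.
  have [w [Q /= [[a [l [l0 ->]]] xQ]]] := h m.
  by rewrite body_averageE// => -[f fS <-] wu; exists (a, l, f).
have [[[a l] f] [/= l0 fS fu] xQ] := h m.
exists (mean a l f) => //; exists (cube a l); first by split => //; exists a, l.
by rewrite body_averageE//; exists f.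
Qed.

(** Lindelof's property for the cubes carrying a mean near u; if there are none,
then u lies in no value of the maximal function. *)
Lemma near_mean_cover (G : Rd -> set V) (u : V) m :
  (forall x, ~ maximal G x u) \/
  exists2 s, (forall i, near_mean G u m (s i)) &
    forall q x, near_mean G u m q -> cube q.1.1 q.1.2 x ->
      exists i : nat, cube (s i).1.1 (s i).1.2 x.
Proof.
have [[q0 q0P]|none] := pselect (exists q, near_mean G u m q); last first.
  by left => x /maximalP/(_ m)[q qP _]; apply: none; exists q.
right; have [s sP cov] := @cube_lindelof R d _ (near_mean G u m)
  (fun q => q.1.1) (fun q => q.1.2) q0 q0P.
by exists s.
Qed.

Lemma measurable_maximal (G : Rd -> set V) (u : V) :
  measurable [set x | maximal G x u].
Proof.
have [[x0 x0u]|none] := pselect (exists x, maximal G x u); last first.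
  by rewrite (_ : [set x | _] = set0)// -subset0 => x xu; apply: none; exists x.
pose O m := [set x | exists2 q, near_mean G u m q & cube q.1.1 q.1.2 x].
rewrite (_ : [set x | _] = \bigcap_m O m); last first.
  apply/seteqP; split => x; first by move=> /maximalP h m _; exact: h.
  by move=> h; apply/maximalP => m; exact: h.
apply: bigcapT_measurable => m.
have [/(_ x0)//|[s sP cov]] := near_mean_cover G u m.
rewrite (_ : O m = \bigcup_i cube (s i).1.1 (s i).1.2); last first.
  apply/seteqP; split => x; first by move=> [q qP /(cov _ _ qP)[i xi]]; exists i.
  by move=> [i _ xi]; exists (s i).
by apply: bigcupT_measurable => i; exact: measurable_cube.
Qed.

Lemma weak_norm_atE (G : Rd -> set V) (u : V) : weak_norm_at p W G u =
  NN mu p (x => (vnorm (W x *m u) * \1_[set y | maximal G y u] x)%R).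
Proof.
rewrite /weak_norm_at /LpW_norm; apply: eq_Lnorm => x; congr EFin.
have [xE|xE] := pselect (maximal G x u).
  by rewrite mem_set// indicE mem_set// mulr1.
by rewrite memNset// mulmx0 vnorm0 indicE memNset// mulr0.
Qed.

Lemma borel_if (Q : set Rd) (f g : Rd -> V) : measurable Q ->
  borel_fun f -> borel_fun g -> borel_fun (fun x => if x \in Q then f x else g x).
Proof.
move=> mQ bf bg; apply: measurable_mx_borel.
exact: (measurable_mx_if mQ (borel_measurable_mx bf) (borel_measurable_mx bg)).
Qed.

(** Outside the given sets the zero selection is used. *)
Lemma glue_selections (G : Rd -> set V) (I : eqType) (D : seq I)
    (Q : I -> set Rd) (f : I -> Rd -> V) : measurable_body G ->
  (forall i, measurable (Q i)) -> uniq D ->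
  {in D &, forall i j, i != j -> Q i `&` Q j = set0} ->
  (forall i, selections (restrict_body G (Q i)) (f i)) ->
  exists2 g, selections G g & forall i x, i \in D -> Q i x -> g x = f i x.
Proof.
move=> mG mQ + + fS; elim: D => [_ _|i D ih].
  by exists (fun=> 0) => //; exact: selections0.
rewrite cons_uniq => /andP[iD uD] dis.
have [//|j m jD mD|g [bg gG] gf] := ih.
  by apply: dis; rewrite inE ?jD ?mD orbT.
have [[bf fG] _] := selections_restrict mG (fS i).
exists (fun x => if x \in Q i then f i x else g x).
  split; first exact: borel_if.
  by apply: filterS2 fG gG => x fx gx; case: ifP.
move=> j x; rewrite inE => /predU1P[->|jD] xj; first by rewrite mem_set.
have ij : i != j by apply: contraNneq iD => ->.
rewrite memNset; first exact: gf.
move=> xi; have : (Q i `&` Q j) x by [].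
by rewrite dis ?inE ?eqxx ?jD ?orbT.
Qed.

Section UpperBound.
Variables (C K : R) (G : Rd -> set V).
Hypothesis C0 : 0 < C.
Hypothesis iW : inv_Lploc (hoelder_conjugate p) W.
Hypothesis WC : Ap_bound p W C.
Hypothesis GL : LpW_body p W G.
Hypothesis K0 : 0 <= K.
Hypothesis GK : LpW_body_norm p W G = K%:E.

(** The mean of f over the tripled cube is 3^-d times its mean over the cube, so
both are controlled by the inequality on the tripled cube. *)
Lemma mean_triple_le (a : d.-tuple R) (l : R) (f : Rd -> V) : 0 < l ->
  selections (restrict_body G (cube a l)) f ->
  (NN mu p (x => (vnorm (W x *m mean a l f) * \1_(triple a l) x)%R) <=
   (3 ^+ d * C)%:E * NN mu p (x => vnorm (W x *m f x)))%E.
Proof.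
move=> l0 fS; have l3 : 0 < 3 * l by rewrite mulr_gt0.
have [_ L1] := L1loc_of_LpW iW GL.
have [|B fB] := L1 (cube a l); first by exists a, l.
have fi : vintegrable mu f.
  by split; [exact: (borel_measurable_mx fS.1)|apply: le_lt_trans (fB f fS) _; exact: ltry].
have [v v0 vC] := (Ap_boundP W C p1).1 WC [tuple tnth a i - l | i < d] _ l3 (mean a l f).
apply: (mean_weight_le muT p1 mW pW _ _ _ _ fi _ _ v0 _ _).
- exact: measurable_cube.
- exact: measurable_cube.
- exact: sub_triple.
- exact: lebesgue_cube_gt0.
- by rewrite mulr_gt0// exprn_gt0.
- by rewrite exprn_gt0.
- by apply: iW; exists [tuple tnth a i - l | i < d], (3 * l).
apply: le_trans vC _; rewrite lee_fin exprMn; apply: ler_wpM2r.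
  exact: modulus_ge0.
by rewrite le_eqVlt; apply/orP; left; apply/eqP; ring.
Qed.

(** Points at which a perturbation of u of size 1/(m+1) changes W u by at most
half its length. *)
Definition comparable_at (u : V) (m : nat) : set Rd :=
  [set x | mxnorm (W x) * m.+1%:R^-1 <= 2^-1 * vnorm (W x *m u)].

Lemma measurable_comparable_at u m : measurable (comparable_at u m).
Proof.
have ml : measurable_fun setT (fun x => mxnorm (W x) * m.+1%:R^-1).
  by apply: measurable_funM; [exact: measurable_mxnorm|exact: measurable_cst].
have mr : measurable_fun setT (fun x => 2^-1 * vnorm (W x *m u)).
  by apply: measurable_funM; [exact: measurable_cst|exact: (measurable_weight_cst mW)].
have := measurable_fun_ler ml mr.
by move=> /(_ measurableT [set true] Logic.I); rewrite setTI.
Qed.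

Lemma comparable_atP (u w : V) m x : comparable_at u m x ->
  vnorm (w - u) < m.+1%:R^-1 -> vnorm (W x *m u) <= 2 * vnorm (W x *m w).
Proof.
rewrite /comparable_at/= => cx wu.
have : vnorm (W x *m u) <= vnorm (W x *m w) + mxnorm (W x) * m.+1%:R^-1.
  rewrite -[u in leLHS](subrK w) mulmxDr addrC; apply: le_trans (vnormD _ _) _.
  rewrite lerD2l; apply: le_trans (vnorm_mulmx_le _ _) _.
  by rewrite ler_wpM2l ?mxnorm_ge0// vnormB ltW.
move: cx; set e := mxnorm _ * _; set b := vnorm (W x *m u).
set c := vnorm (W x *m w) => cx h; lra.
Qed.

(** The part of the level set covered by finitely many cubes.  Vitali's selection
covers it by triples of disjoint cubes, on each of which |W u| is at most twice
|W w| for the corresponding mean w; the selections glue to a single one. *)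
Lemma weak_step (u : V) (m N : nat) (s : nat -> d.-tuple R * R * (Rd -> V)) :
  (forall i, near_mean G u m (s i)) ->
  (NN mu p (x => (vnorm (W x *m u) * \1_(comparable_at u m `&`
      \bigcup_(i in `I_N) cube (s i).1.1 (s i).1.2) x)%R)
    <= (2 * (3 ^+ d * C) * K)%:E)%E.
Proof.
move=> sP; set A := _ `&` _.
pose a i := (s i).1.1; pose l i := (s i).1.2.
have l0 i : 0 < l i by have [] := sP i.
pose w i := mean (a i) (l i) (s i).2.
have mA : measurable A.
  apply: measurableI; first exact: measurable_comparable_at.
  by apply: bigcup_measurable => i _; exact: measurable_cube.
have mQ i : measurable (cube (a i) (l i) : set Rd) by exact: measurable_cube.
have [D [uD Ds dis cov]] := @vitali_cubes R d _ a l (iota 0 N) l0.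
have fS i : selections (restrict_body G (cube (a i) (l i))) (s i).2 by have [] := sP i.
have [f fG fE] := glue_selections GL.1 mQ uD dis fS.
have mA1 : measurable_fun setT (\1_A : Rd -> R) by exact: measurable_indic.
have mu0 : measurable_fun setT (fun x => vnorm (W x *m u)) by exact: (measurable_weight_cst mW).
have mw i : measurable_fun setT (fun x => vnorm (W x *m w i) * \1_(triple (a i) (l i)) x).
  apply: measurable_funM; first exact: (measurable_weight_cst mW).
  by apply: measurable_indic; exact: measurable_cube.
have w0 i x : 0 <= vnorm (W x *m w i) * \1_(triple (a i) (l i)) x.
  by rewrite mulr_ge0 ?vnorm_ge0.
have mphi : measurable_fun setT (fun x => vnorm (W x *m f x)).
  exact: (measurable_weight mW (borel_measurable_mx fG.1)).
have Ccst : 0 < 2 * (3 ^+ d * C) by rewrite !mulr_gt0// exprn_gt0.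
have mg : measurable_fun setT (fun x => vnorm (W x *m u) * \1_A x) by exact: measurable_funM.
have g0 x : 0 <= vnorm (W x *m u) * \1_A x by rewrite mulr_ge0 ?vnorm_ge0.
have mh i : measurable_fun setT
    (fun x => 2 * (vnorm (W x *m w i) * \1_(triple (a i) (l i)) x)).
  by apply: measurable_funM; [exact: measurable_cst|exact: mw].
have h0 i x : 0 <= 2 * (vnorm (W x *m w i) * \1_(triple (a i) (l i)) x).
  by rewrite mulr_ge0.
apply: (Lnorm_packing muT p1 uD dis mQ mg g0 mphi (fun x => vnorm_ge0 _) mh h0
  (ltW Ccst) K0).
- move=> x; have [xA _|xA] := pselect (A x); last by rewrite indicE memNset// mulr0 eqxx.
  have [xc [i /= iN xi]] := xA.
  have [|j jD xj] := cov i x _ xi; first by rewrite mem_iota.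
  exists j => //; rewrite indicE mem_set// mulr1 indicE mem_set// mulr1.
  by apply: comparable_atP xc _; have [] := sP j.
- move=> j jD; rewrite (LnormZ muT p1 (mw j) (w0 j) (ler0n _ 2)) EFinM -muleA.
  apply: lee_wpmul2l; first by rewrite lee_fin.
  apply: le_trans (mean_triple_le (l0 j) (fS j)) _.
  apply: lee_wpmul2l; first by rewrite lee_fin mulr_ge0 ?exprn_ge0// ltW.
  have [_ f0] := selections_restrict GL.1 (fS j).
  apply: (le_Lnorm_ae muT p1).
  + exact: (measurable_weight mW (borel_measurable_mx (fS j).1)).
  + by apply: measurable_funM; [exact: mphi|exact: measurable_indic].
  + by move=> x; exact: vnorm_ge0.
  + by move=> x; rewrite mulr_ge0 ?vnorm_ge0.
  apply: filterS f0 => x f0.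
  have [xj|xj] := pselect (cube (a j) (l j) x); last first.
    by rewrite f0// mulmx0 vnorm0 mulr_ge0 ?vnorm_ge0.
  by rewrite (fE _ _ jD xj) indicE mem_set// mulr1.
- by rewrite -GK; exact: LpW_norm_le.
Qed.

(** Two exhaustions: first by the sets where vectors near u are comparable to
u, which cover almost everything as W u does not vanish, then by finite unions
of the cubes covering the level set. *)
Lemma weak_bound_at (u : V) :
  (weak_norm_at p W G u <= (2 * (3 ^+ d * C) * K)%:E)%E.
Proof.
have B0 : 0 <= 2 * (3 ^+ d * C) * K.
  by rewrite !mulr_ge0 ?exprn_ge0// ltW.
pose E := [set x | maximal G x u].
have mE : measurable E by exact: measurable_maximal.
have mu0 : measurable_fun setT (fun x => vnorm (W x *m u)) by exact: (measurable_weight_cst mW).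
have mE1 : measurable_fun setT (\1_E : Rd -> R) by exact: measurable_indic.
have g0 x : 0 <= vnorm (W x *m u) * \1_E x by rewrite mulr_ge0 ?vnorm_ge0.
rewrite weak_norm_atE -/E; have [->|u0] := eqVneq u 0.
  rewrite (_ : Lnorm _ _ _ = 0%E) ?lee_fin//.
  rewrite -(Lnorm_cst0 mu p1); apply: eq_Lnorm => x.
  by rewrite mulmx0 vnorm0 mul0r.
have mg : measurable_fun setT (fun x => vnorm (W x *m u) * \1_E x) by exact: measurable_funM.
have ndc : nondecreasing_seq (comparable_at u).
  move=> i j ij; apply/subsetPset => x /=; apply: le_trans.
  by rewrite ler_wpM2l ?mxnorm_ge0// lef_pV2 ?posrE// ler_nat ltnS.
apply: (Lnorm_mono_sets muT p1 mg g0 B0 (measurable_comparable_at u) ndc).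
- apply: filterS pW => x px _.
  have c0 : 0 < 2^-1 * vnorm (W x *m u).
    rewrite mulr_gt0// vnorm_gt0//; apply: contra u0 => /eqP Wu.
    by rewrite -[u]mul1mx -(mulVmx (posdef_unitmx px)) -mulmxA Wu mulmx0.
  have e0 : 0 < 2^-1 * vnorm (W x *m u) / (mxnorm (W x) + 1).
    by rewrite divr_gt0// ltr_wpDl// mxnorm_ge0.
  have [m] := ltr_add_invr e0; rewrite add0r => me; exists m.
  rewrite /comparable_at/=; apply: (@le_trans _ _ ((mxnorm (W x) + 1) * m.+1%:R^-1)).
    by rewrite ler_wpM2r// lerDl.
  by rewrite mulrC -ler_pdivlMr ?ltr_wpDl ?mxnorm_ge0// ltW.
move=> m; have [none|[s sP cov]] := near_mean_cover G u m.
  rewrite (_ : Lnorm _ _ _ = 0%E) ?lee_fin//.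
  rewrite -(Lnorm_cst0 mu p1); apply: eq_Lnorm => x.
  by rewrite [\1_E x]indicE memNset ?mulr0 ?mul0r//; exact: none.
have mc := measurable_comparable_at u m.
have mc1 : measurable_fun setT (\1_(comparable_at u m) : Rd -> R) by exact: measurable_indic.
pose U N := \bigcup_(i in `I_N) (cube (s i).1.1 (s i).1.2 : set Rd).
have mU N : measurable (U N).
  by apply: bigcup_measurable => i _; exact: measurable_cube.
have mgc : measurable_fun setT (fun x => vnorm (W x *m u) * \1_E x * \1_(comparable_at u m) x).
  exact: measurable_funM.
have gc0 x : 0 <= vnorm (W x *m u) * \1_E x * \1_(comparable_at u m) x.
  by rewrite mulr_ge0.
have ndU : nondecreasing_seq U.
  move=> i j ij; apply/subsetPset => x [z /= zi xz]; exists z => //=.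
  exact: leq_trans ij.
apply: (Lnorm_mono_sets muT p1 mgc gc0 B0 mU ndU).
- apply: nearW => x; have [xE _|xE] := pselect (E x); last first.
    by rewrite [\1_E x]indicE memNset// mulr0 mul0r eqxx.
  have [q qP xq] := (maximalP G u x).1 xE m.
  have [i xi] := cov q x qP xq.
  by exists i.+1; exists i => //=.
move=> N; apply: le_trans (weak_step N sP).
have mAU : measurable (comparable_at u m `&` U N) by exact: measurableI.
apply: (le_Lnorm_ae muT p1).
- by apply: measurable_funM; [exact: mgc|exact: measurable_indic].
- by apply: measurable_funM; [exact: mu0|exact: measurable_indic].
- by move=> x; rewrite mulr_ge0.
- by move=> x; rewrite mulr_ge0 ?vnorm_ge0.
apply: nearW => x; rewrite -[leRHS]mulr1 -!mulrA ler_wpM2l ?vnorm_ge0//.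
rewrite !indicE in_setI; case: (x \in E); case: (x \in comparable_at u m);
  by case: (x \in U N); rewrite /= ?mulr0 ?mul0r ?mulr1.
Qed.

End UpperBound.

Theorem weak_bound_of_Ap (C : R) : 0 < C ->
  inv_Lploc (hoelder_conjugate p) W -> Ap_bound p W C ->
  weak_bound p W (2 * (3 ^+ d * C)).
Proof.
move=> C0 iW WC G GL; have [K K0 KE] := LpW_body_norm_fin GL.
rewrite KE -EFinM; apply: ge_ereal_sup => _ [u _ <-].
exact: weak_bound_at.
Qed.

End Weighted.
End MaximalFunction.

(** * Separation and duality *)

Section Separation.
Context (R : realType) (k : ground) (n : nat).
Local Notation F := (ground_field R k).
Local Notation V := 'cV[F]_n.
Local Notation rs := (real_scalar k).

(** A point at positive distance from a bounded convex set is separated from it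
by the direction towards a nearly nearest point; moving from that point towards
any other point of the set cannot reduce the distance by much. *)
Lemma separation (B : set V) (z : V) (M e : R) : B !=set0 ->
  (forall u w t, B u -> B w -> 0 <= t -> t <= 1 -> B (rs (1 - t) *: u + rs t *: w)) ->
  (forall w, B w -> vnorm w <= M) -> 0 < e ->
  (forall w, B w -> e <= vnorm (z - w)) ->
  exists2 v : V, v != 0 & forall w, B w -> rdot w v <= rdot z v.
Proof.
move=> [y0 By0] cB bB e0 dB.
pose S := [set vnorm (z - w) ^+ 2 | w in B].
have Se s : S s -> e ^+ 2 <= s.
  by move=> [w Bw <-]; rewrite lerXn2r ?nnegrE ?vnorm_ge0 ?dB// ltW.
have Sinf : has_inf S.
  by split; [exists (vnorm (z - y0) ^+ 2), y0|exists (e ^+ 2) => s; exact: Se].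
pose D := inf S.
have De : e ^+ 2 <= D by apply: lb_le_inf => //; exact: Sinf.1.
have D0 : 0 < D by apply: lt_le_trans De; rewrite exprn_gt0.
have DS w : B w -> D <= vnorm (z - w) ^+ 2.
  by move=> Bw; apply: ge_inf; [exact: Sinf.2|exists w].
pose L := (M + M) ^+ 2.
have L0 : 0 <= L by rewrite sqr_ge0.
have LB u w : B u -> B w -> vnorm (u - w) ^+ 2 <= L.
  move=> Bu Bw; have M0 : 0 <= M by apply: le_trans (bB _ Bu); exact: vnorm_ge0.
  rewrite lerXn2r ?nnegrE ?vnorm_ge0 ?addr_ge0//.
  by apply: le_trans (vnormD _ _) _; rewrite vnormN lerD// bB.
(* The step t balances the first-order gain 2 t c against the second-order term
t^2 L and the defect t D of the nearly nearest point y. *)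
pose t := D / (L + D).
have LD0 : 0 < L + D by rewrite ltr_wpDl.
have t0 : 0 < t by rewrite divr_gt0.
have t1 : t <= 1 by rewrite ler_pdivrMr// mul1r lerDr.
have tL : t * L <= D.
  rewrite /t mulrAC ler_pdivrMr// ler_wpM2l ?(ltW D0)//.
  by rewrite lerDl ltW.
have [_ [y By <-] yD] : exists2 s, S s & s < D + t * D.
  by apply: inf_adherent => //; rewrite mulr_gt0.
exists (z - y).
  apply/eqP => zy; have := dB y By; rewrite zy vnorm0 leNgt e0//.
move=> w Bw.
have := DS _ (cB y w t By Bw (ltW t0) t1).
have -> : z - (rs (1 - t) *: y + rs t *: w) = (z - y) + rs (- t) *: (w - y).
  apply/matrixP => i j; rewrite !mxE.
  by apply: re_im_inj; rewrite ?(reD, reN, imD, imN, re_rsM, im_rsM); ring.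
rewrite vnorm_sqrD rdotZr vnormZ modulus_rs normrN (ger0_norm (ltW t0)) exprMn.
have := LB w y Bw By.
set c := rdot (z - y) (w - y); set q := vnorm (w - y) ^+ 2; set v2 := vnorm (z - y) ^+ 2.
move=> qL h.
have : c <= v2.
  have c2 : 2 * (t * c) <= t * D + t ^+ 2 * L.
    have : t ^+ 2 * q <= t ^+ 2 * L by rewrite ler_wpM2l// sqr_ge0.
    move: h yD; rewrite -/v2; set X := t ^+ 2 * q; set Y := t ^+ 2 * L.
    set Z := t * D; rewrite mulNr mulrN; set U := t * c; move=> *; lra.
  have : 2 * c <= D + t * L.
    rewrite -(ler_pM2l t0); have -> : t * (2 * c) = 2 * (t * c) by ring.
    by have -> : t * (D + t * L) = t * D + t ^+ 2 * L by ring.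
  have := DS y By; rewrite -/v2; set X := t * L in tL *; move=> *; lra.
rewrite /v2 vnorm_sqr /c => hc.
have e1 : rdot (z - y) (w - y) = rdot w (z - y) - rdot y (z - y).
  by rewrite rdotDr rdotNr !(rdotC (z - y)).
have e2 : rdot (z - y) (z - y) = rdot z (z - y) - rdot y (z - y).
  by rewrite rdotDl rdotNl.
by move: hc; rewrite e1 e2 lerD2r.
Qed.

End Separation.

Section LowerBound.
Context dT (T : measurableType dT) (R : realType) (k : ground) (n : nat).
Variable mu : {measure set T -> \bar R}.
Hypothesis muT : (0 < mu setT)%E.
Local Notation F := (ground_field R k).
Local Notation V := 'cV[F]_n.
Local Notation rs := (real_scalar k).
Variables (p : \bar R) (W : T -> 'M[F]_n) (Q : set T) (m C : R).
Hypothesis p1 : (1 <= p)%E.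
Hypothesis mW : measurable_mx W.
Hypothesis pW : {ae mu, forall x, posdef (W x)}.
Hypothesis mQ : measurable Q.
Hypothesis m0 : 0 < m.
Hypothesis muQ : mu Q = m%:E.
Hypothesis C0 : 0 < C.
Local Notation p' := (hoelder_conjugate p).
Local Notation Qmean f := (rs m^-1 *: gvintegral mu Q f).

Hypothesis mean_le : forall f : T -> V, measurable_mx f ->
  (forall x, ~ Q x -> f x = 0) ->
  (NN mu p (x => vnorm (W x *m f x)) < +oo)%E ->
  vintegrable mu f /\
  (NN mu p (x => (vnorm (W x *m Qmean f) * \1_Q x)%R) <=
    C%:E * NN mu p (x => vnorm (W x *m f x)))%E.

Let p1' : (1 <= p')%E := hoelder_conj_ge1 p1.
Let m1 : measurable_fun setT (\1_Q : T -> R). Proof. exact: measurable_indic. Qed.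
Let muQ0 : (0 < mu Q)%E. Proof. by rewrite muQ lte_fin. Qed.

Let N (w : V) := NN mu p (x => (vnorm (W x *m w) * \1_Q x)%R).

Let mN (w : V) : measurable_fun setT (fun x => vnorm (W x *m w) * \1_Q x).
Proof. by apply: measurable_funM => //; exact: measurable_weight_cst. Qed.

Let N0 (w : V) x : 0 <= vnorm (W x *m w) * \1_Q x.
Proof. by rewrite mulr_ge0 ?vnorm_ge0. Qed.

Let NZ t w : N (rs t *: w) = (`|t|%:E * N w)%E.
Proof.
rewrite -LnormZ//; apply: eq_Lnorm => x.
by rewrite -scalemxAr vnormZ modulus_rs mulrA.
Qed.

Lemma Lnorm_indic_lty : (NN mu p (x => \1_Q x) < +oo)%E.
Proof.
have i0 x : 0 <= (\1_Q x : R) by [].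
case: p p1 => [r| |]// r1.
  rewrite lee_fin in r1; have r0 : 0 < r by exact: lt_le_trans r1.
  rewrite Lnorm_finE// poweR_lty//.
  rewrite (_ : integral _ _ _ = \int[mu]_x (\1_Q x)%:E)%E; last first.
    apply: eq_integral => x _; rewrite indicE.
    by case: (_ \in _); rewrite ?powR1// powR0// gt_eqF.
  by rewrite integral_indic// setIT muQ ltry.
apply: (@le_lt_trans _ _ 1%:E); last exact: ltry.
apply/(Lnorm_infty_leP muT) => //; apply: nearW => x.
by rewrite indicE; case: (_ \in _).
Qed.

(* A bounded function supported on Q and positive there, whose product with the
norm of A is bounded by 1. *)
Let tame (A : T -> 'M[F]_n) x : R := \1_Q x * (1 + mxnorm (A x))^-1.

Let tame_ge0 A x : 0 <= tame A x.
Proof. by rewrite mulr_ge0// invr_ge0 addr_ge0 ?mxnorm_ge0. Qed.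

Let tame_off A x : ~ Q x -> tame A x = 0.
Proof. by move=> xQ; rewrite /tame indicE memNset// mul0r. Qed.

Let tame_gt0 A x : Q x -> 0 < tame A x.
Proof.
by move=> xQ; rewrite /tame indicE mem_set// mul1r invr_gt0 ltr_pwDl ?mxnorm_ge0.
Qed.

Let tame_le1 A x : tame A x <= \1_Q x.
Proof.
rewrite /tame -[leRHS]mulr1 ler_wpM2l// invf_le1 ?lerDl ?mxnorm_ge0//.
by rewrite ltr_pwDl ?mxnorm_ge0.
Qed.

Let tame_mxnorm A x : mxnorm (A x) * tame A x <= \1_Q x.
Proof.
rewrite /tame mulrCA -[leRHS]mulr1 ler_wpM2l//.
by rewrite ler_pdivrMr ?ltr_pwDl ?mxnorm_ge0// mul1r lerDr.
Qed.

Let measurable_tame A : measurable_mx A -> measurable_fun setT (tame A).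
Proof.
move=> mA; apply: measurable_funM => //; apply: measurable_funV_ge0.
  by move=> x; rewrite addr_ge0 ?mxnorm_ge0.
by apply: measurable_funD; [exact: measurable_cst|exact: measurable_mxnorm].
Qed.

(** Multiples of a fixed vector by a scalar function taming the weight show that
the means span, so that the weight is locally in the space. *)
Lemma weight_cst_lty (v : V) : (N v < +oo)%E.
Proof.
pose f x := rs (tame W x) *: v.
have mf : measurable_mx f.
  apply: measurable_mx_scale; last exact: measurable_mx_cst.
  by apply: measurable_scalar_rs; exact: measurable_tame.
have fQ x : ~ Q x -> f x = 0 by move=> xQ; rewrite /f tame_off// rs0 scale0r.
have Wf : (NN mu p (x => vnorm (W x *m f x)) < +oo)%E.
  apply: (@le_lt_trans _ _ (NN mu p (x => (vnorm v * \1_Q x)%R))).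
    apply: le_Lnorm_ae => //.
    - exact: measurable_weight.
    - by apply: measurable_funM => //; exact: measurable_cst.
    - by move=> x; exact: vnorm_ge0.
    - by move=> x; rewrite mulr_ge0 ?vnorm_ge0.
    apply: nearW => x; rewrite /f -scalemxAr vnormZ modulus_rs ger0_norm//.
    apply: (@le_trans _ _ (tame W x * (mxnorm (W x) * vnorm v))).
      by rewrite ler_wpM2l// vnorm_mulmx_le.
    rewrite mulrA [leRHS]mulrC ler_wpM2r ?vnorm_ge0// mulrC; exact: tame_mxnorm.
  rewrite LnormZ ?vnorm_ge0//.
  by rewrite lte_mul_pinfty ?lee_fin ?vnorm_ge0// Lnorm_indic_lty.
have [_ Nf] := mean_le mf fQ Wf.
have tI : mu.-integrable Q (EFin \o tame W).
  apply: measurable_bounded_integrable => //.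
  - by rewrite muQ ltry.
  - by apply: measurable_funTS; exact: measurable_tame.
  - exists 1; split; first exact: num_real.
    move=> M M1 x _; rewrite /= ger0_norm//; apply: le_trans (tame_le1 _ _) _.
    by apply: le_trans (ltW M1); rewrite indicE; case: (_ \in _).
set I := \int[mu]_(x in Q) tame W x.
have I0 : 0 < I.
  have tE : (\int[mu]_(x in Q) (tame W x)%:E = NN mu 1%E (x => tame W x))%E.
    rewrite Lnorm1 integral_mkcond; apply: eq_integral => x _.
    rewrite patchE abse_EFin ger0_norm//; case: ifPn => // /negP xQ.
    by rewrite tame_off// => /mem_set.
  have : (0 < \int[mu]_(x in Q) (tame W x)%:E)%E.
    rewrite tE; apply: (@Lnorm_gt0 _ _ _ _ _ _ Q) => //; first exact: measurable_tame.
    by apply: nearW => x xQ; apply/eqP; rewrite gt_eqF// tame_gt0.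
  move=> h; rewrite /I /Rintegral fine_gt0// h/=.
  have := integrable_fin_num mQ tI; rewrite ge0_fin_numE//.
  by apply: integral_ge0 => x _; rewrite lee_fin.
have meanE : Qmean f = rs (m^-1 * I) *: v.
  have key (h : F -> R) : (forall t z, h (rs t * z) = t * h z) -> forall i,
      \int[mu]_(x in Q) h (f x i 0) = I * h (v i 0).
    move=> hZ i; rewrite -RintegralZr//; apply: eq_Rintegral => x _.
    by rewrite mxE hZ.
  apply/matrixP => i j; rewrite ord1 rsM -scalerA !mxE; congr (_ * _).
  apply: re_im_inj; first by rewrite re_rsM re_of_re_im; apply: key; exact: re_rsM.
  by rewrite im_rsM im_Rintegral; apply: key; exact: im_rsM.
have c0 : 0 < m^-1 * I by rewrite mulr_gt0// invr_gt0.
have : (N (Qmean f) < +oo)%E.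
  by apply: le_lt_trans Nf _; rewrite lte_mul_pinfty// lee_fin ltW.
rewrite meanE NZ (gtr0_norm c0) => H; apply: contraTT H.
rewrite -!leNgt !leye_eq => /eqP ->.
by rewrite gt0_muley ?lte_fin.
Qed.

Lemma weight_mxnorm_lty : (NN mu p (x => (mxnorm (W x) * \1_Q x)%R) < +oo)%E.
Proof.
apply: (@le_lt_trans _ _ (\sum_(j <- index_enum 'I_n)
    NN mu p (x => (vnorm (W x *m delta_mx j 0) * \1_Q x)%R))%E).
  apply: le_trans (Lnorm_sum_le muT _ p1 (fun j => mN (delta_mx j 0))
    (fun j => N0 (delta_mx j 0))).
  apply: le_Lnorm_ae => //.
  - by apply: measurable_funM => //; exact: measurable_mxnorm.
  - exact: measurable_sum.
  - by move=> x; rewrite mulr_ge0 ?mxnorm_ge0.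
  - by move=> x; apply: sumr_ge0.
  - apply: nearW => x; rewrite -mulr_suml ler_wpM2r//; exact: mxnorm_le_sum.
by apply: lte_sum_pinfty => j _; exact: weight_cst_lty.
Qed.

(** The image of a unit ball under averaging over Q: the convex set from which
vectors are separated. *)
Definition unit_means : set V := [set Qmean f | f in
  [set f : T -> V | [/\ measurable_mx f, forall x, ~ Q x -> f x = 0 &
    (NN mu p (x => vnorm (W x *m f x)) <= 1)%E]]].
Local Notation B := unit_means.

Lemma unit_means0 : B 0.
Proof.
have mz : @measurable_mx _ T _ _ _ _ (fun=> 0 : V) by move=> i j; exact: measurable_scalar_cst.
exists (fun=> 0).
  split; [exact: mz|by []|].
  rewrite (_ : Lnorm _ _ _ = 0%E)// -(Lnorm_cst0 mu p1); apply: eq_Lnorm => x.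
  by rewrite mulmx0 vnorm0.
have -> : gvintegral mu Q (fun=> 0) = 0 :> V; last by rewrite scaler0.
apply/matrixP => i j; rewrite ord1 [RHS]mxE; apply: re_im_inj.
  rewrite re_vintegral re0; under eq_Rintegral do rewrite mxE re0.
  by rewrite /Rintegral integral0.
rewrite im_vintegral im0; under eq_Rintegral do rewrite mxE im0.
by rewrite /Rintegral integral0.
Qed.

Let one_lty (f : T -> V) : (NN mu p (x => vnorm (W x *m f x)) <= 1)%E ->
  (NN mu p (x => vnorm (W x *m f x)) < +oo)%E.
Proof. by move=> /le_lt_trans; apply; exact: ltry. Qed.

Lemma unit_means_le w : B w -> (N w <= C%:E)%E.
Proof.
move=> [f [mf fQ f1] <-]; have [_] := mean_le mf fQ (one_lty f1).
move=> /le_trans; apply; rewrite -[leRHS]mule1; apply: lee_wpmul2l => //.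
by rewrite lee_fin ltW.
Qed.

Lemma unit_means_convex u w t : B u -> B w -> 0 <= t -> t <= 1 ->
  B (rs (1 - t) *: u + rs t *: w).
Proof.
move=> [f [mf fQ f1] <-] [g [mg gQ g1] <-] t0 t1.
have [fi _] := mean_le mf fQ (one_lty f1).
have [gi _] := mean_le mg gQ (one_lty g1).
have t10 : 0 <= 1 - t by rewrite subr_ge0.
have mh : measurable_mx (fun x => rs (1 - t) *: f x + rs t *: g x).
  by apply: measurable_mxD; apply: measurable_mx_scale => //; exact: measurable_scalar_cst.
exists (fun x => rs (1 - t) *: f x + rs t *: g x); last first.
  rewrite vintegral_lin// scalerDr !scalerA.
  by rewrite [rs m^-1 * _]mulrC [rs m^-1 * _]mulrC.
split => // [x xQ|]; first by rewrite fQ// gQ// !scaler0 addr0.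
have mWf := measurable_weight mW mf; have mWg := measurable_weight mW mg.
have mtf : measurable_fun setT (fun x => (1 - t) * vnorm (W x *m f x)).
  by apply: measurable_funM => //; exact: measurable_cst.
have mtg : measurable_fun setT (fun x => t * vnorm (W x *m g x)).
  by apply: measurable_funM => //; exact: measurable_cst.
have tf0 x : 0 <= (1 - t) * vnorm (W x *m f x) by rewrite mulr_ge0 ?vnorm_ge0.
have tg0 x : 0 <= t * vnorm (W x *m g x) by rewrite mulr_ge0 ?vnorm_ge0.
apply: (@le_trans _ _ (NN mu p (x =>
    ((1 - t) * vnorm (W x *m f x) + t * vnorm (W x *m g x))%R))).
  apply: le_Lnorm_ae => //.
  - exact: measurable_weight.
  - exact: measurable_funD.
  - by move=> x; exact: vnorm_ge0.
  - by move=> x; rewrite addr_ge0.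
  apply: nearW => x; rewrite mulmxDr -!scalemxAr.
  by apply: le_trans (vnormD _ _) _; rewrite !vnormZ !modulus_rs !ger0_norm.
apply: (le_trans (LnormD_le muT p1 mtf mtg tf0 tg0)).
rewrite !LnormZ//; last 2 first.
- by move=> x; exact: vnorm_ge0.
- by move=> x; exact: vnorm_ge0.
apply: (@le_trans _ _ ((1 - t)%:E * 1 + t%:E * 1)%E).
  by apply: leeD; apply: lee_wpmul2l => //; rewrite lee_fin.
by rewrite !mule1 -EFinD subrK.
Qed.

(** A mean w satisfies |w| <= |W^-1| |W w|, and |W^-1| is finite almost
everywhere; integrate the reciprocal of 1 + |W^-1| over Q. *)
Lemma unit_means_bounded : exists2 M : R, 0 <= M & forall w, B w -> vnorm w <= M.
Proof.
set I := fun x => invmx (W x).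
have mI : measurable_mx I by exact: measurable_mx_inv.
have mt := measurable_tame mI.
set tau := NN mu p (x => tame I x).
have tau0 : (0 < tau)%E.
  apply: (@Lnorm_gt0 _ _ _ _ _ _ Q) => //.
  by apply: nearW => x xQ; apply/eqP; rewrite gt_eqF// tame_gt0.
have taufin : tau \is a fin_num.
  rewrite ge0_fin_numE ?(ltW tau0)//; apply: le_lt_trans Lnorm_indic_lty.
  by apply: le_Lnorm_ae => //; apply: nearW => x; exact: tame_le1.
have ft0 : 0 < fine tau by rewrite fine_gt0// tau0 -ge0_fin_numE ?(ltW tau0).
exists (C / fine tau) => [|w Bw]; first by rewrite divr_ge0// ltW.
rewrite ler_pdivlMr// -lee_fin EFinM fineK//.
apply: le_trans (unit_means_le Bw); rewrite -LnormZ ?vnorm_ge0//.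
apply: le_Lnorm_ae => //.
- by apply: measurable_funM => //; exact: measurable_cst.
- by move=> x; rewrite mulr_ge0 ?vnorm_ge0.
apply: filterS pW => x px; have [xQ|xQ] := pselect (Q x); last first.
  by rewrite tame_off// mulr0.
rewrite indicE mem_set// mulr1 /tame indicE mem_set// mul1r.
rewrite ler_pdivrMr ?ltr_pwDl ?mxnorm_ge0//.
apply: le_trans (vnorm_le_inv _ px) _; rewrite mulrC ler_wpM2l ?vnorm_ge0//.
by rewrite lerDr.
Qed.

(** The functions f = phi W^-1 (W^-1 v) realize |W f| = psi and
f . v = psi |W^-1 v| for a prescribed psi, so that the converse of Hoelder's
inequality applies. *)
Lemma dual_Lnorm_le (v : V) (A : R) : 0 <= A -> (forall w, B w -> rdot w v <= A) ->
  (NN mu p' (x => (vnorm (invmx (W x) *m v) * \1_Q x)%R) <= (m * A)%:E)%E.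
Proof.
move=> A0 BA; set g := fun x => vnorm (invmx (W x) *m v).
have mg : measurable_fun setT g by exact: measurable_inv_weight_cst.
have g0 x : 0 <= g x by exact: vnorm_ge0.
(* psi is an arbitrary test function for the dual norm of h = |W^-1 v| 1_Q. *)
apply: (@hoelder_converse _ _ _ _ muT _ Q) => //.
- by rewrite muQ ltry.
- exact: measurable_funM.
- by move=> x; rewrite mulr_ge0 ?vnorm_ge0.
- by move=> x xQ; rewrite indicE memNset// mulr0.
- by rewrite mulr_ge0// ltW.
move=> psi mpsi psi0 psiQ Npsi.
pose phi x := psi x * (g x)^-1.
have mphi : measurable_fun setT phi.
  by apply: measurable_funM => //; exact: measurable_funV_ge0.
have phi0 x : 0 <= phi x by rewrite mulr_ge0// invr_ge0.
pose f x := rs (phi x) *: (invmx (W x) *m (invmx (W x) *m v)).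
have mI : measurable_mx (fun x => invmx (W x)) by exact: measurable_mx_inv.
have mf : measurable_mx f.
  apply: measurable_mx_scale; first exact: measurable_scalar_rs.
  by apply: measurable_mx_mul => //; apply: measurable_mx_mul => //; exact: measurable_mx_cst.
have fQ x : ~ Q x -> f x = 0.
  by move=> xQ; rewrite /f /phi psiQ// mul0r rs0 scale0r.
have phig x : phi x * g x <= psi x.
  have [gx|gx] := eqVneq (g x) 0; first by rewrite gx mulr0.
  by rewrite /phi mulfVK.
have Wf1 : (NN mu p (x => vnorm (W x *m f x)) <= 1)%E.
  apply: le_trans Npsi; apply: le_Lnorm_ae => //.
  - exact: measurable_weight.
  - by move=> x; exact: vnorm_ge0.
  apply: filterS pW => x px.
  rewrite /f -scalemxAr vnormZ modulus_rs ger0_norm//.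
  by rewrite (mulmxA (W x)) mulmxV ?posdef_unitmx// mul1mx.
have [fi _] := mean_le mf fQ (one_lty Wf1).
have Bf : B (Qmean f) by exists f.
have := BA _ Bf; rewrite rdotZl ler_pdivrMl// => H.
have [ri rE] := rdot_vintegral v mQ fi.
rewrite -lee_fin rE /Rintegral fineK in H; last exact: integrable_fin_num.
apply: le_trans H; rewrite le_eqVlt; apply/orP; left; apply/eqP.
rewrite [RHS]integral_mkcond; apply: ae_eq_integral => //.
- by apply/measurable_EFinP; apply: measurable_funM => //; exact: measurable_funM.
- by apply/(measurable_restrictT _ mQ); exact: measurable_int ri.
apply: filterS pW => x px _; rewrite patchE; case: ifPn => [xQ|/negP xQ]; last first.
  by rewrite psiQ ?mul0r// => /mem_set.
rewrite indicE xQ mulr1; congr EFin.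
rewrite /f rdotZl.
have -> : rdot (invmx (W x) *m (invmx (W x) *m v)) v = g x * g x.
  have hV : v = W x *m (invmx (W x) *m v).
    by rewrite (mulmxA (W x)) mulmxV ?posdef_unitmx// mul1mx.
  rewrite {2}hV -(rdot_hermitian _ _ px.1) (mulmxA (W x)) mulmxV ?posdef_unitmx// mul1mx.
  by rewrite -vnorm_sqr expr2.
rewrite -/(g x); have [gx|gx] := eqVneq (g x) 0; first by rewrite gx !mulr0.
by rewrite /phi mulrA mulfVK.
Qed.

(** The dual norm of each basis vector is finite because the unit means are
bounded. *)
Lemma inv_weight_lty : (NN mu p' (x => (mxnorm (invmx (W x)) * \1_Q x)%R) < +oo)%E.
Proof.
have [M M0 BM] := unit_means_bounded.
have mI (v : V) : measurable_fun setT (fun x => vnorm (invmx (W x) *m v) * \1_Q x).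
  by apply: measurable_funM => //; exact: measurable_inv_weight_cst.
have I0 (v : V) x : 0 <= vnorm (invmx (W x) *m v) * \1_Q x by rewrite mulr_ge0 ?vnorm_ge0.
apply: (@le_lt_trans _ _ (\sum_(j <- index_enum 'I_n)
    NN mu p' (x => (vnorm (invmx (W x) *m delta_mx j 0) * \1_Q x)%R))%E).
  apply: le_trans (Lnorm_sum_le muT _ p1' (fun j => mI (delta_mx j 0))
    (fun j => I0 (delta_mx j 0))).
  apply: le_Lnorm_ae => //.
  - by apply: measurable_funM => //; apply: measurable_mxnorm; exact: measurable_mx_inv.
  - exact: measurable_sum.
  - by move=> x; rewrite mulr_ge0 ?mxnorm_ge0.
  - by move=> x; apply: sumr_ge0.
  - apply: nearW => x; rewrite -mulr_suml ler_wpM2r//; exact: mxnorm_le_sum.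
apply: lte_sum_pinfty => j _.
set v : V := delta_mx j 0.
apply: (@le_lt_trans _ _ (m * (M * vnorm v))%:E); last exact: ltry.
apply: dual_Lnorm_le => [|w Bw]; first by rewrite mulr_ge0// vnorm_ge0.
by apply: le_trans (cauchy_schwarz _ _) _; rewrite ler_wpM2r ?vnorm_ge0// BM.
Qed.

(** Scale u so that its norm is twice the bound on the unit means, and separate
it from them. *)
Lemma dual_vector (u : V) : u != 0 -> exists2 v : V, v != 0 &
  (N u * NN mu p' (x => (vnorm (invmx (W x) *m v) * \1_Q x)%R) <=
    (2 * C * m * modulus (dot u v))%:E)%E.
Proof.
move=> u0; have Nu0 : (0 < N u)%E by exact: Lnorm_weight_gt0.
have Nfin : N u \is a fin_num.
  by rewrite ge0_fin_numE ?(ltW Nu0)//; exact: weight_cst_lty.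
have fN0 : 0 < fine (N u) by rewrite fine_gt0// Nu0 -ge0_fin_numE ?(ltW Nu0).
(* Then N z = 2 C, whereas the means have norm at most C. *)
pose t := 2 * C / fine (N u).
have t0 : 0 < t by rewrite divr_gt0// mulr_gt0.
pose z := rs t *: u.
have Nz : N z = (2 * C)%:E.
  by rewrite /z NZ gtr0_norm// -(fineK Nfin) -EFinM /t mulfVK// gt_eqF.
set La := NN mu p (x => (mxnorm (W x) * \1_Q x)%R).
have La0 : (0 <= La)%E by exact: Lnorm_ge0.
have Lafin : La \is a fin_num by rewrite ge0_fin_numE//; exact: weight_mxnorm_lty.
have fLa0 : 0 <= fine La by exact: fine_ge0.
have [M M0 BM] := unit_means_bounded.
have e0 : 0 < C / (fine La + 1) by rewrite divr_gt0// ltr_wpDl.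
have mL : measurable_fun setT (fun x => mxnorm (W x) * \1_Q x).
  by apply: measurable_funM => //; exact: measurable_mxnorm.
have dist w : B w -> C / (fine La + 1) <= vnorm (z - w).
  move=> Bw; have : (N z <= N w + (vnorm (z - w))%:E * La)%E.
    rewrite -LnormZ ?vnorm_ge0//; last first.
      by move=> x; rewrite mulr_ge0 ?mxnorm_ge0.
    have mzL : measurable_fun setT (fun x => vnorm (z - w) * (mxnorm (W x) * \1_Q x)).
      by apply: measurable_funM => //; exact: measurable_cst.
    have zL0 x : 0 <= vnorm (z - w) * (mxnorm (W x) * \1_Q x).
      by rewrite !mulr_ge0 ?vnorm_ge0 ?mxnorm_ge0.
    apply: le_trans (LnormD_le muT p1 (mN w) mzL (N0 w) zL0).
    apply: le_Lnorm_ae => //; first exact: measurable_funD.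
      by move=> x; rewrite addr_ge0.
    apply: nearW => x; rewrite mulrA -mulrDl ler_wpM2r//.
    rewrite -[z in leLHS](subrK w) mulmxDr addrC; apply: le_trans (vnormD _ _) _.
    by rewrite lerD2l mulrC vnorm_mulmx_le.
  rewrite Nz => /le_trans/(_ (leeD2r _ (unit_means_le Bw))).
  rewrite -(fineK Lafin) -EFinM -EFinD lee_fin => h.
  rewrite ler_pdivrMr ?ltr_wpDl//.
  have := vnorm_ge0 (z - w); move: h; rewrite mulrDr mulr1.
  set X := vnorm (z - w) * fine La; set Y := vnorm _; move=> *; lra.
have [v v0 vB] := separation (ex_intro _ 0 unit_means0) unit_means_convex BM e0 dist.
exists v => //.
have zv0 : 0 <= rdot z v by have := vB 0 unit_means0; rewrite rdot0l.
have := dual_Lnorm_le zv0 vB => /(lee_wpmul2l (ltW Nu0))/le_trans; apply.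
rewrite -(fineK Nfin) -EFinM lee_fin /z rdotZl.
have -> : fine (N u) * (m * (t * rdot u v)) = 2 * C * m * rdot u v.
  by rewrite /t; field; rewrite gt_eqF.
by rewrite ler_wpM2l ?rdot_le_modulus// mulr_ge0 ?mulr_ge0// ltW.
Qed.

End LowerBound.

(** * From the weak bound to the weight class *)

Section WeightedBalls.
Context (R : realType) (d n : nat) (k : ground).
Local Notation F := (ground_field R k).
Local Notation Rd := (euclid R d).
Local Notation V := 'cV[F]_n.
Local Notation mu := (lebesgue R d).
Local Notation rs := (real_scalar k).

(** For r = 0 the ball is reduced to the origin even when A is singular, so that
measurability can be tested on rational vectors. *)
Definition weighted_ball (A : 'M[F]_n) (r : R) : set V :=
  [set w | vnorm (A *m w) <= r /\ (r = 0 -> w = 0)].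

(** Closedness and convexity are those of the seminorm w |-> |A w|. *)
Lemma weighted_ball_convex (A : 'M[F]_n) (r : R) : 0 <= r ->
  convex_body (weighted_ball A r).
Proof.
move=> r0; split.
- by exists 0; split => //; rewrite mulmx0 vnorm0.
- move=> w /closure_vnormP clw; split.
    apply/ler_addgt0Pr => e e0.
    have A0 : 0 < mxnorm A + 1 by rewrite ltr_wpDl// mxnorm_ge0.
    have eA : 0 < e / (mxnorm A + 1) by rewrite divr_gt0.
    have [m] := ltr_add_invr eA; rewrite add0r => me.
    have [w' [w'r _] w'w] := clw m.
    rewrite -[w](subKr w') mulmxBr; apply: le_trans (vnormD _ _) _.
    rewrite vnormN lerD//; apply: le_trans (vnorm_mulmx_le _ _) _.
    have /ltW := lt_trans w'w me; rewrite ler_pdivlMr// => h.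
    apply: le_trans h; rewrite mulrC ler_wpM2l ?vnorm_ge0//.
    by rewrite lerDl.
  move=> r00; apply: vnorm_eq0; apply/eqP; rewrite eq_le vnorm_ge0 andbT.
  apply/ler_addgt0Pr => e e0; rewrite add0r.
  have [m] := ltr_add_invr e0; rewrite add0r => me.
  have [w' [_ w'0]] := clw m; rewrite w'0// sub0r vnormN => wm.
  exact: ltW (lt_trans wm me).
- move=> u w t /set_mem[ur u0] /set_mem[wr w0]; apply/mem_set.
  rewrite /conv/=; split; last first.
    by move=> r00; rewrite (u0 r00) (w0 r00) !scaler0 addr0.
  have tE : t%:num = rs (re (t%:num : F)) by rewrite rs_re_ge0.
  have t1E : unstable.onem (t%:num : F) = rs (1 - re (t%:num : F)).
    rewrite /unstable.onem {1}tE; apply: re_im_inj.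
      by rewrite reB re1 !re_rs.
    by rewrite imB im1 !im_rs subr0.
  have t0 : 0 <= re (t%:num : F) by rewrite re_ge0.
  have t1 : 0 <= 1 - re (t%:num : F).
    have : 0 <= 1 - (t%:num : F) by rewrite subr_ge0.
    by move=> /re_ge0; rewrite reB re1.
  rewrite t1E {1}tE mulmxDr -!scalemxAr; apply: le_trans (vnormD _ _) _.
  rewrite !vnormZ !modulus_rs !ger0_norm//.
  move: t0 t1; set s := re _ => s0 s1.
  have -> : r = s * r + (1 - s) * r by ring.
  by rewrite lerD// ler_wpM2l.
- move=> c u c1 [ur u0]; split; first by rewrite -scalemxAr vnormZ c1 mul1r.
  by move=> /u0 ->; rewrite scaler0.
Qed.

(** If a weighted ball of positive radius meets an open set, then shrinking a
common point slightly makes it interior, so that a rational vector will do. *)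
Lemma weighted_ball_meets (A : 'M[F]_n) (r : R) (E : set V) : 0 < r -> open E ->
  weighted_ball A r `&` E !=set0 <->
  exists a, E (ratvec R k a) /\ vnorm (A *m ratvec R k a) <= r.
Proof.
move=> r0 oE; split=> [[w [[wr _] Ew]]|[a [Ea ar]]]; last first.
  by exists (ratvec R k a); split => //; split => // r00; rewrite r00 ltxx in r0.
have /open_vnormP/(_ w Ew)[e e0 eE] := oE.
pose t := e / (2 * (e + vnorm w)).
have ew0 : 0 < e + vnorm w by rewrite ltr_pwDl// vnorm_ge0.
have t0 : 0 < t by rewrite divr_gt0// mulr_gt0.
have t12 : t <= 2^-1.
  rewrite /t invfM mulrCA ler_piMr// ler_pdivrMr// mul1r lerDl.
  exact: vnorm_ge0.
have tw : t * vnorm w < e.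
  rewrite /t mulrAC ltr_pdivrMr ?mulr_gt0// ltr_pM2l//.
  have := vnorm_ge0 w; lra.
pose w' := rs (1 - t) *: w.
have t1 : 0 <= 1 - t by rewrite subr_ge0 (le_trans t12)// invf_le1// ler1n.
have w'E : vnorm (w' - w) = t * vnorm w.
  have -> : w' - w = rs (- t) *: w.
    apply/matrixP => i j; rewrite !mxE.
    by apply: re_im_inj; rewrite ?(reB, imB, re_rsM, im_rsM); ring.
  by rewrite vnormZ modulus_rs normrN gtr0_norm.
have Aw' : vnorm (A *m w') < r.
  rewrite -scalemxAr vnormZ modulus_rs ger0_norm//.
  apply: (@le_lt_trans _ _ ((1 - t) * r)); first by rewrite ler_wpM2l.
  by rewrite mulrBl mul1r ltrBlDr ltrDl mulr_gt0.
have A0 : 0 < mxnorm A + 1 by rewrite ltr_wpDl// mxnorm_ge0.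
have s0 : 0 < Num.min (e - t * vnorm w) ((r - vnorm (A *m w')) / (mxnorm A + 1)).
  by rewrite lt_min subr_gt0 tw/= divr_gt0// subr_gt0.
have [a] := ratvec_dense w' s0.
rewrite lt_min => /andP[a1 a2]; exists a; split.
  apply: eE; rewrite -(subrKA w'); apply: le_lt_trans (vnormD _ _) _.
  by rewrite w'E -ltrBrDr.
rewrite -(subrK w' (ratvec R k a)) mulmxDr; apply: le_trans (vnormD _ _) _.
rewrite -lerBrDr; apply: le_trans (vnorm_mulmx_le _ _) _.
move/ltW: a2; rewrite ler_pdivlMr// => /(le_trans _); apply.
by rewrite mulrC ler_wpM2l ?vnorm_ge0// lerDl.
Qed.

Lemma weighted_ball_measurable (W : Rd -> 'M[F]_n) (r : Rd -> R) :
  measurable_mx W -> measurable_fun setT r -> (forall x, 0 <= r x) ->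
  measurable_body (fun x => weighted_ball (W x) (r x)).
Proof.
move=> mW mr r0; split=> [x|E oE]; first exact: weighted_ball_convex.
pose Z := [set x | r x = 0].
have mZ : measurable Z.
  have := measurable_fun_eqr mr (@measurable_cst _ _ _ _ setT (0 : R)).
  move=> /(_ measurableT [set true] Logic.I); rewrite setTI; congr measurable.
  by apply/seteqP; split => x /= /eqP.
pose S (a : {ffun 'I_n -> rat * rat}) := [set x | vnorm (W x *m ratvec R k a) <= r x].
have mS a : measurable (S a).
  have := measurable_fun_ler (measurable_weight_cst mW (ratvec R k a)) mr.
  by move=> /(_ measurableT [set true] Logic.I); rewrite setTI.
pose idx i : set Rd := if unpickle i is Some a then
  (if `[< E (ratvec R k a) >] then S a `\` Z else set0) else set0.
pose Z0 : set Rd := if `[< E 0 >] then Z else set0.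
rewrite (_ : [set x | _] = \bigcup_i idx i `|` Z0).
  apply: measurableU.
    apply: bigcupT_measurable => i; rewrite /idx; case: unpickle => [a|//].
    case: ifP => // _; exact: measurableD.
  by rewrite /Z0; case: ifP.
have Zball x : Z x -> weighted_ball (W x) (r x) 0.
  by move=> Zx; split => //; rewrite mulmx0 vnorm0.
apply/seteqP; split => x /=.
  have [Zx|Zx] := pselect (Z x).
    move=> [w [[_ w0] Ew]]; right; rewrite /Z0; move: Ew; rewrite w0// => E0.
    by case: asboolP.
  have rx : 0 < r x by rewrite lt_neqAle r0 andbT eq_sym; apply/eqP.
  move=> /(weighted_ball_meets _ rx oE)[a [Ea ax]]; left.
  exists (pickle a) => //; rewrite /idx pickleK; case: asboolP => // _.
case=> [[i _]|].
  rewrite /idx; case: unpickle => [a|//]; case: asboolP => // Ea [Sa Zx].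
  have rx : 0 < r x by rewrite lt_neqAle r0 andbT eq_sym; apply/eqP.
  by apply/(weighted_ball_meets _ rx oE); exists a.
by rewrite /Z0; case: asboolP => // E0 Zx; exists 0; split => //; exact: Zball.
Qed.

Section MeanBound.
Variables (p : \bar R) (W : Rd -> 'M[F]_n) (C : R).
Hypothesis p1 : (1 <= p)%E.
Hypothesis wW : matrix_weight W.
Let mW : measurable_mx W := borel_measurable_mx wW.1.
Let pW : {ae mu, forall x, posdef (W x)} := wW.2.
Let muT := lebesgueT_gt0 R d.
Hypothesis C0 : 0 < C.
Hypothesis L1loc : forall G, LpW_body p W G -> L1loc_body G.
Hypothesis WC : weak_bound p W C.

(** The weak bound for the body {w : |W w| <= |W f|}, of which f is a selection,
at the mean of f over a cube. *)
Lemma mean_le_of_weak (a : d.-tuple R) (l : R) (f : Rd -> V) : 0 < l ->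
  measurable_mx f -> (forall x, ~ cube a l x -> f x = 0) ->
  (NN mu p (x => vnorm (W x *m f x)) < +oo)%E ->
  vintegrable mu f /\
  (NN mu p (x => (vnorm (W x *m mean a l f) * \1_(cube a l) x)%R) <=
    C%:E * NN mu p (x => vnorm (W x *m f x)))%E.
Proof.
move=> l0 mf fQ Wf; pose G x := weighted_ball (W x) (vnorm (W x *m f x)).
have mWf : measurable_fun setT (fun x => vnorm (W x *m f x)).
  exact: (measurable_weight mW mf).
have Wf0 x : 0 <= vnorm (W x *m f x) by exact: vnorm_ge0.
have mG : measurable_body G by exact: (weighted_ball_measurable mW mWf Wf0).
have GN : (LpW_body_norm p W G <= NN mu p (x => vnorm (W x *m f x)))%E.
  apply: ge_ereal_sup => _ [g [bg gG] <-].
  apply: (le_Lnorm_ae muT p1 (measurable_weight mW (borel_measurable_mx bg)) mWf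
    (fun x => vnorm_ge0 _) Wf0).
  by apply: filterS gG => x [].
have GL : LpW_body p W G by split => //; exact: le_lt_trans GN Wf.
have fS : selections (restrict_body G (cube a l)) f.
  split; first exact: measurable_mx_borel.
  apply: filterS pW => x px; rewrite /restrict_body.
  case: ifPn => [xQ|/negP xQ]; last by apply: fQ => /mem_set.
  split => // /vnorm_eq0 Wfx.
  by rewrite -[f x]mul1mx -(mulVmx (posdef_unitmx px)) -mulmxA Wfx mulmx0.
split.
  have [_ L1] := L1loc GL; have [|K fK] := L1 (cube a l); first by exists a, l.
  by split => //; apply: le_lt_trans (fK f fS) _; exact: ltry.
have QE : cube a l `<=` [set y | maximal G y (mean a l f)].
  move=> x xQ; apply/maximalP => m; exists (a, l, f) => //.
  by split => //; rewrite subrr vnorm0 invr_gt0.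
apply: (@le_trans _ _ (weak_norm_at p W G (mean a l f))).
  have mE := measurable_maximal G (mean a l f).
  have mM : measurable_fun setT (fun x => vnorm (W x *m mean a l f)).
    exact: (measurable_weight_cst mW).
  rewrite weak_norm_atE; apply: (le_Lnorm_ae muT p1).
  - by apply: measurable_funM; [exact: mM|apply: measurable_indic; exact: measurable_cube].
  - by apply: measurable_funM; [exact: mM|exact: measurable_indic].
  - by move=> x; rewrite mulr_ge0 ?vnorm_ge0.
  - by move=> x; rewrite mulr_ge0 ?vnorm_ge0.
  apply: nearW => x; rewrite ler_wpM2l ?vnorm_ge0// !indicE.
  have [xQ|xQ] := pselect (cube a l x); last by rewrite memNset.
  by rewrite mem_set// mem_set//; exact: QE.
apply: (@le_trans _ _ (C%:E * LpW_body_norm p W G)%E); last first.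
  by apply: lee_wpmul2l => //; rewrite lee_fin ltW.
apply: le_trans (WC GL); apply: ereal_sup_ubound.
by exists (mean a l f).
Qed.

Lemma inv_Lploc_of_weak : inv_Lploc (hoelder_conjugate p) W.
Proof.
move=> _ [a [l [l0 ->]]].
apply: (@inv_weight_lty _ _ _ _ _ mu muT p W (cube a l) (l ^+ d) C p1 mW pW) => //.
- exact: measurable_cube.
- by rewrite exprn_gt0.
- by rewrite lebesgue_cube// ltW.
- by move=> f; exact: mean_le_of_weak.
Qed.

Lemma Ap_bound_of_weak : (0 < n)%N -> Ap_bound p W (2 * C).
Proof.
move=> n0; apply/Ap_boundP => // a l l0 u; have [->|u0] := eqVneq u 0.
  exists (const_mx 1).
    apply/eqP => /matrixP/(_ (Ordinal n0) 0); rewrite !mxE => /eqP.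
    by rewrite oner_eq0.
  rewrite (_ : Lnorm mu p _ = 0%E).
    by rewrite mul0e lee_fin !mulr_ge0 ?modulus_ge0 ?exprn_ge0// ltW.
  rewrite -(Lnorm_cst0 mu p1); apply: eq_Lnorm => x.
  by rewrite mulmx0 vnorm0 mul0r.
apply: (@dual_vector _ _ _ _ _ mu muT p W (cube a l) (l ^+ d) C p1 mW pW) => //.
- exact: measurable_cube.
- by rewrite exprn_gt0.
- by rewrite lebesgue_cube// ltW.
- by move=> f; exact: mean_le_of_weak.
Qed.

End MeanBound.
End WeightedBalls.

(** Transports a comparison of admissible constants to their infima. *)
Lemma inf_le_scaled (R : realType) (A B : set R) (c : R) : 0 < c -> B !=set0 ->
  (forall x, A x -> 0 <= x) -> (forall x, B x -> A (c * x)) -> inf A <= c * inf B.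
Proof.
move=> c0 B0 A0 BA; rewrite mulrC -ler_pdivrMr//.
apply: lb_le_inf => // x Bx; rewrite ler_pdivrMr// mulrC.
by apply: ge_inf; [exists 0 => y; exact: A0|exact: BA].
Qed.

Theorem corollaryF (R : realType) (d n : nat) (hd : (1 <= d)%N) (hn : (1 <= n)%N) :
  exists2 c : R, 0 < c &
    forall (k : ground) (p : \bar R) (W : euclid R d -> 'M[ground_field R k]_n),
      (1 <= p)%E -> matrix_weight W ->
      (Ap p W <-> maximal_weak_type p W) /\
      (Ap p W ->
        Ap_const p W <= c * maximal_weak_norm p W /\
        maximal_weak_norm p W <= c * Ap_const p W).
Proof.
have d0 : 1 <= 3 ^+ d :> R by rewrite exprn_ege1// ler1n.
have d3 : 0 < 3 ^+ d :> R by exact: lt_le_trans d0.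
exists (2 * 3 ^+ d) => [|k p W p1 wW]; first by rewrite mulr_gt0.
have up C : inv_Lploc (hoelder_conjugate p) W -> 0 < C /\ Ap_bound p W C ->
    0 < 2 * 3 ^+ d * C /\ weak_bound p W (2 * 3 ^+ d * C).
  move=> iW [C0 WC]; split; first by rewrite !mulr_gt0.
  by rewrite -mulrA; exact: weak_bound_of_Ap.
have iff : Ap p W <-> maximal_weak_type p W.
  split=> [[iW [C C0 WC]]|[L1 [C C0 WC]]]; split.
  - by move=> G; exact: L1loc_of_LpW.
  - by have [] := up C iW (conj C0 WC); exists (2 * 3 ^+ d * C).
  - exact: inv_Lploc_of_weak WC.
  - by exists (2 * C); [rewrite mulr_gt0|exact: Ap_bound_of_weak].
split=> // WA; have [iW [C C0 WC]] := WA; have [L1 [C' C'0 WC']] := iff.1 WA.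
split; apply: inf_le_scaled.
- by rewrite mulr_gt0.
- by exists C'.
- by move=> x [/ltW].
- move=> x [x0 Wx]; split; first by rewrite !mulr_gt0.
  have := Ap_bound_of_weak p1 wW x0 L1 Wx hn.
  move=> H Q cQ u; have [v v0 vx] := H Q cQ u; exists v => //.
  apply: le_trans vx _; rewrite lee_fin ler_wpM2r ?modulus_ge0//.
  by rewrite ler_wpM2r ?(ltW x0)// ler_peMr.
- by rewrite mulr_gt0.
- by exists C.
- by move=> x [/ltW].
- by move=> x; exact: up.
Qed.
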